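(* Let $f_1,\dots,f_h$ ($h\ge 2$) be germs of biholomorphisms of $\mathbb{C}^n$ fixing the origin, each formally linearizable, with simultaneously diagonalizable linear parts, and satisfying the simultaneous Brjuno condition. Then $f_1,\dots,f_h$ are simultaneously holomorphically linearizable (there is a germ of biholomorphism $\varphi$ with $\varphi(0)=0$ and $\varphi^{-1}\circ f_k\circ\varphi$ linear for all $k$) if and only if $f_p\circ f_q=f_q\circ f_p$ for all $p,q\in\{1,\dots,h\}$.
   Context: Formally linearizable: there is an invertible formal power series map $\varphi$, $\varphi(0)=0$, with $\varphi^{-1}\circ f\circ\varphi$ linear. Let $\Lambda_k=(\lambda_{k,1},\dots,\lambda_{k,n})$ be the eigenvalues of the linear part of $f_k$ listed along a common eigenbasis. For $Q\in\mathbb{N}^n$ write $|Q|=\sum q_i$, $\Lambda_k^Q=\prod_i\lambda_{k,i}^{q_i}$, and $\mathrm{Res}_j(\Lambda_k)=\{Q:|Q|\ge2,\ \Lambda_k^Q=\lambda_{k,j}\}$. Set $\varepsilon_Q=\min_{1\le j\le n}\max_{1\le k\le h}|\Lambda_k^Q-\lambda_{k,j}|$ and, for $m\ge2$, $\omega(m)=\min\{\varepsilon_Q: 2\le|Q|\le m,\ Q\notin\bigcap_{k=1}^h\bigcap_{j=1}^n\mathrm{Res}_j(\Lambda_k)\}$ (convention $\log(1/0)=+\infty$). The simultaneous Brjuno condition holds if there is a strictly increasing sequence of integers $(p_\nu)_{\nu\ge0}$ with $p_0=1$ such that $\sum_{\nu\ge0}\frac1{p_\nu}\log\frac1{\omega(p_{\nu+1})}<+\infty$.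 *)

(* Defs.v *)
(* complex numbers as pairs of Stdlib reals; holomorphic germs
   fixing 0 in C^n are modelled as n-tuples of convergent power series in n
   variables (multi-indices = lists of naturals of length n). *)
From Stdlib Require Import Reals Lra List.
Import ListNotations.
Open Scope R_scope.

Definition C := (R * R)%type.
Definition C0 : C := (0, 0).
Definition C1 : C := (1, 0).
Definition Cadd (x y : C) : C := (fst x + fst y, snd x + snd y).
Definition Copp (x : C) : C := (- fst x, - snd x).
Definition Csub (x y : C) : C := Cadd x (Copp y).
Definition Cmul (x y : C) : C :=
  (fst x * fst y - snd x * snd y, fst x * snd y + snd x * fst y).
Definition Cnorm (x : C) : R := sqrt (fst x ^ 2 + snd x ^ 2).
Fixpoint Cpow (x : C) (k : nat) : C :=
  match k with O => C1 | S k' => Cmul x (Cpow x k') end.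
Definition Csum (l : list C) : C := fold_right Cadd C0 l.
Definition Ceqb (x y : C) : bool :=
  if Req_EM_T (fst x) (fst y) then
    if Req_EM_T (snd x) (snd y) then true else false
  else false.

Definition Rsum (l : list R) : R := fold_right Rplus 0 l.
Definition list_max (l : list R) : R :=
  match l with [] => 0 | x :: l' => fold_right Rmax x l' end.
Definition list_min (l : list R) : R :=
  match l with [] => 0 | x :: l' => fold_right Rmin x l' end.

(* a multi-index Q in N^n is a list of length n; |Q| = deg Q *)
Definition deg (Q : list nat) : nat := fold_right Nat.add 0%nat Q.

Fixpoint mindices (n d : nat) : list (list nat) :=
  match n with
  | O => if Nat.eqb d 0 then [[]] else []
  | S n' => flat_map (fun k => map (cons k) (mindices n' (d - k)))
                     (seq 0 (S d))
  end.

Definition mindices_le (n d : nat) : list (list nat) :=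
  flat_map (mindices n) (seq 0 (S d)).

Fixpoint mbelow (Q : list nat) : list (list nat) :=
  match Q with
  | [] => [[]]
  | q :: Q' => flat_map (fun k => map (cons k) (mbelow Q')) (seq 0 (S q))
  end.

Fixpoint msub (Q P : list nat) : list nat :=
  match Q, P with
  | q :: Q', p :: P' => (q - p)%nat :: msub Q' P'
  | _, _ => Q
  end.

Definition unitQ (n j : nat) : list nat :=
  map (fun i => if Nat.eqb i j then 1%nat else 0%nat) (seq 0 n).

(* only the values on multi-indices of length n are meaningful *)
Definition series := list nat -> C.

Definition sone : series :=
  fun Q => if forallb (Nat.eqb 0) Q then C1 else C0.

Definition smul (F G : series) : series :=
  fun Q => Csum (map (fun P => Cmul (F P) (G (msub Q P))) (mbelow Q)).

Fixpoint spow (F : series) (k : nat) : series :=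
  match k with O => sone | S k' => smul F (spow F k') end.

Fixpoint smono_aux (F : nat -> series) (i : nat) (P : list nat) : series :=
  match P with
  | [] => sone
  | p :: P' => smul (spow (F i) p) (smono_aux F (S i) P')
  end.
Definition smono (F : nat -> series) (P : list nat) : series := smono_aux F 0 P.

(* formal maps C^n -> C^n : component j (j < n) is a series *)
Definition pmap := nat -> series.

Definition fix0 (n : nat) (F : pmap) : Prop :=
  forall j, (j < n)%nat -> F j (repeat 0%nat n) = C0.

(* composition G o F (meaningful when F(0) = 0) *)
Definition pcomp (n : nat) (G F : pmap) : pmap :=
  fun j Q => Csum (map (fun P => Cmul (G j P) (smono F P Q))
                       (mindices_le n (deg Q))).

Definition sid (n : nat) : pmap :=
  fun j Q => if list_eq_dec Nat.eq_dec Q (unitQ n j) then C1 else C0.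

Definition meq (n : nat) (F G : pmap) : Prop :=
  forall j Q, (j < n)%nat -> length Q = n -> F j Q = G j Q.

Definition is_linear (n : nat) (F : pmap) : Prop :=
  fix0 n F /\
  forall j Q, (j < n)%nat -> length Q = n -> (2 <= deg Q)%nat -> F j Q = C0.

Definition conv_series (n : nat) (F : series) : Prop :=
  exists r M, 0 < r /\
    forall d, Rsum (map (fun Q => Cnorm (F Q) * r ^ deg Q) (mindices_le n d)) <= M.

Definition conv_map (n : nat) (F : pmap) : Prop :=
  forall j, (j < n)%nat -> conv_series n (F j).

Definition biholo (n : nat) (F : pmap) : Prop :=
  fix0 n F /\ conv_map n F /\
  exists G, fix0 n G /\ conv_map n G /\
    meq n (pcomp n G F) (sid n) /\ meq n (pcomp n F G) (sid n).

Definition formally_linearizable (n : nat) (f : pmap) : Prop :=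
  exists phi psi, fix0 n phi /\ fix0 n psi /\
    meq n (pcomp n psi phi) (sid n) /\ meq n (pcomp n phi psi) (sid n) /\
    is_linear n (pcomp n psi (pcomp n f phi)).

Definition simult_holo_linearizable (n h : nat) (f : nat -> pmap) : Prop :=
  exists phi psi, fix0 n phi /\ fix0 n psi /\ conv_map n phi /\ conv_map n psi /\
    meq n (pcomp n psi phi) (sid n) /\ meq n (pcomp n phi psi) (sid n) /\
    forall k, (k < h)%nat -> is_linear n (pcomp n psi (pcomp n (f k) phi)).

Definition linpart (n : nat) (F : pmap) (i l : nat) : C := F i (unitQ n l).

Definition matmul (n : nat) (A B : nat -> nat -> C) (i j : nat) : C :=
  Csum (map (fun l => Cmul (A i l) (B l j)) (seq 0 n)).
Definition idmat (i j : nat) : C := if Nat.eqb i j then C1 else C0.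

Definition common_eigenbasis (n h : nat) (f : nat -> pmap)
    (P : nat -> nat -> C) (Lam : nat -> nat -> C) : Prop :=
  (exists Pinv, forall i j, (i < n)%nat -> (j < n)%nat ->
      matmul n P Pinv i j = idmat i j /\ matmul n Pinv P i j = idmat i j) /\
  forall k i j, (k < h)%nat -> (i < n)%nat -> (j < n)%nat ->
    matmul n (linpart n (f k)) P i j = Cmul (P i j) (Lam k j).

Fixpoint cmono_aux (lam : nat -> C) (i : nat) (Q : list nat) : C :=
  match Q with
  | [] => C1
  | q :: Q' => Cmul (Cpow (lam i) q) (cmono_aux lam (S i) Q')
  end.
Definition cmono (lam : nat -> C) (Q : list nat) : C := cmono_aux lam 0 Q.

Definition fully_resonant (n h : nat) (Lam : nat -> nat -> C) (Q : list nat) : bool :=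
  forallb (fun k => forallb (fun j => Ceqb (cmono (Lam k) Q) (Lam k j)) (seq 0 n))
          (seq 0 h).

Definition eps (n h : nat) (Lam : nat -> nat -> C) (Q : list nat) : R :=
  list_min (map (fun j =>
     list_max (map (fun k => Cnorm (Csub (cmono (Lam k) Q) (Lam k j))) (seq 0 h)))
    (seq 0 n)).

(* omega(m); None encodes min of the empty set = +infinity *)
Definition omega (n h : nat) (Lam : nat -> nat -> C) (m : nat) : option R :=
  match map (eps n h Lam)
          (filter (fun Q => negb (fully_resonant n h Lam Q))
                  (flat_map (mindices n) (seq 2 (m - 1)))) with
  | [] => None
  | x :: l => Some (fold_right Rmin x l)
  end.

Definition brjuno_term (n h : nat) (Lam : nat -> nat -> C) (p : nat -> nat)
    (v : nat) : R :=
  match omega n h Lam (p (S v)) with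
  | Some w => / INR (p v) * ln (/ w)
  | None => 0
  end.

(* sum_v (1/p_v) log(1/omega(p_{v+1})) < +infinity, with log(1/0) = +infinity
   and log(1/(+infinity)) = -infinity *)
Definition brjuno (n h : nat) (Lam : nat -> nat -> C) : Prop :=
  exists p : nat -> nat, p 0%nat = 1%nat /\ (forall v, (p v < p (S v))%nat) /\
    ((exists v, omega n h Lam (p (S v)) = None) \/
     ((forall v, exists w, omega n h Lam (p (S v)) = Some w /\ 0 < w) /\
      exists M, forall N, Rsum (map (brjuno_term n h Lam p) (seq 0 N)) <= M)).

(* Main.v *)
(** Idea. Write the maps in a common eigenbasis, [g_k = Lam_k + ...], and look
    for [phi = id + ...] with [g_k o phi = phi o Lam_k] for all [k]. At a
    multi-index [Q] that is not fully resonant, the equation with the largest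
    divisor [Lam_k^Q - lam_(k,j)] determines [phi_(j,Q)]; at a fully resonant
    [Q], put [phi_(j,Q) = 0]. Let [E_k = g_k o phi - phi o Lam_k]. In its lowest
    degree, commutation gives
    [(Lam_k^Q - lam_(k,j)) E_(l,j,Q) = (Lam_l^Q - lam_(l,j)) E_(k,j,Q)], so the
    equations that were not used hold too. A fully resonant [Q] forces all
    linear parts to be scalar, and then formal linearizability of [g_k] kills
    [E_(k,j,Q)].

    For convergence, the divisors are absorbed in a weight [T] such that
    [T P * T P' <= T (P + P')], also after division of the left side by
    [eps (P + P')], and [T Q <= A ^ |Q|]. The norm [sum |phi_Q| r^|Q| / T Q],
    truncated at degree [D], then satisfies a contraction estimate and stays
    bounded as [D] grows. If [eps] is bounded below (in particular if some [Q]
    is fully resonant: then all eigenvalues are roots of unity), [T] is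
    geometric. Otherwise [log T Q] is the supremum over binary decompositions
    of [Q] of the sum of [log (1 / eps)] over the nodes. Two nodes with small
    divisors for the same [j] at scale [p_(v+1)] on one branch differ by a
    multi-index of degree at least [p_(v+1)], so a decomposition has at most
    [2 |Q| / p_(v+1)] of them for each [j], and the Brjuno series bounds
    [log T Q / |Q|].

    Conversely the linearized maps are linear with simultaneously diagonalizable
    matrices, so they commute. *)

Require Import Defs.
From Stdlib Require Import Reals List.
From Stdlib Require Import Lra Lia Classical ClassicalEpsilon Setoid.
From HB Require Import structures.
From mathcomp Require Import ssreflect ssrfun ssrbool eqtype ssrnat seq bigop.
From mathcomp Require Import zify_ssreflect.
From Coquelicot Require Complex Lub.
Import Defs.

Set Implicit Arguments.
Unset Strict Implicit.
Unset Printing Implicit Defensive.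

(* Finite sums and norms of complex numbers *)
Declare Scope cplx_scope.
Delimit Scope cplx_scope with cx.
Notation "x + y" := (Cadd x y) : cplx_scope.
Notation "x * y" := (Cmul x y) : cplx_scope.
Notation "x - y" := (Csub x y) : cplx_scope.
Notation "- x" := (Copp x) : cplx_scope.

(** [C] and its operations are convertible to the complex numbers of Coquelicot, so the facts on
    ring laws, modulus and inverse transfer by [exact]. *)
Lemma Cring_theory : ring_theory C0 C1 Cadd Cmul Csub Copp (@eq C).
Proof. exact: Complex.C_ring_theory. Qed.
Add Ring Cring : Cring_theory.

Lemma CaddA : associative Cadd. Proof. by move=> x y z; ring. Qed.
Lemma CaddC : commutative Cadd. Proof. by move=> x y; ring. Qed.
Lemma Cadd0 : left_id C0 Cadd. Proof. by move=> x; ring. Qed.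
Lemma Cmul0x : left_zero C0 Cmul. Proof. by move=> x; ring. Qed.
Lemma Cmulx0 : right_zero C0 Cmul. Proof. by move=> x; ring. Qed.
Lemma CmulDl : left_distributive Cmul Cadd. Proof. by move=> x y z; ring. Qed.
Lemma CmulDr : right_distributive Cmul Cadd. Proof. by move=> x y z; ring. Qed.
HB.instance Definition _ := Monoid.isComLaw.Build C C0 Cadd CaddA CaddC Cadd0.
HB.instance Definition _ := Monoid.isMulLaw.Build C C0 Cmul Cmul0x Cmulx0.
HB.instance Definition _ :=
  Monoid.isAddLaw.Build C Cmul Cadd CmulDl CmulDr.

Lemma RaddA : associative Rplus. Proof. by move=> x y z; ring. Qed.
Lemma RaddC : commutative Rplus. Proof. by move=> x y; ring. Qed.
Lemma Radd0 : left_id 0%R Rplus. Proof. by move=> x; ring. Qed.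
Lemma Rmul0x : left_zero 0%R Rmult. Proof. by move=> x; ring. Qed.
Lemma Rmulx0 : right_zero 0%R Rmult. Proof. by move=> x; ring. Qed.
Lemma RmulDl : left_distributive Rmult Rplus. Proof. by move=> x y z; ring. Qed.
Lemma RmulDr : right_distributive Rmult Rplus. Proof. by move=> x y z; ring. Qed.
HB.instance Definition _ := Monoid.isComLaw.Build R 0%R Rplus RaddA RaddC Radd0.
HB.instance Definition _ := Monoid.isMulLaw.Build R 0%R Rmult Rmul0x Rmulx0.
HB.instance Definition _ :=
  Monoid.isAddLaw.Build R Rmult Rplus RmulDl RmulDr.

Notation "\csum_ ( i <- r | P ) F" := (\big[Cadd/C0]_(i <- r | P%B) F%cx)
  (at level 41, F at level 41, i, r at level 50) : cplx_scope.
Notation "\csum_ ( i <- r ) F" := (\big[Cadd/C0]_(i <- r) F%cx)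
  (at level 41, F at level 41, i, r at level 50) : cplx_scope.
Notation "\rsum_ ( i <- r | P ) F" := (\big[Rplus/0%R]_(i <- r | P%B) F%R)
  (at level 41, F at level 41, i, r at level 50) : R_scope.
Notation "\rsum_ ( i <- r ) F" := (\big[Rplus/0%R]_(i <- r) F%R)
  (at level 41, F at level 41, i, r at level 50) : R_scope.
Open Scope cplx_scope.
Open Scope R_scope.

Lemma CsumE (T : Type) (l : list T) (F : T -> C) :
  Csum (List.map F l) = (\csum_(x <- l) F x)%cx.
Proof.
by elim: l => [|x l IH]; rewrite ?big_nil // big_cons -IH.
Qed.

Lemma RsumE (T : Type) (l : list T) (F : T -> R) :
  Rsum (List.map F l) = \rsum_(x <- l) F x.
Proof.
by elim: l => [|x l IH]; rewrite ?big_nil // big_cons -IH.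
Qed.

Lemma rsum_le (T : eqType) (l : seq T) (P : pred T) (F G : T -> R) :
  (forall x, x \in l -> P x -> F x <= G x) ->
  \rsum_(x <- l | P x) F x <= \rsum_(x <- l | P x) G x.
Proof.
elim: l => [|x l IH] H; first by rewrite !big_nil; lra.
have Hl : forall y, y \in l -> P y -> F y <= G y.
  by move=> y Hy; apply: H; rewrite inE Hy orbT.
have {}IH := IH Hl.
rewrite !big_cons; case: ifP => // Px.
by have := H x (mem_head _ _) Px; lra.
Qed.

Lemma rsum_ge0 (T : eqType) (l : seq T) (P : pred T) (F : T -> R) :
  (forall x, x \in l -> P x -> 0 <= F x) -> 0 <= \rsum_(x <- l | P x) F x.
Proof.
move=> H; elim: l H => [|x l IH] H; first by rewrite big_nil; lra.
have Hl : forall y, y \in l -> P y -> 0 <= F y.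
  by move=> y Hy; apply: H; rewrite inE Hy orbT.
have {}IH := IH Hl.
rewrite big_cons; case: ifP => // Px.
by have := H x (mem_head _ _) Px; lra.
Qed.

Lemma rsum_le_cond (T : eqType) (l : seq T) (P P' : pred T) (F : T -> R) :
  (forall x, x \in l -> 0 <= F x) -> (forall x, x \in l -> P x -> P' x) ->
  \rsum_(x <- l | P x) F x <= \rsum_(x <- l | P' x) F x.
Proof.
move=> F0 PP'; rewrite big_mkcond [X in _ <= X]big_mkcond.
apply: rsum_le => x xl _; have := F0 x xl; have := PP' x xl.
by case: (P x); case: (P' x) => //; try lra; move=> H; have := H isT.
Qed.

Lemma rsum_single (T : eqType) (l : seq T) (F : T -> R) x :
  (forall y, y \in l -> 0 <= F y) -> x \in l -> F x <= \rsum_(y <- l) F y.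
Proof.
move=> F0 xl; rewrite (perm_big _ (perm_to_rem xl)) big_cons /=.
have : 0 <= \rsum_(y <- rem x l) F y; last lra.
by apply: rsum_ge0 => y /mem_rem /F0.
Qed.

Lemma rsum_const (T : eqType) (l : seq T) (c : R) :
  \rsum_(x <- l) c = INR (size l) * c.
Proof.
elim: l => [|x l IH]; first by rewrite big_nil Rmult_0_l.
by rewrite big_cons IH (_ : size (x :: l) = (size l).+1) // S_INR; ring.
Qed.

Lemma Cnorm_ge0 x : 0 <= Cnorm x. Proof. exact: Complex.Cmod_ge_0. Qed.
Lemma Cnorm0 : Cnorm C0 = 0. Proof. exact: Complex.Cmod_0. Qed.
Lemma Cnorm1 : Cnorm C1 = 1. Proof. exact: Complex.Cmod_1. Qed.
Lemma CnormM x y : Cnorm (x * y)%cx = Cnorm x * Cnorm y.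
Proof. exact: Complex.Cmod_mult. Qed.
Lemma CnormN x : Cnorm (- x)%cx = Cnorm x. Proof. exact: Complex.Cmod_opp. Qed.
Lemma CnormD x y : Cnorm (x + y)%cx <= Cnorm x + Cnorm y.
Proof. exact: Complex.Cmod_triangle. Qed.
Lemma CnormB x y : Cnorm (x - y)%cx <= Cnorm x + Cnorm y.
Proof. by rewrite -(CnormN y); apply: CnormD. Qed.
Lemma Cnorm_eq0 x : Cnorm x = 0 -> x = C0.
Proof. exact: Complex.Cmod_eq_0. Qed.

Lemma Cnorm_sum (T : Type) (l : seq T) (P : pred T) (F : T -> C) :
  Cnorm (\csum_(x <- l | P x) F x)%cx <= \rsum_(x <- l | P x) Cnorm (F x).
Proof.
elim: l => [|x l IH]; first by rewrite !big_nil Cnorm0; lra.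
rewrite !big_cons; case: ifP => // _.
by have := CnormD (F x) (\csum_(y <- l | P y) F y)%cx; lra.
Qed.

Lemma Cnorm_gt0 x : x <> C0 -> 0 < Cnorm x.
Proof.
move=> H; have := Cnorm_ge0 x.
by case: (Req_dec (Cnorm x) 0) => [/Cnorm_eq0 //|]; lra.
Qed.

Lemma CmulVx x : x <> C0 -> (Complex.Cinv x * x)%cx = C1.
Proof. exact: Complex.Cinv_l. Qed.

Lemma CnormV x : x <> C0 -> Cnorm (Complex.Cinv x) = / Cnorm x.
Proof. exact: Complex.Cmod_inv. Qed.

Lemma Cmul_integral x y : (x * y)%cx = C0 -> x <> C0 -> y = C0.
Proof.
move=> xy0 x0; have -> : y = (Complex.Cinv x * x * y)%cx.
  by rewrite CmulVx //; ring.
by rewrite (_ : (_ * _ * y)%cx = (Complex.Cinv x * (x * y))%cx);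
  [rewrite xy0; ring | ring].
Qed.

Lemma Csub0_eq x y : (x - y)%cx = C0 -> x = y.
Proof. by move=> H; rewrite (_ : x = (x - y) + y)%cx; [rewrite H; ring|ring]. Qed.

Lemma Cadd_fix x y : x = (x + y)%cx -> y = C0.
Proof. by move=> H; rewrite (_ : y = (x + y) - x)%cx; [rewrite -H; ring|ring]. Qed.

(** * Multi-indices *)

Definition madd (P Q : seq nat) : seq nat := [seq (x.1 + x.2)%N | x <- zip P Q].
Notation zeroQ n := (repeat 0%N n).
Notation idx := mindices_le.

Lemma size_madd n P Q : size P = n -> size Q = n -> size (madd P Q) = n.
Proof. by move=> sP sQ; rewrite size_map size_zip sP sQ minnn. Qed.

Lemma maddC : commutative madd.
Proof. by elim=> [|p P IH] [|q Q] //; rewrite /madd /= -/(madd _ _) addnC IH. Qed.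

Lemma maddA : associative madd.
Proof.
elim=> [|p P IH] [|q Q] [|s S] //.
by rewrite /madd /= -!/(madd _ _) addnA IH.
Qed.

Lemma deg_cons q Q : deg (q :: Q) = (q + deg Q)%N.
Proof. by []. Qed.

Lemma deg_madd P Q : size P = size Q -> deg (madd P Q) = (deg P + deg Q)%N.
Proof.
elim: P Q => [|p P IH] [|q Q] //= [] /IH E.
by rewrite /madd /= -/(madd _ _) E; lia.
Qed.

Lemma size_zeroQ n : size (zeroQ n) = n.
Proof. by elim: n => //= n ->. Qed.

Lemma deg_zeroQ n : deg (zeroQ n) = 0%N.
Proof. by elim: n. Qed.

Lemma madd0Q n Q : size Q = n -> madd (zeroQ n) Q = Q.
Proof.
by move=> <-; elim: Q => [|q Q IH] //=; rewrite /madd /= -/(madd _ _) IH.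
Qed.

Lemma deg0_zeroQ Q : deg Q = 0%N -> Q = zeroQ (size Q).
Proof. by elim: Q => [|[|q] Q IH] //= /IH {1}->. Qed.

Lemma madd_injl n P Q Q' : size P = n -> size Q = n -> size Q' = n ->
  madd P Q = madd P Q' -> Q = Q'.
Proof.
elim: P Q Q' n => [|p P IH] [|q Q] [|q' Q'] [|n] //= [sP] [sQ] [sQ'] [pq E].
by congr (_ :: _); [lia | apply: (IH _ _ n)].
Qed.

Lemma seq_iota m n : List.seq m n = iota m n.
Proof. by elim: n m => //= n IH m; rewrite IH. Qed.

Lemma In_mem (T : eqType) (x : T) (l : seq T) : List.In x l <-> x \in l.
Proof.
elim: l => //= y l IH; rewrite inE; split.
  by case=> [->|/IH ->]; rewrite ?eqxx ?orbT.
by case/orP=> [/eqP ->|/IH]; [left | right].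
Qed.

Lemma uniq_flat_map (T U : eqType) (F : T -> seq U) (l : seq T) :
  uniq l -> (forall x, x \in l -> uniq (F x)) ->
  (forall x y z, z \in F x -> z \in F y -> x = y) ->
  uniq (List.flat_map F l).
Proof.
move=> ul uF dF; elim: l ul uF => //= x l IH /andP[xl ul] uF.
rewrite cat_uniq uF ?mem_head //= IH //; last first.
  by move=> y yl; apply: uF; rewrite inE yl orbT.
rewrite andbT; apply/hasPn => z /In_mem /in_flat_map[y [/In_mem yl /In_mem zy]].
by apply/negP => zx; rewrite (dF _ _ _ zx zy) yl in xl.
Qed.

Lemma mem_flat_map (T U : eqType) (F : T -> seq U) (l : seq T) z :
  reflect (exists2 x, x \in l & z \in F x) (z \in List.flat_map F l).
Proof.
apply: (iffP idP) => [/In_mem /in_flat_map [x [/In_mem ? /In_mem ?]]|[x xl zx]].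
  by exists x.
by apply/In_mem/in_flat_map; exists x; split; apply/In_mem.
Qed.

Lemma mem_cons_map (k : nat) (l : seq (seq nat)) q Q :
  (q :: Q \in List.map (cons k) l) = (q == k) && (Q \in l).
Proof.
apply/idP/andP => [/In_mem/in_map_iff [S [[-> <-] /In_mem Sl]]|[/eqP ->]] //.
by move=> /In_mem Ql; apply/In_mem/in_map.
Qed.

Lemma mem_mindices n d Q : (Q \in mindices n d) = (size Q == n) && (deg Q == d).
Proof.
elim: n d Q => [|n IH] d Q.
  rewrite /mindices; case: Nat.eqb_spec => [->|dn0].
    by case: Q.
  by case: Q => //=; case: eqP => // E; case: dn0.
case: Q => [|q Q]; rewrite [mindices _ _]/mindices -/mindices.
  by apply/mem_flat_map => -[k _ /In_mem/in_map_iff[]] ? [].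
rewrite seq_iota; apply/mem_flat_map/idP => [[k]|].
  rewrite mem_iota mem_cons_map IH deg_cons /= => kd /and3P[/eqP -> /eqP -> /eqP ?].
  by apply/andP; split; lia.
rewrite deg_cons => /andP[sQ /eqP dQ]; exists q; first by rewrite mem_iota; lia.
by rewrite mem_cons_map eqxx IH (eqP (_ : size Q == n)) ?eqxx //=; lia.
Qed.

Lemma uniq_cons_map (k : nat) (l : seq (seq nat)) :
  uniq l -> uniq (List.map (cons k) l).
Proof. by move=> ul; rewrite -[List.map _ _]/([seq k :: x | x <- l]) map_inj_uniq // => ? ? []. Qed.

Lemma uniq_mindices n d : uniq (mindices n d).
Proof.
elim: n d => [|n IH] d; first by rewrite /mindices; case: ifP.
rewrite [mindices _ _]/mindices -/mindices seq_iota.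
apply: uniq_flat_map; first exact: iota_uniq.
  by move=> k _; apply: uniq_cons_map.
move=> x y [|q Q]; first by move/In_mem/in_map_iff => [? []].
by rewrite !mem_cons_map => /andP[/eqP <- _] /andP[/eqP <- _].
Qed.

Lemma mem_idx n D Q : (Q \in idx n D) = (size Q == n) && (deg Q <= D)%N.
Proof.
rewrite /mindices_le seq_iota; apply/mem_flat_map/andP => [[d]|[sQ dQ]].
  by rewrite mem_iota mem_mindices => ? /andP[-> /eqP ->]; split=> //; lia.
by exists (deg Q); rewrite ?mem_mindices ?sQ ?mem_iota ?eqxx //; lia.
Qed.

Lemma uniq_idx n D : uniq (idx n D).
Proof.
rewrite /mindices_le seq_iota; apply: uniq_flat_map; first exact: iota_uniq.
  by move=> ? _; apply: uniq_mindices.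
by move=> x y z; rewrite !mem_mindices => /andP[_ /eqP <-] /andP[_ /eqP <-].
Qed.

Lemma mbelow_cons q Q : mbelow (q :: Q) =
  List.flat_map (fun k => List.map (cons k) (mbelow Q)) (iota 0 q.+1).
Proof. by rewrite -seq_iota. Qed.

(** Subtraction is truncated, so [P + (Q - P) = Q] holds exactly when [P <= Q] componentwise. This
    turns the enumeration behind [smul] into a condition on sums of multi-indices. *)
Lemma mem_mbelow n Q P : size Q = n ->
  (P \in mbelow Q) = (size P == n) && (madd P (msub Q P) == Q).
Proof.
elim: Q n P => [|q Q IH] [|n] // P; first by case: P.
move=> [sQ]; case: P => [|p P].
  by rewrite mbelow_cons; apply/mem_flat_map => -[k _ /In_mem/in_map_iff[]] ? [].
rewrite mbelow_cons; have -> : madd (p :: P) (msub (q :: Q) (p :: P)) =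
  (p + (q - p))%N :: madd P (msub Q P) by [].
rewrite eqSS eqseq_cons; apply/mem_flat_map/and3P => [[k]|[sP /eqP pq EQ]].
  rewrite mem_iota mem_cons_map (IH n) // => kd /and3P[/eqP pk sP EQ].
  by split=> //; apply/eqP; lia.
exists p; first by rewrite mem_iota; lia.
by rewrite mem_cons_map eqxx (IH n) // sP EQ.
Qed.

Lemma uniq_mbelow Q : uniq (mbelow Q).
Proof.
elim: Q => // q Q IH; rewrite mbelow_cons.
apply: uniq_flat_map; first exact: iota_uniq.
  by move=> k _; apply: uniq_cons_map.
move=> x y [|p P]; first by move/In_mem/in_map_iff => [? []].
by rewrite !mem_cons_map => /andP[/eqP <- _] /andP[/eqP <- _].
Qed.

Lemma size_msub Q P : size (msub Q P) = size Q.
Proof. by elim: Q P => [|q Q IH] [|p P] //=; rewrite IH. Qed.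

Lemma msub_maddl P Q : size P = size Q -> msub (madd P Q) P = Q.
Proof.
elim: P Q => [|p P IH] [|q Q] //= [/IH E].
by rewrite /madd /= -/(madd _ _) E; congr (_ :: _); lia.
Qed.

(** * Formal power series *)

(** The condition becomes a scalar factor, so a restricted sum becomes a full one and sums can be
    exchanged freely. *)
Definition ind (b : bool) : C := if b then C1 else C0.

Lemma csum_ind (T : Type) (l : seq T) (P : pred T) (F : T -> C) :
  (\csum_(x <- l | P x) F x = \csum_(x <- l) ind (P x) * F x)%cx.
Proof.
by rewrite big_mkcond; apply: eq_bigr => x _; rewrite /ind; case: (P x); ring.
Qed.

Lemma csum_pick (T : eqType) (l : seq T) (a : T) (P : pred T) (F : T -> C) :
  uniq l -> (forall x, x \in l -> P x = (x == a)) ->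
  (\csum_(x <- l | P x) F x = ind (a \in l) * F a)%cx.
Proof.
move=> ul HP; case: (boolP (a \in l)) => al.
  rewrite big_mkcond (bigD1_seq a) //= HP // eqxx big1_seq /ind; first by ring.
  by move=> x /andP[xa xl]; rewrite HP // (negbTE xa).
rewrite big1_seq /ind; first by ring.
move=> x /andP[Px xl]; move: (Px); rewrite HP // => /eqP xa.
by rewrite xa in xl; rewrite xl in al.
Qed.

Lemma csum_delta (T : eqType) (l : seq T) (a : T) (F : T -> C) :
  uniq l -> (forall x, x \in l -> x != a -> F x = C0) ->
  (\csum_(x <- l) F x = ind (a \in l) * F a)%cx.
Proof.
move=> ul F0; rewrite -(@csum_pick _ _ a (pred1 a)) // [RHS]big_mkcond.
by apply: eq_big_seq => x xl /=; case: eqP => // /eqP; apply: F0.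
Qed.

Lemma csum_exch4 (T U V W : Type) l1 l2 l3 l4 (K : T -> U -> V -> W -> C) :
  (\csum_(a <- l1) \csum_(b <- l2) \csum_(c <- l3) \csum_(d <- l4) K a b c d =
   \csum_(c <- l3) \csum_(d <- l4) \csum_(a <- l1) \csum_(b <- l2) K a b c d)%cx.
Proof.
have H1 a : (\csum_(b <- l2) \csum_(c <- l3) \csum_(d <- l4) K a b c d =
  \csum_(c <- l3) \csum_(d <- l4) \csum_(b <- l2) K a b c d)%cx.
  by rewrite exchange_big; apply: eq_bigr => c _; apply: exchange_big.
rewrite (eq_bigr _ (fun a _ => H1 a)) exchange_big.
by apply: eq_bigr => c _; apply: exchange_big.
Qed.

Lemma csum_exch4' (T U V W : Type) l1 l2 l3 l4 (K : T -> U -> V -> W -> C) :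
  (\csum_(a <- l1) \csum_(b <- l2) \csum_(c <- l3) \csum_(d <- l4) K a b c d =
   \csum_(c <- l3) \csum_(d <- l4) \csum_(b <- l2) \csum_(a <- l1) K a b c d)%cx.
Proof.
rewrite csum_exch4; apply: eq_bigr => c _; apply: eq_bigr => d _.
exact: exchange_big.
Qed.

(** A [series] is a function on all lists, but only lists of length [n] matter; [eqd] moreover looks
    only at degree at most [d]. *)
Definition eqd n d (F G : series) :=
  forall Q, size Q = n -> (deg Q <= d)%N -> F Q = G Q.
Definition eqs n (F G : series) := forall Q, size Q = n -> F Q = G Q.

Lemma eqs_eqd n F G : eqs n F G <-> forall d, eqd n d F G.
Proof. by split=> [H d Q sQ _|H Q sQ]; [apply: H | apply: (H (deg Q))]. Qed.

Section FixedDim.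
Variable n : nat.
Implicit Types (Q P : seq nat) (F G H : series).

(** The range of summation [idx n D] does not depend on [Q], provided [deg Q <= D]. The ring laws
    then follow by exchanging sums. *)
Lemma smulE D Q F G : size Q = n -> (deg Q <= D)%N ->
  smul F G Q = (\csum_(P <- idx n D) \csum_(P' <- idx n D | madd P P' == Q)
                  F P * G P')%cx.
Proof.
move=> sQ dQ; rewrite /smul CsumE.
transitivity (\csum_(P <- idx n D | P \in mbelow Q) F P * G (msub Q P))%cx.
  rewrite -[RHS]big_filter; apply: perm_big; apply: uniq_perm; rewrite ?uniq_mbelow //.
    by rewrite filter_uniq ?uniq_idx.
  move=> P; rewrite mem_filter (mem_mbelow _ sQ); apply/idP/idP => [|/andP[]//].
  move=> /[dup] /andP[/eqP sP /eqP E] ->; rewrite mem_idx sP eqxx /=.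
  have := deg_madd (etrans sP (esym (etrans (size_msub Q P) sQ))).
  by rewrite E; lia.
rewrite big_mkcond; apply: eq_big_seq => P; rewrite mem_idx => /andP[/eqP sP dP].
have sM : size (msub Q P) = n by rewrite size_msub.
case: ifP => [|/negP PQ].
  rewrite (mem_mbelow _ sQ) => /andP[_ /eqP E].
  rewrite (@csum_pick _ _ (msub Q P)) ?uniq_idx //.
    rewrite mem_idx sM eqxx /= (_ : (deg _ <= D)%N) /ind; first by ring.
    by have := deg_madd (etrans sP (esym sM)); rewrite E; lia.
  move=> P'; rewrite mem_idx => /andP[/eqP sP' _].
  apply/eqP/eqP => [E'|-> //]; apply: (madd_injl sP sP' sM).
  by rewrite E E'.
rewrite big1_seq // => P' /andP[/eqP E]; rewrite mem_idx => /andP[/eqP sP' _].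
case: PQ; rewrite (mem_mbelow _ sQ) sP eqxx /= -E; apply/eqP; congr madd.
by rewrite msub_maddl // sP.
Qed.

Lemma smul_ext d F F' G G' : eqd n d F F' -> eqd n d G G' ->
  eqd n d (smul F G) (smul F' G').
Proof.
move=> HF HG Q sQ dQ; rewrite !(smulE _ _ sQ dQ).
apply: eq_big_seq => P; rewrite mem_idx => /andP[/eqP sP dP].
rewrite big_seq_cond [RHS]big_seq_cond; apply: eq_bigr => P' /andP[].
rewrite mem_idx => /andP[/eqP sP' dP'] _.
by rewrite HF ?HG.
Qed.

Lemma smul_exts F F' G G' : eqs n F F' -> eqs n G G' ->
  eqs n (smul F G) (smul F' G').
Proof. by rewrite !eqs_eqd => HF HG d; apply: smul_ext. Qed.

Lemma smulC F G : eqs n (smul F G) (smul G F).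
Proof.
move=> Q sQ; rewrite !(smulE _ _ sQ (leqnn _)).
under eq_bigr do rewrite csum_ind.
rewrite exchange_big; apply: eq_bigr => P _; rewrite csum_ind.
by apply: eq_bigr => P' _; rewrite maddC; ring.
Qed.

Lemma smulA F G H : eqs n (smul F (smul G H)) (smul (smul F G) H).
Proof.
move=> Q sQ; set D := deg Q; have dQ : (deg Q <= D)%N by [].
(* Both bracketings are compared with this symmetric triple sum. Summing out the intermediate index
   [S] picks [S = B + E] for one side and [S = A + B] for the other. *)
pose T := (\csum_(A <- idx n D) \csum_(B <- idx n D) \csum_(E <- idx n D)
   ind (madd A (madd B E) == Q) * (F A * G B * H E))%cx.
transitivity T.
  rewrite (smulE _ _ sQ dQ); apply: eq_big_seq => A.
  rewrite mem_idx => /andP[/eqP sA dA].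
  transitivity (\csum_(S <- idx n D) \csum_(B <- idx n D) \csum_(E <- idx n D)
    ind (madd A S == Q) * (ind (madd B E == S) * (F A * G B * H E)))%cx.
    rewrite csum_ind; apply: eq_big_seq => S; rewrite mem_idx => /andP[/eqP sS dS].
    rewrite (smulE _ _ sS dS) big_distrr big_distrr; apply: eq_bigr => B _ /=.
    by rewrite csum_ind !big_distrr; apply: eq_bigr => E _ /=; ring.
  rewrite exchange_big; apply: eq_big_seq => B; rewrite mem_idx => /andP[/eqP sB dB].
  rewrite exchange_big; apply: eq_big_seq => E; rewrite mem_idx => /andP[/eqP sE dE].
  rewrite (@csum_delta _ _ (madd B E)) ?uniq_idx //; last first.
    by move=> S _; rewrite eq_sym => /negbTE ->; rewrite /ind; ring.
  rewrite mem_idx (size_madd sB sE) !eqxx /=.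
  case: eqP => [EQ|]; last by move=> _; rewrite /ind; ring.
  have -> : (deg (madd B E) <= D)%N; last by rewrite /ind; ring.
  by have := deg_madd (etrans sA (esym (size_madd sB sE))); rewrite EQ /D; lia.
rewrite (smulE _ _ sQ dQ) /T.
transitivity (\csum_(S <- idx n D) \csum_(E <- idx n D) \csum_(A <- idx n D)
   \csum_(B <- idx n D)
    ind (madd S E == Q) * (ind (madd A B == S) * (F A * G B * H E)))%cx; last first.
  apply: eq_big_seq => S; rewrite mem_idx => /andP[/eqP sS dS].
  rewrite [RHS]csum_ind; apply: eq_bigr => E _.
  rewrite (smulE _ _ sS dS) big_distrl big_distrr; apply: eq_bigr => A _ /=.
  by rewrite [in RHS]csum_ind big_distrl big_distrr; apply: eq_bigr => B _ /=; ring.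
rewrite csum_exch4'.
apply: eq_big_seq => A; rewrite mem_idx => /andP[/eqP sA dA].
apply: eq_big_seq => B; rewrite mem_idx => /andP[/eqP sB dB].
apply: eq_big_seq => E; rewrite mem_idx => /andP[/eqP sE dE].
rewrite (@csum_delta _ _ (madd A B)) ?uniq_idx //; last first.
  by move=> S _; rewrite eq_sym => /negbTE ->; rewrite /ind; ring.
rewrite mem_idx (size_madd sA sB) !eqxx /= maddA.
case: eqP => [EQ|]; last by move=> _; rewrite /ind; ring.
have -> : (deg (madd A B) <= D)%N; last by rewrite /ind; ring.
have := deg_madd (etrans (size_madd sA sB) (esym sE)).
by rewrite EQ /D; lia.
Qed.

End FixedDim.

Lemma fix0P n F : fix0 n F <->
  forall j Q, (j < n)%N -> size Q = n -> deg Q = 0%N -> F j Q = C0.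
Proof.
split=> [H j Q jn sQ dQ|H j /ltP jn]; last first.
  by apply: H; rewrite ?size_zeroQ ?deg_zeroQ.
by rewrite (deg0_zeroQ dQ) sQ; apply: H; apply/ltP.
Qed.

Lemma meqP n F G : meq n F G <-> forall j, (j < n)%N -> eqs n (F j) (G j).
Proof.
by split=> H j; [move=> /ltP jn Q sQ | move=> Q /ltP jn sQ]; apply: H.
Qed.

Lemma soneE Q : sone Q = ind (deg Q == 0%N).
Proof.
rewrite /sone /ind; suff -> : forallb (Nat.eqb 0) Q = (deg Q == 0%N) by [].
by elim: Q => //= -[|q] Q IH //=; rewrite IH.
Qed.

(** [scomp n F G] is [G o F]: the inner map is the first argument. *)
Definition scomp n (F : pmap) (G : series) : series :=
  fun Q => (\csum_(P <- idx n (deg Q)) G P * smono F P Q)%cx.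

Lemma pcompE n G F j Q : pcomp n G F j Q = scomp n F (G j) Q.
Proof. exact: CsumE. Qed.

(** * Substitution of formal maps into formal series *)

Section FixedDim.
Variable n : nat.
Implicit Types (Q P : seq nat) (F G H : series).

Lemma eqs_refl F : eqs n F F. Proof. by []. Qed.
Lemma eqs_sym F G : eqs n F G -> eqs n G F.
Proof. by move=> H Q sQ; rewrite H. Qed.
Lemma eqs_trans G F H : eqs n F G -> eqs n G H -> eqs n F H.
Proof. by move=> H1 H2 Q sQ; rewrite H1 ?H2. Qed.

Lemma smul1s F : eqs n (smul sone F) F.
Proof.
move=> Q sQ; rewrite (smulE _ _ sQ (leqnn _)).
rewrite (@csum_delta _ _ (zeroQ n)) ?uniq_idx //; last first.
  move=> P; rewrite mem_idx => /andP[/eqP sP _] P0.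
  rewrite big1 // => P' _; rewrite soneE; case: eqP; last by rewrite /ind => _; ring.
  by move=> /deg0_zeroQ E; rewrite {1}E sP eqxx in P0.
rewrite (@csum_pick _ _ Q) ?uniq_idx //; last first.
  by move=> P; rewrite mem_idx => /andP[/eqP sP _]; rewrite madd0Q.
rewrite soneE !mem_idx size_zeroQ deg_zeroQ sQ leqnn !eqxx /=.
by rewrite /ind; ring.
Qed.

Lemma smulACA A B E F :
  eqs n (smul (smul A B) (smul E F)) (smul (smul A E) (smul B F)).
Proof.
apply: (eqs_trans (eqs_sym (smulA (n:=n) A B (smul E F)))).
apply: eqs_trans (smulA (n:=n) A E (smul B F)).
apply: smul_exts => //.
apply: (eqs_trans (smulA (n:=n) B E F)).
apply: eqs_trans (eqs_sym (smulA (n:=n) E B F)).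
by apply: smul_exts => //; apply: smulC.
Qed.

Lemma spowD F a b : eqs n (spow F (a + b)) (smul (spow F a) (spow F b)).
Proof.
elim: a => [|a IH] /=; first by apply/eqs_sym/smul1s.
by apply: eqs_trans (@smulA _ _ _ _); apply: smul_exts.
Qed.

Lemma spow_ext d F F' k : eqd n d F F' -> eqd n d (spow F k) (spow F' k).
Proof. by move=> H; elim: k => //= k IH; apply: smul_ext. Qed.

Lemma smono_aux_madd (F : pmap) i P P' : size P = size P' ->
  eqs n (smono_aux F i (madd P P')) (smul (smono_aux F i P) (smono_aux F i P')).
Proof.
elim: P P' i => [|p P IH] [|p' P'] //= i.
  by move=> _; apply/eqs_sym/smul1s.
move=> [/IH {}IH]; apply: eqs_trans (smulACA _ _ _ _).
by apply: smul_exts => //; apply: spowD.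
Qed.

Lemma smono_madd (F : pmap) P P' : size P = size P' ->
  eqs n (smono F (madd P P')) (smul (smono F P) (smono F P')).
Proof. exact: smono_aux_madd. Qed.

Lemma smono_aux_ext d (F F' : pmap) i P :
  (forall j, (j < i + size P)%N -> eqd n d (F j) (F' j)) ->
  eqd n d (smono_aux F i P) (smono_aux F' i P).
Proof.
elim: P i => //= p P IH i H; apply: smul_ext; first by apply/spow_ext/H; lia.
by apply: IH => j Hj; apply: H; lia.
Qed.

Lemma smono_ext d (F F' : pmap) P :
  (forall j, (j < size P)%N -> eqd n d (F j) (F' j)) ->
  eqd n d (smono F P) (smono F' P).
Proof. by move=> H; apply: (@smono_aux_ext d F F' 0 P). Qed.

(** [F] and [F'] have order at least [k] and agree in degree less than
    [d + k]; this shape makes the relation multiplicative in [k]. *)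
Definition rel d k F F' :=
  (forall Q, size Q = n -> (deg Q < k)%N -> F Q = C0 /\ F' Q = C0) /\
  (forall Q, size Q = n -> (deg Q < d + k)%N -> F Q = F' Q).

(** In a nonzero term of degree below [d + k + l] the factors have degree at least [k] and [l].
    Hence they have degree below [d + k] and [d + l], where the two versions agree. *)
Lemma rel_smul d k l F F' G G' :
  rel d k F F' -> rel d l G G' -> rel d (k + l) (smul F G) (smul F' G').
Proof.
move=> [F0 FF] [G0 GG].
have split_deg Q P P' : P \in idx n (deg Q) -> P' \in idx n (deg Q) ->
    madd P P' == Q -> [/\ size P = n, size P' = n & deg Q = (deg P + deg P')%N].
  rewrite !mem_idx => /andP[/eqP sP _] /andP[/eqP sP' _] /eqP <-.
  by rewrite deg_madd ?sP.
split=> Q sQ dQ; rewrite !(smulE _ _ sQ (leqnn _)).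
  suff Z A B (k' : forall P, size P = n -> (deg P < k)%N -> A P = C0)
      (l' : forall P, size P = n -> (deg P < l)%N -> B P = C0) :
      (\csum_(P <- idx n (deg Q)) \csum_(P' <- idx n (deg Q) | madd P P' == Q)
        A P * B P')%cx = C0.
    by split; apply: Z => P sP dP; [case: (F0 P sP dP) | case: (G0 P sP dP)
      | case: (F0 P sP dP) | case: (G0 P sP dP)].
  rewrite big1_seq // => P /= PQ; rewrite big1_seq // => P' /andP[E P'Q].
  have [sP sP' dE] := split_deg _ _ _ PQ P'Q E.
  have [/(k' _ sP) ->|kP] := ltnP (deg P) k; first by ring.
  by rewrite (l' P') //; [ring | lia].
apply: eq_big_seq => P PQ; rewrite big_seq_cond [RHS]big_seq_cond.
apply: eq_bigr => P' /andP[P'Q E].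
have [sP sP' dE] := split_deg _ _ _ PQ P'Q E.
have [/(F0 _ sP)[-> ->]|kP] := ltnP (deg P) k; first by ring.
have [/(G0 _ sP')[-> ->]|lP'] := ltnP (deg P') l; first by ring.
by rewrite FF ?GG //; lia.
Qed.

Lemma rel_sone d : rel d 0 sone sone.
Proof. by split. Qed.

Lemma rel_spow d k F F' : rel d 1 F F' -> rel d k (spow F k) (spow F' k).
Proof.
by move=> H; elim: k => [|k IH] /=; [apply: rel_sone | apply: (@rel_smul d 1 k)].
Qed.

Lemma rel_smono_aux d (F F' : pmap) i P :
  (forall j, (j < i + size P)%N -> rel d 1 (F j) (F' j)) ->
  rel d (deg P) (smono_aux F i P) (smono_aux F' i P).
Proof.
elim: P i => [|p P IH] i H; first exact: rel_sone.
apply: rel_smul; first by apply/rel_spow/H => /=; lia.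
by apply: IH => j Hj; apply: H => /=; lia.
Qed.

(** Each further factor of [F^P] has order at least 1, so agreement of the maps up to degree [d]
    improves by [deg P - 1] degrees for the monomial. For [deg P >= 2] this gain makes the later
    recursions triangular. *)
Lemma rel_smono d (F F' : pmap) P : size P = n ->
  fix0 n F -> fix0 n F' -> (forall j, (j < n)%N -> eqd n d (F j) (F' j)) ->
  rel d (deg P) (smono F P) (smono F' P).
Proof.
move=> sP /fix0P F0 /fix0P F0' FF.
apply: (@rel_smono_aux d F F' 0) => j; rewrite add0n sP => jn.
split=> Q sQ dQ; first by rewrite F0 ?F0' //; lia.
by apply: FF => //; lia.
Qed.

Lemma smono_order (F : pmap) P Q : fix0 n F -> size P = n -> size Q = n ->
  (deg Q < deg P)%N -> smono F P Q = C0.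
Proof.
move=> F0 sP sQ dQ; have [H _] := @rel_smono 0 F F P sP F0 F0 (fun _ _ _ _ _ => erefl).
by case: (H Q).
Qed.

Lemma big_idx (T : Type) (e : T) (op : Monoid.com_law e) d D (F : seq nat -> T) :
  (d <= D)%N -> (forall P, size P = n -> (d < deg P <= D)%N -> F P = e) ->
  \big[op/e]_(P <- idx n d) F P = \big[op/e]_(P <- idx n D) F P.
Proof.
move=> dD F0; transitivity (\big[op/e]_(P <- idx n D | (deg P <= d)%N) F P).
  rewrite -[RHS]big_filter; apply: perm_big; apply: uniq_perm.
  - exact: uniq_idx.
  - by rewrite filter_uniq ?uniq_idx.
  by move=> P; rewrite mem_filter !mem_idx; case: eqP; rewrite ?andbF //=; lia.
apply: big_rmcond_in => P; rewrite mem_idx => /andP[/eqP sP dP] ndP.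
by apply: F0 => //; lia.
Qed.

Lemma scompE D (F : pmap) G Q : fix0 n F -> size Q = n -> (deg Q <= D)%N ->
  scomp n F G Q = (\csum_(P <- idx n D) G P * smono F P Q)%cx.
Proof.
move=> F0 sQ dQ; apply: big_idx => // P sP dP.
by rewrite smono_order //; [ring | lia].
Qed.

Lemma scomp_ext d (F F' : pmap) G G' :
  (forall j, (j < n)%N -> eqd n d (F j) (F' j)) -> eqd n d G G' ->
  eqd n d (scomp n F G) (scomp n F' G').
Proof.
move=> FF GG Q sQ dQ; apply: eq_big_seq => P; rewrite mem_idx => /andP[/eqP sP dP].
rewrite GG //; last lia.
by rewrite (@smono_ext d F F' P) // => j; rewrite sP; apply: FF.
Qed.

Lemma scomp_exts (F F' : pmap) G G' :
  (forall j, (j < n)%N -> eqs n (F j) (F' j)) -> eqs n G G' ->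
  eqs n (scomp n F G) (scomp n F' G').
Proof.
move=> FF /eqs_eqd GG; apply/eqs_eqd => d; apply: scomp_ext => // j jn.
by move: d; apply/eqs_eqd/FF.
Qed.

(** Substitution is multiplicative: both sides become sums over pairs [P], [P'] of
    [G_P H_P' F^(P + P')], using [smono_madd] on the right. *)
Lemma scomp_smul (F : pmap) G H : fix0 n F ->
  eqs n (scomp n F (smul G H)) (smul (scomp n F G) (scomp n F H)).
Proof.
move=> F0 Q sQ; set D := deg Q; have dQ : (deg Q <= D)%N by [].
transitivity (\csum_(P <- idx n D) \csum_(P' <- idx n D)
   G P * H P' * smono F (madd P P') Q)%cx.
  transitivity (\csum_(S <- idx n D) \csum_(P <- idx n D) \csum_(P' <- idx n D)
     ind (madd P P' == S) * (G P * H P' * smono F S Q))%cx.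
    apply: eq_big_seq => S; rewrite mem_idx => /andP[/eqP sS dS].
    rewrite (smulE _ _ sS dS) big_distrl; apply: eq_bigr => P _ /=.
    by rewrite csum_ind big_distrl; apply: eq_bigr => P' _ /=; ring.
  rewrite exchange_big; apply: eq_big_seq => P; rewrite mem_idx => /andP[/eqP sP dP].
  rewrite exchange_big; apply: eq_big_seq => P'.
  rewrite mem_idx => /andP[/eqP sP' dP'].
  rewrite (@csum_delta _ _ (madd P P')) ?uniq_idx //; last first.
    by move=> S _; rewrite eq_sym => /negbTE ->; rewrite /ind; ring.
  rewrite eqxx mem_idx (size_madd sP sP') eqxx /=.
  (* The index [P + P'] may lie outside the range of summation; its term then vanishes, since
     [F^(P + P')] has no coefficient of degree [D]. *)
  case: leqP => [_|dPP]; first by rewrite /ind; ring.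
  by rewrite (smono_order F0 (size_madd sP sP') sQ dPP) /ind; ring.
transitivity (\csum_(P <- idx n D) \csum_(P' <- idx n D)
   \csum_(A <- idx n D) \csum_(B <- idx n D)
   ind (madd A B == Q) * (G P * smono F P A * (H P' * smono F P' B)))%cx.
  apply: eq_big_seq => P; rewrite mem_idx => /andP[/eqP sP dP].
  apply: eq_big_seq => P'; rewrite mem_idx => /andP[/eqP sP' dP'].
  rewrite (smono_madd F (etrans sP (esym sP')) sQ) (smulE _ _ sQ dQ) big_distrr.
  apply: eq_bigr => A _ /=; rewrite csum_ind big_distrr.
  by apply: eq_bigr => B _ /=; ring.
rewrite csum_exch4 (smulE _ _ sQ dQ).
apply: eq_big_seq => A; rewrite mem_idx => /andP[/eqP sA dA].
rewrite [RHS]csum_ind; apply: eq_big_seq => B; rewrite mem_idx => /andP[/eqP sB dB].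
rewrite (scompE _ F0 sA dA) (scompE _ F0 sB dB) big_distrlr big_distrr.
apply: eq_bigr => P _ /=; rewrite big_distrr.
by apply: eq_bigr => P' _ /=; ring.
Qed.

Lemma zeroQ_in D : zeroQ n \in idx n D.
Proof. by rewrite mem_idx size_zeroQ deg_zeroQ eqxx. Qed.

Lemma smono_aux0 (F : pmap) i m : eqs n (smono_aux F i (zeroQ m)) sone.
Proof.
elim: m i => //= m IH i; apply: eqs_trans (smul1s sone).
by apply: smul_exts.
Qed.

Lemma scomp_sone (F : pmap) : fix0 n F -> eqs n (scomp n F sone) sone.
Proof.
move=> F0 Q sQ; rewrite /scomp (@csum_delta _ _ (zeroQ n)) ?uniq_idx //.
  rewrite zeroQ_in /smono (smono_aux0 F 0 n sQ) [sone (zeroQ n)]soneE deg_zeroQ eqxx.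
  by rewrite /ind; ring.
move=> P; rewrite mem_idx => /andP[/eqP sP _] P0.
rewrite soneE; case: eqP; last by rewrite /ind => _; ring.
by move=> /deg0_zeroQ E; rewrite {1}E sP eqxx in P0.
Qed.

Lemma scomp_spow (F : pmap) G k : fix0 n F ->
  eqs n (scomp n F (spow G k)) (spow (scomp n F G) k).
Proof.
move=> F0; elim: k => [|k IH] /=; first exact: scomp_sone.
by apply: eqs_trans (scomp_smul _ _ F0) _; apply: smul_exts.
Qed.

Lemma scomp_smono (F G : pmap) P : fix0 n F ->
  eqs n (scomp n F (smono G P)) (smono (fun j => scomp n F (G j)) P).
Proof.
rewrite /smono; elim: P 0%N => [|p P IH] i F0 /=; first exact: scomp_sone.
apply: eqs_trans (scomp_smul _ _ F0) _; apply: smul_exts; first exact: scomp_spow.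
exact: IH.
Qed.

Lemma scomp_fix0 (F G : pmap) : fix0 n G -> fix0 n (fun j => scomp n F (G j)).
Proof.
move=> /fix0P G0; apply/fix0P => j Q jn sQ dQ.
rewrite /scomp dQ big1_seq // => P /=; rewrite mem_idx => /andP[/eqP sP dP].
by rewrite G0 //; [ring | lia].
Qed.

(** Associativity reduces to monomials in the outermost series, where it is the multiplicativity of
    substitution ([scomp_smono]). *)
Lemma scompA (F G : pmap) H : fix0 n F -> fix0 n G ->
  eqs n (scomp n F (scomp n G H)) (scomp n (fun j => scomp n F (G j)) H).
Proof.
move=> F0 G0 Q sQ; set D := deg Q; have dQ : (deg Q <= D)%N by [].
transitivity (\csum_(S <- idx n D) \csum_(P <- idx n D)
   H S * (smono G S P * smono F P Q))%cx.
  rewrite exchange_big; apply: eq_big_seq => P; rewrite mem_idx => /andP[/eqP sP dP].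
  rewrite (scompE _ G0 sP dP) big_distrl; apply: eq_bigr => S _ /=; ring.
apply: eq_big_seq => S; rewrite mem_idx => /andP[/eqP sS dS].
rewrite -(scomp_smono G S F0 sQ) big_distrr.
by apply: eq_bigr => P _.
Qed.

End FixedDim.

(** * Linear parts *)

Lemma unitQ0 n : unitQ n.+1 0 = 1%N :: zeroQ n.
Proof.
rewrite /unitQ /=; congr (_ :: _).
have H m : List.map (fun i => if Nat.eqb i 0 then 1%N else 0%N) (List.seq m.+1 n)
    = zeroQ n by elim: n m => //= n IH m; rewrite -(IH m.+1).
exact: H.
Qed.

Lemma unitQS n j : unitQ n.+1 j.+1 = 0%N :: unitQ n j.
Proof.
rewrite /unitQ /=; congr (_ :: _).
by rewrite -List.seq_shift List.map_map; apply: List.map_ext => i.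
Qed.

Lemma size_unitQ n j : size (unitQ n j) = n.
Proof.
elim: n j => // n IH [|j]; first by rewrite unitQ0 /= size_zeroQ.
by rewrite unitQS /= IH.
Qed.

Lemma deg_unitQ n j : (j < n)%N -> deg (unitQ n j) = 1%N.
Proof.
elim: n j => // n IH [|j] jn; first by rewrite unitQ0 deg_cons deg_zeroQ.
by rewrite unitQS deg_cons IH.
Qed.

Lemma unitQ_inj n i j : (i < n)%N -> unitQ n i = unitQ n j -> i = j.
Proof.
elim: n i j => // n IH [|i] [|j] //; rewrite ?unitQ0 ?unitQS // => lin [] E.
by rewrite (IH i j).
Qed.

Lemma deg1P n Q : size Q = n -> deg Q = 1%N ->
  exists2 j, (j < n)%N & Q = unitQ n j.
Proof.
move=> <-; elim: Q => // -[|[|q]] Q IH; rewrite deg_cons // ?add0n.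
  by move=> /IH [j jn E]; exists j.+1; rewrite //= unitQS -E.
move=> [dQ]; exists 0%N => //=; rewrite unitQ0 -deg0_zeroQ //; lia.
Qed.

Lemma big_split_idx (T : Type) (e : T) (op : Monoid.com_law e) n D
    (F : seq nat -> T) : (1 <= D)%N ->
  \big[op/e]_(P <- idx n D) F P =
  op (op (F (zeroQ n)) (\big[op/e]_(i <- iota 0 n) F (unitQ n i)))
     (\big[op/e]_(P <- idx n D | (2 <= deg P)%N) F P).
Proof.
move=> D1; rewrite (bigID (fun P => (2 <= deg P)%N)) /= [RHS]Monoid.mulmC.
congr (op _ _); rewrite (bigID (fun P => deg P == 0%N)) /=; congr (op _ _).
  transitivity (\big[op/e]_(P <- [:: zeroQ n]) F P); last by rewrite big_seq1.
  rewrite -big_filter; apply: perm_big.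
  apply: uniq_perm; rewrite ?filter_uniq ?uniq_idx // => P.
  rewrite mem_filter mem_idx inE; apply/andP/eqP.
    by move=> [/andP[_ /eqP d0] /andP[/eqP sP _]]; rewrite (deg0_zeroQ d0) sP.
  by move=> ->; rewrite deg_zeroQ size_zeroQ !eqxx.
rewrite -big_filter -[RHS](big_map (unitQ n) xpredT); apply: perm_big.
apply: uniq_perm; first by rewrite filter_uniq ?uniq_idx.
  rewrite map_inj_in_uniq ?iota_uniq // => i j; rewrite !mem_iota => /andP[_ iN] _.
  exact: unitQ_inj.
move=> P; rewrite mem_filter mem_idx; apply/andP/mapP => [[dP /andP[/eqP sP dPD]]|].
  have [||j jn ->] := @deg1P n P; rewrite ?sP //; first lia.
  by exists j; rewrite ?mem_iota.
move=> [j]; rewrite mem_iota => /andP[_ jn] ->.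
by rewrite size_unitQ deg_unitQ // eqxx.
Qed.

Section FixedDim.
Variable n : nat.
Implicit Types (Q P : seq nat) (F G H : pmap).

Lemma smono_aux_unitQ F k m i : (i < m)%N ->
  eqs n (smono_aux F k (unitQ m i)) (F (k + i)%N).
Proof.
elim: m k i => // m IH k [|i] im.
  rewrite unitQ0 addn0 /=.
  apply: eqs_trans (smul1s (F k)); apply: eqs_trans (@smulC _ _ _).
  apply: smul_exts; last exact: smono_aux0.
  by apply: eqs_trans (smul1s (F k)); apply: smulC.
rewrite unitQS /=; apply: (eqs_trans (smul1s _)).
by rewrite addnS -addSn; apply: IH.
Qed.

Lemma smono_unitQ F i : (i < n)%N -> eqs n (smono F (unitQ n i)) (F i).
Proof. exact: smono_aux_unitQ. Qed.

(** The contribution to [a o F] of the terms of [a] of degree at least 2. At [Q] it involves only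
    the coefficients of [F] of degree below [deg Q] ([higher_ext]). *)
Definition higher F (a : series) : series := fun Q =>
  (\csum_(P <- idx n (deg Q) | (2 <= deg P)%N) a P * smono F P Q)%cx.

Lemma scomp_split F (a : series) Q : size Q = n -> (1 <= deg Q)%N ->
  scomp n F a Q = (\csum_(i <- iota 0 n) a (unitQ n i) * F i Q + higher F a Q)%cx.
Proof.
move=> sQ dQ; rewrite /scomp big_split_idx // [smono F (zeroQ n)]/smono (smono_aux0 F 0 n sQ).
rewrite soneE (_ : deg Q == 0%N = false); last by lia.
rewrite (_ : \csum_(i <- iota 0 n) a (unitQ n i) * smono F (unitQ n i) Q =
  \csum_(i <- iota 0 n) a (unitQ n i) * F i Q)%cx; first by rewrite /higher /ind /=; ring.
by apply: eq_big_seq => i; rewrite mem_iota => /andP[_ ?]; rewrite smono_unitQ.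
Qed.

Definition mon P c : series := fun Q => (ind (Q == P) * c)%cx.

Lemma smul_mon P P' c c' : size P = n -> size P' = n ->
  eqs n (smul (mon P c) (mon P' c')) (mon (madd P P') (c * c')%cx).
Proof.
move=> sP sP' Q sQ; rewrite (smulE _ _ sQ (leqnn _)).
rewrite (@csum_delta _ _ P) ?uniq_idx //; last first.
  by move=> S _ /negbTE SP; apply: big1 => ? _; rewrite /mon SP /ind; ring.
rewrite csum_ind (@csum_delta _ _ P') ?uniq_idx //; last first.
  by move=> S _ /negbTE SP; rewrite /mon SP /ind; ring.
rewrite /mon !eqxx !mem_idx sP sP' !eqxx /= eq_sym.
case: eqP => [->|]; last by move=> _; rewrite /ind; ring.
by rewrite deg_madd ?sP // leq_addl leq_addr /ind; ring.
Qed.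

(** [smono_aux F i P] uses the components of [F] from [i] on; [emb i P] is the exponent, in all
    variables, to which its argument [P] corresponds. *)
Definition emb i P := iter i (cons 0%N) P.

Lemma size_emb i P : size (emb i P) = (i + size P)%N.
Proof. by elim: i => //= i ->. Qed.

Lemma madd_emb i p P :
  madd (unitQ (i + (size P).+1) i) (emb i (p :: P)) = emb i (p.+1 :: P).
Proof.
elim: i => [|i IH]; last by rewrite addSn unitQS; apply: (congr1 (cons 0%N) IH).
by rewrite add0n unitQ0; apply: (congr1 (cons p.+1) (madd0Q (erefl (size P)))).
Qed.

Lemma spow_mon i p q P c d : (i + (size P).+1)%N = n ->
  eqs n (smul (spow (mon (unitQ n i) c) p) (mon (emb i (q :: P)) d))
        (mon (emb i ((p + q)%N :: P)) (Cpow c p * d)%cx).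
Proof.
move=> sn; elim: p => [|p IH] /=.
  by apply: (eqs_trans (smul1s _)) => Q sQ; rewrite add0n /mon; ring.
apply: (eqs_trans (eqs_sym (smulA _ _ _))).
have E := eqs_refl (n := n) (mon (unitQ n i) c).
apply: (eqs_trans (smul_exts E IH)).
apply: (eqs_trans (smul_mon _ _ _ _)); rewrite ?size_unitQ ?size_emb //.
rewrite addSn -madd_emb sn => Q sQ; rewrite /mon; ring.
Qed.

(** The diagonal linear map with eigenvalues [lam]. *)
Definition dg (lam : nat -> C) : pmap := fun j => mon (unitQ n j) (lam j).

Lemma smono_aux_dg lam i P : (i + size P)%N = n ->
  eqs n (smono_aux (dg lam) i P) (mon (emb i P) (cmono_aux lam i P)).
Proof.
elim: P i => [|p P IH] i /= sn.
  rewrite addn0 in sn; rewrite sn => Q sQ.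
  rewrite soneE /mon (_ : (Q == _) = (deg Q == 0%N)); first by rewrite /ind; ring.
  have E : emb n [::] = zeroQ n by rewrite /emb; elim: (n) => //= m ->.
  rewrite E; apply/eqP/eqP => [->|/deg0_zeroQ ->]; first exact: deg_zeroQ.
  by rewrite sQ.
have sn' : (i.+1 + size P)%N = n by rewrite addSn -addnS.
have E := eqs_refl (n := n) (spow (dg lam i) p).
apply: (eqs_trans (smul_exts E (IH _ sn'))).
have -> : emb i.+1 P = emb i (0%N :: P) by rewrite /emb iterSr.
by have := spow_mon p 0 (lam i) (cmono_aux lam i.+1 P) sn; rewrite addn0.
Qed.

Lemma smono_dg lam P : size P = n ->
  eqs n (smono (dg lam) P) (mon P (cmono lam P)).
Proof. exact: (@smono_aux_dg lam 0). Qed.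

Lemma dg_fix0 lam : fix0 n (dg lam).
Proof.
apply/fix0P => j Q jn sQ dQ; rewrite /dg /mon; case: eqP => [E|_].
  by rewrite E deg_unitQ in dQ.
by rewrite /ind; ring.
Qed.

Lemma scomp_dg lam (a : series) Q : size Q = n ->
  scomp n (dg lam) a Q = (a Q * cmono lam Q)%cx.
Proof.
move=> sQ; rewrite /scomp (@csum_delta _ _ Q) ?uniq_idx //.
  by rewrite mem_idx sQ leqnn eqxx smono_dg // /mon eqxx /ind /=; ring.
move=> P; rewrite mem_idx => /andP[/eqP sP _] PQ.
by rewrite smono_dg // /mon eq_sym (negbTE PQ) /ind; ring.
Qed.

Lemma Cpow1 k : Cpow C1 k = C1.
Proof. by elim: k => //= k ->; ring. Qed.

Lemma cmono1 Q : cmono (fun=> C1) Q = C1.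
Proof. by rewrite /cmono; elim: Q 0%N => //= q Q IH i; rewrite IH Cpow1; ring. Qed.

Lemma sidE : meq n (sid n) (dg (fun=> C1)).
Proof.
apply/meqP => j jn Q sQ; rewrite /sid /dg /mon.
by case: list_eq_dec => [->|/eqP/negbTE ->]; rewrite ?eqxx /ind; ring.
Qed.

End FixedDim.

(** * The monoid of formal maps fixing the origin *)

Lemma meq_refl n F : meq n F F. Proof. by []. Qed.
Lemma meq_sym n F G : meq n F G -> meq n G F.
Proof. by move=> H j Q jn sQ; rewrite H. Qed.
Lemma meq_trans n F G H : meq n F G -> meq n G H -> meq n F H.
Proof. by move=> H1 H2 j Q jn sQ; rewrite H1 ?H2. Qed.

Add Parametric Relation n : pmap (@meq n)
  reflexivity proved by (@meq_refl n) symmetry proved by (@meq_sym n)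
  transitivity proved by (@meq_trans n) as meq_rel.

#[export] Instance pcomp_meq n : Morphisms.Proper
  (Morphisms.respectful (meq n) (Morphisms.respectful (meq n) (meq n))) (pcomp n).
Proof.
move=> G G' /meqP GG F F' /meqP FF; apply/meqP => j jn Q sQ.
by rewrite !pcompE; apply: scomp_exts => //; apply: GG.
Qed.

Section Monoid.
Variable n : nat.
Implicit Types (F G H : pmap).

Lemma fix0_meq F G : meq n F G -> fix0 n F -> fix0 n G.
Proof.
by move=> FG F0 j jn; rewrite -FG ?F0 // -/size; apply: size_zeroQ.
Qed.

Lemma pcomp_fix0 G F : fix0 n G -> fix0 n F -> fix0 n (pcomp n G F).
Proof.
move=> G0 F0; apply: fix0_meq (scomp_fix0 F G0) => j Q jn sQ.
by rewrite pcompE.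
Qed.

Lemma pcompA H G F : fix0 n G -> fix0 n F ->
  meq n (pcomp n H (pcomp n G F)) (pcomp n (pcomp n H G) F).
Proof.
move=> G0 F0; apply/meqP => j jn Q sQ; rewrite !pcompE.
transitivity (scomp n F (scomp n G (H j)) Q); last first.
  by apply: scomp_exts => // S sS; rewrite pcompE.
rewrite scompA //; apply: scomp_exts => // i _ S sS; exact: pcompE.
Qed.

Lemma sid_fix0 : fix0 n (sid n).
Proof. by apply: fix0_meq (dg_fix0 (n:=n) (fun=> C1)); apply/meq_sym/sidE. Qed.

Lemma pcomp_dg G lam j Q : size Q = n ->
  pcomp n G (dg n lam) j Q = (G j Q * cmono lam Q)%cx.
Proof. by move=> sQ; rewrite pcompE scomp_dg. Qed.

Lemma dg_pcomp G lam : fix0 n G ->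
  meq n (pcomp n (dg n lam) G) (fun j Q => lam j * G j Q)%cx.
Proof.
move=> /[dup] G0 /fix0P G0'; apply/meqP => j jn Q sQ; rewrite pcompE.
rewrite /scomp (@csum_delta _ _ (unitQ n j)) ?uniq_idx //; last first.
  by move=> P _ /negbTE PQ; rewrite /dg /mon PQ /ind; ring.
rewrite smono_unitQ // /dg /mon eqxx mem_idx size_unitQ eqxx deg_unitQ //=.
case: (ltnP 0 (deg Q)) => dQ; first by rewrite /ind; ring.
by rewrite G0' //; [rewrite /ind; ring | lia].
Qed.

Lemma pcompid F : meq n (pcomp n F (sid n)) F.
Proof.
rewrite sidE; apply/meqP => j jn Q sQ.
by rewrite pcomp_dg // cmono1; ring.
Qed.

Lemma pidcomp F : fix0 n F -> meq n (pcomp n (sid n) F) F.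
Proof.
move=> F0; rewrite sidE dg_pcomp // => j Q jn sQ; ring.
Qed.

End Monoid.

(** * Linear maps and their matrices *)

Section Linear.
Variable n : nat.
Implicit Types (F G H : pmap) (A B : nat -> nat -> C).

(** Passing from matrices to maps lets matrix identities be proved by rewriting in the monoid of
    formal maps. *)
Definition lin A : pmap :=
  fun j Q => (\csum_(i <- iota 0 n) A j i * ind (Q == unitQ n i))%cx.

Lemma matmulE A B i j :
  matmul n A B i j = (\csum_(l <- iota 0 n) A i l * B l j)%cx.
Proof. by rewrite /matmul CsumE seq_iota. Qed.

Lemma lin_unitQ A j i : (i < n)%N -> lin A j (unitQ n i) = A j i.
Proof.
move=> lt_in; rewrite /lin (@csum_delta _ _ i) ?iota_uniq //.
  by rewrite mem_iota lt_in eqxx /ind /=; ring.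
move=> l; rewrite mem_iota => /andP[_ ln] li; case: eqP => [E|_]; last first.
  by rewrite /ind; ring.
by move: li; rewrite (unitQ_inj lt_in E) eqxx.
Qed.

Lemma lin_nonlinear A j Q : deg Q <> 1%N -> lin A j Q = C0.
Proof.
move=> dQ; rewrite /lin big1_seq // => i; rewrite mem_iota => /andP[_ lt_in].
by case: eqP => [E|_]; [rewrite E deg_unitQ in dQ | rewrite /ind; ring].
Qed.

Lemma lin_fix0 A : fix0 n (lin A).
Proof. by apply/fix0P => j Q jn sQ dQ; apply: lin_nonlinear; rewrite dQ. Qed.

Lemma lin_ext A B : (forall i j, (i < n)%N -> (j < n)%N -> A i j = B i j) ->
  meq n (lin A) (lin B).
Proof.
move=> AB; apply/meqP => j jn Q sQ; apply: eq_big_seq => i.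
by rewrite mem_iota => /andP[_ lt_in]; rewrite AB.
Qed.

Lemma lin_linpart F : is_linear n F -> meq n F (lin (linpart n F)).
Proof.
move=> [/fix0P F0 FL]; apply/meqP => j jn Q sQ.
case: (eqVneq (deg Q) 1%N) => [dQ|dQ].
  by have [i lt_in ->] := deg1P sQ dQ; rewrite lin_unitQ.
rewrite lin_nonlinear; last exact/eqP.
case: (posnP (deg Q)) => [/F0 -> //|d0]; apply: FL => //; first exact/ltP.
by apply/leP; lia.
Qed.

Lemma is_linear_lin A : is_linear n (lin A).
Proof.
split; first exact: lin_fix0.
by move=> j Q _ _ dQ; apply: lin_nonlinear; lia.
Qed.

Lemma is_linear_meq F G : meq n F G -> is_linear n F -> is_linear n G.
Proof.
move=> FG [F0 FL]; split; first exact: fix0_meq F0.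
by move=> j Q jn sQ dQ; rewrite -FG // FL.
Qed.

(** The chain rule at the origin: in degree 1 the higher terms of [G] contribute nothing. *)
Lemma linpart_pcomp G F i j : fix0 n F -> (j < n)%N ->
  linpart n (pcomp n G F) i j = matmul n (linpart n G) (linpart n F) i j.
Proof.
move=> F0 jn; rewrite /linpart pcompE scomp_split ?size_unitQ ?deg_unitQ //.
rewrite matmulE /linpart [higher _ _ _ _]big1_seq; first by ring.
by move=> P; rewrite mem_idx deg_unitQ // => /andP[d2 /andP[_ d1]]; lia.
Qed.

Lemma lin_comp A B : meq n (pcomp n (lin A) (lin B)) (lin (matmul n A B)).
Proof.
have L : is_linear n (pcomp n (lin A) (lin B)).
  split; first by apply: pcomp_fix0; apply: lin_fix0.
  move=> j Q /ltP jn sQ /leP dQ; rewrite pcompE scomp_split //; last by lia.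
  rewrite big1_seq => [|i /andP[_]]; last first.
    by rewrite mem_iota => _; rewrite (@lin_nonlinear B); [ring | lia].
  rewrite /higher big1_seq; first by ring.
  by move=> P /andP[dP _]; rewrite lin_nonlinear; [ring | lia].
rewrite (lin_linpart L); apply: lin_ext => i j lt_in jn.
rewrite linpart_pcomp ?matmulE //; last exact: lin_fix0.
apply: eq_big_seq => l; rewrite mem_iota => /andP[_ ln].
by rewrite /linpart !lin_unitQ.
Qed.

Lemma linpart_lin_comp G F : fix0 n F ->
  meq n (lin (linpart n (pcomp n G F)))
        (pcomp n (lin (linpart n G)) (lin (linpart n F))).
Proof.
move=> F0; rewrite lin_comp; apply: lin_ext => i j lt_in jn.
exact: linpart_pcomp.
Qed.

Lemma linpart_meq F G : meq n F G -> meq n (lin (linpart n F)) (lin (linpart n G)).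
Proof.
move=> FG; apply: lin_ext => i j /ltP lt_in jn.
by apply: FG => //; apply: size_unitQ.
Qed.

Lemma cmono_unitQ lam i : (i < n)%N -> cmono lam (unitQ n i) = lam i.
Proof.
move=> lt_in; have s := size_unitQ n i.
have := smono_dg lam s s; rewrite (smono_unitQ _ lt_in) // /dg /mon eqxx /ind.
move=> E; transitivity (C1 * cmono lam (unitQ n i))%cx; first by ring.
by rewrite -E; ring.
Qed.

Lemma lin_dg A lam : meq n (pcomp n (lin A) (dg n lam))
  (lin (fun i j => A i j * lam j)%cx).
Proof.
apply/meqP => j jn Q sQ; rewrite pcomp_dg // /lin big_distrl.
apply: eq_big_seq => i; rewrite mem_iota => /andP[_ lt_in] /=.
by case: eqP => [->|_]; [rewrite cmono_unitQ // | rewrite /ind]; ring.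
Qed.

Lemma lin_id : meq n (lin idmat) (sid n).
Proof.
rewrite sidE; apply/meqP => j jn Q sQ; rewrite /lin (@csum_delta _ _ j) ?iota_uniq //.
  by rewrite /idmat Nat.eqb_refl mem_iota jn /dg /mon /ind /=; ring.
move=> l _ lj; rewrite /idmat (_ : Nat.eqb j l = false); first by rewrite /ind; ring.
by apply/Nat.eqb_neq => E; rewrite E eqxx in lj.
Qed.

Lemma dgC lam mu : meq n (pcomp n (dg n lam) (dg n mu)) (pcomp n (dg n mu) (dg n lam)).
Proof.
rewrite !dg_pcomp; try exact: dg_fix0.
by move=> j Q _ _; rewrite /dg /mon; ring.
Qed.

Lemma is_linear_id : is_linear n (sid n).
Proof. by apply: is_linear_meq lin_id _; apply: is_linear_lin. Qed.

Lemma dg_linear lam : is_linear n (dg n lam).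
Proof.
apply: (is_linear_meq (F := pcomp n (lin idmat) (dg n lam))).
  by rewrite lin_id pidcomp //; apply: dg_fix0.
by apply: is_linear_meq (meq_sym (lin_dg _ _)) _; apply: is_linear_lin.
Qed.

Lemma linpart_id : meq n (lin (linpart n (sid n))) (sid n).
Proof. by apply/meq_sym/lin_linpart/is_linear_id. Qed.

End Linear.

#[export] Hint Resolve lin_fix0 dg_fix0 sid_fix0 pcomp_fix0 : core.

Lemma csumB (T : Type) (l : seq T) (F G : T -> C) :
  (\csum_(x <- l) (F x - G x) = \csum_(x <- l) F x - \csum_(x <- l) G x)%cx.
Proof.
elim: l => [|x l IH]; first by rewrite !big_nil; ring.
by rewrite !big_cons IH; ring.
Qed.

(** * Formal solutions of triangular systems *)

Section Solve.
Variable n : nat.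
Implicit Types (F G H : pmap) (a : series).

Lemma higher_ext d F F' a Q : fix0 n F -> fix0 n F' ->
  (forall i, (i < n)%N -> eqd n d (F i) (F' i)) ->
  size Q = n -> (deg Q <= d.+1)%N -> higher n F a Q = higher n F' a Q.
Proof.
move=> F0 F0' FF sQ dQ; rewrite /higher big_seq_cond [RHS]big_seq_cond.
apply: eq_bigr => P /andP[]; rewrite mem_idx => /andP[/eqP sP _] dP.
by case: (rel_smono sP F0 F0' FF) => _ -> //; lia.
Qed.

(** When the inner maps agree below degree [deg Q], the higher terms of [a] cancel at [Q] and only
    the derivative of [a] sees the difference. *)
Lemma scomp_perturb F F' a Q : fix0 n F -> fix0 n F' ->
  (forall i, (i < n)%N -> eqd n (deg Q).-1 (F i) (F' i)) ->
  size Q = n -> (1 <= deg Q)%N ->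
  (scomp n F a Q - scomp n F' a Q =
   \csum_(i <- iota 0 n) a (unitQ n i) * (F i Q - F' i Q))%cx.
Proof.
move=> F0 F0' FF sQ dQ; rewrite !scomp_split // (higher_ext a F0 F0' FF) //; last lia.
transitivity (\csum_(i <- iota 0 n) a (unitQ n i) * F i Q -
  \csum_(i <- iota 0 n) a (unitQ n i) * F' i Q)%cx; first by ring.
rewrite -csumB; apply: eq_bigr => l _; ring.
Qed.

Variables (c : nat -> seq nat -> C) (g : nat -> seq nat -> series).

(** The outer series [g j Q] may vary with [Q], because the linearization uses a different germ at
    each multi-index, namely one with the largest divisor there. *)
Definition solve_step F : pmap := fun j Q =>
  if (deg Q <= 1)%N then sid n j Q else (c j Q * higher n F (g j Q) Q)%cx.
Definition solve_iter k : pmap := iter k solve_step (sid n).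
(** The iterate of index [deg Q] has already reached its final value at [Q], so this diagonal choice
    is the limit of the iteration. *)
Definition solve : pmap := fun j Q => solve_iter (deg Q) j Q.

Lemma solve_iter_fix0 k : fix0 n (solve_iter k).
Proof.
case: k => [|k]; first exact: sid_fix0.
apply/fix0P => j Q jn sQ dQ; rewrite /solve_iter /= /solve_step dQ /=.
by move/fix0P: (@sid_fix0 n) => ->.
Qed.

(** By induction: if consecutive iterates agree up to degree [k + 1], then the next ones agree up to
    degree [k + 2], because [higher] reads only strictly lower degrees. *)
Lemma solve_iterS k j : eqd n k.+1 (solve_iter k.+1 j) (solve_iter k j).
Proof.
elim: k j => [|k IH] j Q sQ dQ; rewrite [LHS]/= {1}/solve_step; case: leqP => // d1.
- by lia.
- by rewrite /solve_iter /= /solve_step d1.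
rewrite [RHS]/= /solve_step leqNgt d1 /=; congr Cmul.
apply: (@higher_ext k.+1) => //.
- exact: (solve_iter_fix0 k.+1).
- exact: solve_iter_fix0.
by move=> i _; apply: IH.
Qed.

Lemma solve_iter_stable m k j Q : size Q = n -> (deg Q <= k)%N ->
  solve_iter (m + k) j Q = solve_iter k j Q.
Proof.
move=> sQ dQ; elim: m => // m IH; rewrite addSn solve_iterS //; lia.
Qed.

Lemma solveE k j : eqd n k (solve j) (solve_iter k j).
Proof.
by move=> Q sQ dQ; rewrite -[in RHS](subnK dQ) solve_iter_stable.
Qed.

Lemma solve_fix0 : fix0 n solve.
Proof.
apply/fix0P => j Q jn sQ dQ.
exact: (proj1 (fix0P _ _) (solve_iter_fix0 (deg Q))).
Qed.

Lemma solve_deg1 j Q : deg Q = 1%N -> solve j Q = sid n j Q.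
Proof. by move=> dQ; rewrite /solve dQ /solve_iter /= /solve_step dQ. Qed.

Lemma solve_eq j Q : size Q = n -> (2 <= deg Q)%N ->
  solve j Q = (c j Q * higher n solve (g j Q) Q)%cx.
Proof.
move=> sQ dQ; rewrite {1}/solve; case E : (deg Q) => [|d]; first by lia.
rewrite [LHS]/= /solve_step leqNgt dQ /=; congr Cmul.
apply: (@higher_ext d) => //; last by rewrite E.
- exact: solve_iter_fix0.
- exact: solve_fix0.
by move=> i _ P sP dP; rewrite (solveE i sP dP).
Qed.

End Solve.

(** * Weighted norms and convergence *)

(** Truncation at degree [D] makes every norm a finite sum; convergence then means a bound uniform
    in [D]. *)
Definition nrm n D (w : seq nat -> R) (F : series) : R :=
  \rsum_(Q <- idx n D) Cnorm (F Q) * w Q.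

Section Norms.
Variable n : nat.
Implicit Types (F G : series) (w : seq nat -> R) (P Q : seq nat).

Lemma nrm_eqs D w F G : eqs n F G -> nrm n D w F = nrm n D w G.
Proof. by move=> FG; apply: eq_big_seq => Q; rewrite mem_idx => /andP[/eqP sQ _]; rewrite FG. Qed.

Lemma nrm_ge0 D w F : (forall Q, 0 <= w Q) -> 0 <= nrm n D w F.
Proof.
move=> w0; apply: rsum_ge0 => Q _ _.
by have := Cnorm_ge0 (F Q); have := w0 Q; nra.
Qed.

Lemma nrm_smul_le D w F G : (forall Q, 0 <= w Q) ->
  nrm n D w (smul F G) <= \rsum_(P <- idx n D) \rsum_(P' <- idx n D)
    if (deg P + deg P' <= D)%N then Cnorm (F P) * Cnorm (G P') * w (madd P P') else 0.
Proof.
move=> w0; apply: (Rle_trans _ (\rsum_(Q <- idx n D) \rsum_(P <- idx n D)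
    \rsum_(P' <- idx n D) if madd P P' == Q then
      Cnorm (F P) * Cnorm (G P') * w Q else 0)).
  apply: rsum_le => Q; rewrite mem_idx => /andP[/eqP sQ dQ] _.
  rewrite (smulE _ _ sQ dQ).
  apply: (Rle_trans _ ((\rsum_(P <- idx n D) \rsum_(P' <- idx n D | madd P P' == Q)
      (Cnorm (F P) * Cnorm (G P'))) * w Q)).
    apply: Rmult_le_compat_r; first exact: w0.
    apply: (Rle_trans _ _ _ (Cnorm_sum _ _ _)); apply: rsum_le => P _ _.
    apply: (Rle_trans _ _ _ (Cnorm_sum _ _ _)); apply: rsum_le => P' _ _.
    by rewrite CnormM; lra.
  rewrite big_distrl; apply: Req_le; apply: eq_bigr => P _ /=.
  by rewrite big_distrl big_mkcond.
rewrite exchange_big; apply: rsum_le => P; rewrite mem_idx => /andP[/eqP sP dP] _.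
rewrite exchange_big; apply: rsum_le => P'; rewrite mem_idx => /andP[/eqP sP' dP'] _.
rewrite -big_mkcond; case: leqP => dPP; last first.
  rewrite big1_seq; first by lra.
  move=> Q /andP[/eqP <-]; rewrite mem_idx deg_madd ?sP // => /andP[_]; lia.
rewrite (big_rem (madd P P')) /=; last first.
  by rewrite mem_idx (size_madd sP sP') eqxx deg_madd ?sP.
rewrite eqxx big1_seq; first by lra.
move=> Q /andP[/eqP <-]; rewrite mem_rem_uniq ?uniq_idx // inE eqxx //.
Qed.

Lemma nrm_smul D w F G : (forall Q, 0 <= w Q) ->
  (forall P P', size P = n -> size P' = n -> w (madd P P') <= w P * w P') ->
  nrm n D w (smul F G) <= nrm n D w F * nrm n D w G.
Proof.
move=> w0 wM; apply: Rle_trans (nrm_smul_le _ _ _ w0) _.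
rewrite /nrm big_distrlr /=; apply: rsum_le => P; rewrite mem_idx => /andP[/eqP sP _] _.
apply: rsum_le => P'; rewrite mem_idx => /andP[/eqP sP' _] _.
have H := wM _ _ sP sP'; have FP := Cnorm_ge0 (F P); have GP := Cnorm_ge0 (G P').
have FG : 0 <= Cnorm (F P) * Cnorm (G P') by nra.
case: ifP => _; first by nra.
by have H1 := Rmult_le_pos _ _ FP (w0 P); have H2 := Rmult_le_pos _ _ GP (w0 P'); nra.
Qed.

(** The gain of one degree, from the vanishing of both factors at 0, drives the
    induction on the truncation degree in [conv_recursion]. *)
Lemma nrm_smul_S D w v F G : (forall Q, 0 <= w Q) -> (forall Q, 0 <= v Q) ->
  (forall P P', size P = n -> size P' = n -> (0 < deg P)%N -> (0 < deg P')%N ->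
     v (madd P P') <= w P * w P') ->
  (forall Q, size Q = n -> deg Q = 0%N -> F Q = C0) ->
  (forall Q, size Q = n -> deg Q = 0%N -> G Q = C0) ->
  nrm n D.+1 v (smul F G) <= nrm n D w F * nrm n D w G.
Proof.
move=> w0 v0 wM F0 G0; apply: Rle_trans (nrm_smul_le _ _ _ v0) _.
pose b P P' := if (deg P + deg P' <= D.+1)%N then
  Cnorm (F P) * Cnorm (G P') * v (madd P P') else 0.
(* Since the total degree is at most [D + 1], a factor of degree above [D] leaves degree 0 for the
   other, whose coefficient vanishes there. *)
have b0 P P' : size P = n -> size P' = n ->
    (D < deg P)%N || (D < deg P')%N -> b P P' = 0.
  move=> sP sP' H; rewrite /b; case: ifP => // dPP.
  have [/F0 ->|dP] := posnP (deg P); rewrite ?Cnorm0; first by ring.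
    by [].
  have [/G0 ->|dP'] := posnP (deg P'); rewrite ?Cnorm0; first by ring.
    by [].
  by lia.
rewrite -[X in X <= _]/(\rsum_(P <- idx n D.+1) \rsum_(P' <- idx n D.+1) b P P').
rewrite -(@big_idx n _ _ _ D); first last.
- move=> P sP dP; rewrite big1_seq // => P'; rewrite mem_idx => /and3P[_ /eqP sP' _].
  by apply: b0 => //; lia.
- by [].
rewrite /nrm big_distrlr /=; apply: rsum_le => P; rewrite mem_idx => /andP[/eqP sP dP] _.
rewrite -(@big_idx n _ _ _ D); first last.
- by move=> P' sP' dP'; apply: b0 => //; lia.
- by [].
apply: rsum_le => P'; rewrite mem_idx => /andP[/eqP sP' dP'] _; rewrite /b.
have FP := Cnorm_ge0 (F P); have GP := Cnorm_ge0 (G P').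
have H1 := Rmult_le_pos _ _ FP (w0 P); have H2 := Rmult_le_pos _ _ GP (w0 P').
case: ifP => dPP; last by nra.
have [/F0 ->|dP0] := posnP (deg P); rewrite ?Cnorm0 //; first by lra.
have [/G0 ->|dP0'] := posnP (deg P'); rewrite ?Cnorm0 //; first by lra.
have H := wM _ _ sP sP' dP0 dP0'.
by have := Rmult_le_compat_l _ _ _ (Rmult_le_pos _ _ FP GP) H; lra.
Qed.

Section Weight.
Variables (w : seq nat -> R) (D : nat) (x : R).
Hypothesis w0 : forall Q, 0 <= w Q.
Hypothesis w1 : w (zeroQ n) = 1.
Hypothesis wM : forall P P', size P = n -> size P' = n ->
  w (madd P P') <= w P * w P'.

Lemma nrm_sone : nrm n D w sone = 1.
Proof.
rewrite /nrm (big_rem (zeroQ n)) ?zeroQ_in //= big1_seq.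
  by rewrite soneE deg_zeroQ /= Cnorm1 w1; ring.
move=> Q /andP[_]; rewrite mem_rem_uniq ?uniq_idx // inE mem_idx.
move=> /andP[Q0 /andP[/eqP sQ _]]; rewrite soneE; case: eqP => [dQ|_].
  by rewrite (deg0_zeroQ dQ) sQ eqxx in Q0.
by rewrite /= Cnorm0; ring.
Qed.

Lemma nrm_spow F k : nrm n D w F <= x -> nrm n D w (spow F k) <= x ^ k.
Proof.
move=> Fx; elim: k => [|k IH] /=; first by rewrite nrm_sone; lra.
apply: Rle_trans (nrm_smul _ _ _ w0 wM) _.
by apply: Rmult_le_compat => //; apply: nrm_ge0.
Qed.

Lemma nrm_smono (F : pmap) P : size P = n ->
  (forall i, (i < n)%N -> nrm n D w (F i) <= x) ->
  nrm n D w (smono F P) <= x ^ deg P.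
Proof.
move=> sP Fx; rewrite /smono.
have : (0 + size P <= n)%N by rewrite sP.
elim: P {sP} 0%N => [|p P IH] i /= iP; first by rewrite nrm_sone; lra.
apply: Rle_trans (nrm_smul _ _ _ w0 wM) _.
rewrite -/(deg P) pow_add; apply: Rmult_le_compat; try exact: nrm_ge0.
  by apply/nrm_spow/Fx; lia.
by apply: IH; lia.
Qed.

End Weight.

Lemma madd_unitQ P : size P = n -> (0 < deg P)%N ->
  exists i P', [/\ (i < n)%N, size P' = n & P = madd (unitQ n i) P'].
Proof.
move=> <-; elim: P => // -[|p] P IH.
  rewrite deg_cons add0n => /IH [i [P' [lt_iP sP' E]]].
  by exists i.+1, (0%N :: P'); rewrite unitQS /= sP'; split=> //; congr cons.
move=> _; exists 0%N, (p :: P); rewrite unitQ0; split=> //=.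
exact/esym/(congr1 (cons p.+1) (madd0Q (erefl (size P)))).
Qed.

(** [F^P] is split as [F_i] times [F^P'] with [deg P' >= 1]. The outer product is estimated by
    [nrm_smul_S], which uses the weight [v] and gains a degree; the inner monomial only needs
    submultiplicativity of [w]. *)
Lemma nrm_smono_S (F : pmap) w v D x P : (forall Q, 0 <= w Q) -> (forall Q, 0 <= v Q) ->
  w (zeroQ n) = 1 ->
  (forall P P', size P = n -> size P' = n -> w (madd P P') <= w P * w P') ->
  (forall P P', size P = n -> size P' = n -> (0 < deg P)%N -> (0 < deg P')%N ->
     v (madd P P') <= w P * w P') ->
  fix0 n F -> (forall i, (i < n)%N -> nrm n D w (F i) <= x) ->
  size P = n -> (2 <= deg P)%N -> nrm n D.+1 v (smono F P) <= x ^ deg P.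
Proof.
move=> w0 v0 w1 wM vM F0 Fx sP dP.
have [|i [P' [lt_in sP' E]]] := madd_unitQ sP; first by lia.
have dE : deg P = (deg P').+1 by rewrite E deg_madd ?size_unitQ // deg_unitQ.
rewrite {1}E (@nrm_eqs _ _ _ (smul (F i) (smono F P'))); last first.
  apply: eqs_trans (smono_madd F _) _; first by rewrite size_unitQ.
  by apply: smul_exts => //; apply: smono_unitQ.
rewrite dE; apply: Rle_trans (nrm_smul_S D w0 v0 vM _ _) _.
- by move=> Q; apply: (proj1 (fix0P _ _) F0).
- by move=> Q sQ dQ; apply: (smono_order F0 sP' sQ); lia.
apply: Rmult_le_compat; try exact: nrm_ge0; first exact: Fx.
by apply: nrm_smono.
Qed.

End Norms.

(** * Convergent power series *)

Lemma conv_seriesE n F : conv_series n F <->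
  exists r M, 0 < r /\ forall D, nrm n D (fun Q => r ^ deg Q) F <= M.
Proof.
by split=> -[r [M [r0 H]]]; exists r, M; split=> // D; have := H D; rewrite RsumE.
Qed.

Lemma pow_deg_ge0 r (Q : seq nat) : 0 < r -> 0 <= r ^ deg Q.
Proof. by move=> r0; apply/pow_le/Rlt_le. Qed.

Lemma pow_deg_zeroQ r n : r ^ deg (zeroQ n) = 1.
Proof. by rewrite deg_zeroQ. Qed.

Lemma pow_deg_madd n r P P' : size P = n -> size P' = n ->
  r ^ deg (madd P P') <= r ^ deg P * r ^ deg P'.
Proof. by move=> sP sP'; rewrite deg_madd ?sP // pow_add; lra. Qed.

Lemma nrm_le n D w w' F : (forall Q, size Q = n -> w Q <= w' Q) ->
  nrm n D w F <= nrm n D w' F.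
Proof.
move=> H; apply: rsum_le => Q; rewrite mem_idx => /andP[/eqP sQ _] _.
by apply: Rmult_le_compat_l; [apply: Cnorm_ge0 | apply: H].
Qed.

(** A finite family has a common radius, and the sum of the absolute values of its coefficients
    serves as one majorant for all members. *)
Lemma conv_family (I : eqType) n (l : seq I) (G : I -> series) :
  (forall x, x \in l -> conv_series n (G x)) ->
  exists s M, 0 < s /\ forall D,
    \rsum_(P <- idx n D) (\rsum_(x <- l) Cnorm (G x P)) * s ^ deg P <= M.
Proof.
elim: l => [|x l IH] H.
  exists 1, 0; split=> [|D]; first by lra.
  by rewrite big1 => [|P _]; rewrite ?big_nil; lra.
have [|s [M [s0 sM]]] := IH; first by move=> y yl; apply: H; rewrite inE yl orbT.
have /conv_seriesE [r [N [r0 rN]]] := H x (mem_head _ _).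
have m0 : 0 < Rmin r s by apply: Rmin_glb_lt.
exists (Rmin r s), (N + M); split=> // D.
apply: Rle_trans (Rplus_le_compat _ _ _ _ (rN D) (sM D)).
rewrite /nrm -big_split /=; apply: rsum_le => P _ _; rewrite big_cons Rmult_plus_distr_r.
apply: Rplus_le_compat; apply: Rmult_le_compat_l.
- exact: Cnorm_ge0.
- by apply: pow_incr; split; [lra | apply: Rmin_l].
- by apply: rsum_ge0 => y _ _; apply: Cnorm_ge0.
by apply: pow_incr; split; [lra | apply: Rmin_r].
Qed.

Lemma conv_map_common n F : conv_map n F ->
  exists s M, [/\ 0 < s, 0 <= M & forall i, (i < n)%N ->
    forall D, nrm n D (fun Q => s ^ deg Q) (F i) <= M].
Proof.
move=> cF; have [|s [M [s0 H]]] := @conv_family _ n (iota 0 n) F.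
  by move=> i; rewrite mem_iota => /andP[_ /ltP]; apply: cF.
exists s, M; split=> //.
  apply: Rle_trans (H 0%N); apply: rsum_ge0 => P _ _.
  apply: Rmult_le_pos; last exact: pow_deg_ge0.
  by apply: rsum_ge0 => y _ _; apply: Cnorm_ge0.
move=> i lt_in D; apply: Rle_trans (H D); apply: rsum_le => P _ _.
apply: Rmult_le_compat_r; first exact: pow_deg_ge0.
apply: (rsum_single (F := fun x => Cnorm (F x P))); last by rewrite mem_iota.
by move=> x _; apply: Cnorm_ge0.
Qed.

Lemma conv_series_eqs n F G : eqs n F G -> conv_series n F -> conv_series n G.
Proof.
move=> FG /conv_seriesE [r [M [r0 H]]]; apply/conv_seriesE; exists r, M; split=> // D.
by rewrite -(nrm_eqs _ _ FG).
Qed.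

(** Without constant term every monomial carries at least one factor [r / s]; so the norm becomes
    arbitrarily small with the radius. *)
Lemma nrm_shrink n D r s F : 0 < r -> r <= s ->
  (forall Q, size Q = n -> deg Q = 0%N -> F Q = C0) ->
  nrm n D (fun Q => r ^ deg Q) F <= r / s * nrm n D (fun Q => s ^ deg Q) F.
Proof.
move=> r0 rs F0; rewrite /nrm big_distrr /=.
apply: rsum_le => Q; rewrite mem_idx => /andP[/eqP sQ _] _.
case E : (deg Q) => [|d]; first by rewrite F0 // Cnorm0; lra.
have := Cnorm_ge0 (F Q); have := pow_incr r s d (conj (Rlt_le _ _ r0) rs).
move=> H1 H2; rewrite /= (_ : _ * _ * _ = Cnorm (F Q) * (r * s ^ d)).
  by apply: Rmult_le_compat_l => //; apply: Rmult_le_compat_l; lra.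
by field; lra.
Qed.

Lemma rsum_idx_le n d D (f : seq nat -> R) (p : pred (seq nat)) : (d <= D)%N ->
  (forall P, size P = n -> 0 <= f P) ->
  \rsum_(P <- idx n d | p P) f P <= \rsum_(P <- idx n D | p P) f P.
Proof.
move=> dD f0; rewrite big_mkcond [X in _ <= X]big_mkcond /=.
have pf P : P \in idx n D -> 0 <= (if p P then f P else 0).
  by rewrite mem_idx => /andP[/eqP /f0 ? _]; case: (p P); lra.
apply: (Rle_trans _ (\rsum_(P <- idx n D | (deg P <= d)%N) if p P then f P else 0)).
  rewrite -[X in _ <= X]big_filter; apply: Req_le; apply: perm_big.
  apply: uniq_perm; rewrite ?filter_uniq ?uniq_idx // => P.
  by rewrite mem_filter !mem_idx; case: eqP; rewrite ?andbF //=; lia.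
by apply: rsum_le_cond.
Qed.

(** On a small enough radius all components of [F] have norm at most the radius [t] of [G]. Then
    [F^P] has norm at most [t ^ deg P], and the composition is bounded by the norm of [G]. *)
Lemma conv_scomp n (F : pmap) G : fix0 n F -> conv_map n F -> conv_series n G ->
  conv_series n (scomp n F G).
Proof.
move=> F0 /conv_map_common [s [M [s0 M0 FM]]] /conv_seriesE [t [N [t0 GN]]].
have M1 : 0 < M + 1 by lra.
(* The second bound yields [r / s * M <= t]; the shift to [M + 1] keeps the denominator positive
   when [M = 0]. *)
pose r := Rmin s (s * t / (M + 1)).
have st : 0 < s * t / (M + 1) by apply: Rdiv_lt_0_compat => //; nra.
have r0 : 0 < r by apply: Rmin_glb_lt.
have rs : r <= s by apply: Rmin_l.
have rt : r / s * M <= t.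
  have H : r / s <= t / (M + 1).
    rewrite (_ : t / (M + 1) = s * t / (M + 1) / s); last by field; lra.
    by apply: Rmult_le_compat_r; [apply/Rlt_le/Rinv_0_lt_compat | apply: Rmin_r].
  apply: (Rle_trans _ (t / (M + 1) * M)); first exact: Rmult_le_compat_r.
  rewrite (_ : _ * M = t - t / (M + 1)); last by field; lra.
  by have := Rdiv_lt_0_compat _ _ t0 M1; lra.
apply/conv_seriesE; exists r, N; split=> // D.
have Ft i : (i < n)%N -> nrm n D (fun Q => r ^ deg Q) (F i) <= t.
  move=> lt_in; apply: Rle_trans rt.
  apply: Rle_trans (nrm_shrink D r0 rs (fun Q => proj1 (fix0P n F) F0 i Q lt_in)) _.
  by apply: Rmult_le_compat_l; [apply/Rlt_le/Rdiv_lt_0_compat | apply: FM].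
apply: Rle_trans (GN D).
apply: (Rle_trans _ (\rsum_(P <- idx n D)
   Cnorm (G P) * nrm n D (fun Q => r ^ deg Q) (smono F P))).
  apply: (Rle_trans _ (\rsum_(Q <- idx n D) \rsum_(P <- idx n D)
     Cnorm (G P) * (Cnorm (smono F P Q) * r ^ deg Q))).
    apply: rsum_le => Q; rewrite mem_idx => /andP[/eqP sQ dQ] _.
    rewrite (scompE _ F0 sQ dQ).
    apply: Rle_trans (Rmult_le_compat_r _ _ _ (pow_deg_ge0 _ r0) (Cnorm_sum _ _ _)) _.
    rewrite big_distrl; apply: Req_le; apply: eq_bigr => P _ /=.
    by rewrite CnormM; ring.
  rewrite exchange_big; apply: Req_le; apply: eq_bigr => P _.
  by rewrite /nrm big_distrr.
apply: rsum_le => P; rewrite mem_idx => /andP[/eqP sP _] _.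
apply: Rmult_le_compat_l; first exact: Cnorm_ge0.
by apply: (nrm_smono (fun Q => pow_deg_ge0 Q r0) (pow_deg_zeroQ r n)
  (@pow_deg_madd n r)).
Qed.

Lemma conv_pcomp n G F : fix0 n F -> conv_map n F -> conv_map n G ->
  conv_map n (pcomp n G F).
Proof.
move=> F0 cF cG j jn; apply: conv_series_eqs (conv_scomp F0 cF (cG j jn)).
by move=> Q _; rewrite pcompE.
Qed.

Lemma conv_lin n A : conv_map n (lin n A).
Proof.
move=> j _; apply/conv_seriesE; exists 1, (nrm n 1 (fun Q => 1 ^ deg Q) (lin n A j)).
split=> [|[|D]]; first by lra.
  apply: (@rsum_idx_le n 0 1 _ xpredT) => // P _.
  by have := Cnorm_ge0 (lin n A j P); rewrite pow1; lra.
apply: Req_le; symmetry; apply: big_idx => // P sP dP.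
by rewrite lin_nonlinear ?Cnorm0; [ring | lia].
Qed.

(** [kappa] bounds the inverse divisors; [T] is a multiplicative majorant
    absorbing them. *)
Definition absorbs n (kappa T : seq nat -> R) (A : R) : Prop :=
  [/\ (forall Q, 0 < T Q), T (zeroQ n) = 1, (forall i, (i < n)%N -> 1 <= T (unitQ n i)),
      (forall P P', size P = n -> size P' = n -> (0 < deg P)%N -> (0 < deg P')%N ->
         T P * T P' <= T (madd P P') /\ kappa (madd P P') * (T P * T P') <= T (madd P P'))
    & (1 <= A /\ forall Q, size Q = n -> T Q <= A ^ deg Q)].

(** With weight [r^|Q| / T Q], the linear part of [phi] has norm at most [r]. If the norm up to
    degree [D] is at most [2r], the terms of degree from 2 to [D + 1] have norm at most the sum of
    [a_P (2r)^|P|], hence at most [M (2r/s)^2 <= r]. So the bound [2r] passes from [D] to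
    [D + 1]. *)
Theorem conv_recursion n kappa T A (a : seq nat -> R) s M (phi : pmap) :
  (forall Q, 0 <= kappa Q) -> absorbs n kappa T A ->
  (forall P, 0 <= a P) -> 0 < s ->
  (forall D, \rsum_(P <- idx n D) a P * s ^ deg P <= M) ->
  fix0 n phi ->
  (forall j Q, (j < n)%N -> size Q = n -> deg Q = 1%N -> phi j Q = sid n j Q) ->
  (forall j Q, (j < n)%N -> size Q = n -> (2 <= deg Q)%N -> Cnorm (phi j Q) <=
     kappa Q * \rsum_(P <- idx n (deg Q) | (2 <= deg P)%N) a P * Cnorm (smono phi P Q)) ->
  conv_map n phi.
Proof.
move=> k0 [T0 T1 Tu TM [A1 TA]] a0 s0 aM phi0 phi1 phi2.
have M0 : 0 <= M.
  apply: Rle_trans (aM 0%N); apply: rsum_ge0 => P _ _.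
  by apply: Rmult_le_pos => //; apply: pow_deg_ge0.
(* The two entries are made for [2 * r <= s] and [M * (2 * r / s) ^ 2 <= r]. *)
pose r := Rmin (s / 2) (s * s / (4 * (M + 1))).
have r0 : 0 < r by apply: Rmin_glb_lt; apply: Rdiv_lt_0_compat; nra.
have rs : 2 * r <= s by have := Rmin_l (s / 2) (s * s / (4 * (M + 1))); rewrite -/r; lra.
have rM : M * (2 * r / s) ^ 2 <= r.
  have H : r * (4 * (M + 1)) <= s * s.
    have := Rmin_r (s / 2) (s * s / (4 * (M + 1))); rewrite -/r => H.
    have := Rmult_le_compat_r (4 * (M + 1)) _ _ _ H.
    rewrite (_ : s * s / (4 * (M + 1)) * (4 * (M + 1)) = s * s); last by field; lra.
    by apply; lra.
  apply: (Rmult_le_reg_r (s * s)); first nra.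
  rewrite (_ : _ * (s * s) = 4 * M * r * r); last by field; lra.
  by nra.
pose w Q := r ^ deg Q / T Q.
(* The small divisor is put into the weight [v]; the second inequality of [absorbs] says that a
   product of two factors measured by [w] pays for it. *)
pose v Q := kappa Q * w Q.
have w0 Q : 0 <= w Q by apply/Rlt_le/Rdiv_lt_0_compat => //; apply: pow_lt.
have v0 Q : 0 <= v Q by apply: Rmult_le_pos.
have w1 : w (zeroQ n) = 1 by rewrite /w deg_zeroQ T1 /=; field.
have wE P P' : size P = n -> size P' = n ->
    w P * w P' = r ^ deg (madd P P') / (T P * T P').
  move=> sP sP'; rewrite /w deg_madd ?sP // pow_add; field.
  by split; apply: Rgt_not_eq.
have wM P P' : size P = n -> size P' = n -> w (madd P P') <= w P * w P'.
  move=> sP sP'; have [d0|dP] := posnP (deg P).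
    by rewrite (deg0_zeroQ d0) sP madd0Q // w1; lra.
  have [d0|dP'] := posnP (deg P').
    by rewrite (deg0_zeroQ d0) sP' maddC madd0Q // w1; lra.
  rewrite wE //; apply: Rmult_le_compat_l; first exact: pow_deg_ge0.
  by apply: Rinv_le_contravar; [apply: Rmult_lt_0_compat | case: (TM P P')].
have vM P P' : size P = n -> size P' = n -> (0 < deg P)%N -> (0 < deg P')%N ->
    v (madd P P') <= w P * w P'.
  move=> sP sP' dP dP'; have [_ H] := TM _ _ sP sP' dP dP'.
  have TT : 0 < T P * T P' by apply: Rmult_lt_0_compat.
  have rd := pow_deg_ge0 (madd P P') r0.
  rewrite wE // /v /w; apply: (Rmult_le_reg_r (T P * T P' * T (madd P P'))).
    exact: Rmult_lt_0_compat.
  rewrite (_ : _ / (T P * T P') * _ = r ^ deg (madd P P') * T (madd P P')); last first.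
    by field; split; apply: Rgt_not_eq.
  rewrite (_ : _ * _ = r ^ deg (madd P P') * (kappa (madd P P') * (T P * T P'))).
    exact: Rmult_le_compat_l.
  by field; apply: Rgt_not_eq.
have key D j : (j < n)%N -> nrm n D w (phi j) <= 2 * r.
  elim: D j => [|D IH] j jn.
    rewrite /nrm big1_seq; first by lra.
    move=> Q /andP[_]; rewrite mem_idx leqn0 => /andP[/eqP sQ /eqP dQ].
    by rewrite (proj1 (fix0P _ _) phi0) // Cnorm0; ring.
  rewrite /nrm big_split_idx //= (proj1 (fix0P _ _) phi0) ?size_zeroQ ?deg_zeroQ //.
  rewrite Cnorm0 Rmult_0_l Rplus_0_l.
  suff [H1 H2] : \rsum_(i <- iota 0 n) (Cnorm (phi j (unitQ n i)) * w (unitQ n i)) <= r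
     /\ \rsum_(Q <- idx n D.+1 | (2 <= deg Q)%N) (Cnorm (phi j Q) * w Q) <= r by lra.
  split.
    rewrite (big_rem j) ?mem_iota //= big1_seq; last first.
      move=> i /andP[_]; rewrite mem_rem_uniq ?iota_uniq // inE mem_iota.
      move=> /andP[ij /andP[_ lt_in]].
      rewrite phi1 ?size_unitQ ?deg_unitQ //.
      rewrite (proj1 (meqP _ _ _) (@sidE n) j jn _ (size_unitQ n i)).
      rewrite /dg /mon; case: eqP => [E|_].
        by move: ij; rewrite (unitQ_inj lt_in E) eqxx.
      by rewrite (_ : (_ * _)%cx = C0) ?Cnorm0 /ind; [ring | ring].
    rewrite phi1 ?size_unitQ ?deg_unitQ //.
    rewrite (proj1 (meqP _ _ _) (@sidE n) j jn _ (size_unitQ n j)).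
    rewrite /dg /mon eqxx CnormM /= Cnorm1 /w deg_unitQ // pow_1 Rplus_0_r !Rmult_1_l.
    apply: (Rmult_le_reg_r (T (unitQ n j))); first exact: T0.
    rewrite /Rdiv Rmult_assoc Rinv_l; last exact: Rgt_not_eq.
    by apply: Rmult_le_compat_l; [lra | apply: Tu].
  apply: (Rle_trans _ (\rsum_(P <- idx n D.+1 | (2 <= deg P)%N)
     a P * nrm n D.+1 v (smono phi P))).
    apply: (Rle_trans _ (\rsum_(Q <- idx n D.+1 | (2 <= deg Q)%N)
       \rsum_(P <- idx n D.+1 | (2 <= deg P)%N) a P * (Cnorm (smono phi P Q) * v Q))).
      apply: rsum_le => Q; rewrite mem_idx => /andP[/eqP sQ dQ] dQ2.
      apply: Rle_trans (Rmult_le_compat_r _ _ _ (w0 Q) (phi2 _ _ jn sQ dQ2)) _.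
      rewrite (_ : _ * _ = (\rsum_(P <- idx n (deg Q) | (2 <= deg P)%N)
        a P * Cnorm (smono phi P Q)) * v Q); last by rewrite /v; ring.
      apply: Rle_trans (Rmult_le_compat_r _ _ _ (v0 Q) (@rsum_idx_le n _ _ _ _ dQ _)) _.
        by move=> P _; apply: Rmult_le_pos => //; apply: Cnorm_ge0.
      by rewrite big_distrl; apply: Req_le; apply: eq_bigr => P _ /=; ring.
    rewrite exchange_big; apply: rsum_le => P _ _.
    rewrite /nrm big_distrr /=; apply: rsum_le_cond => // Q _.
    apply: Rmult_le_pos => //; apply: Rmult_le_pos => //; exact: Cnorm_ge0.
  apply: Rle_trans rM; rewrite Rmult_comm.
  apply: (Rle_trans _ ((2 * r / s) ^ 2 * \rsum_(P <- idx n D.+1) a P * s ^ deg P)); last first.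
    by apply: Rmult_le_compat_l => //; apply: pow2_ge_0.
  rewrite big_distrr /=; apply: (Rle_trans _ (\rsum_(P <- idx n D.+1 | (2 <= deg P)%N)
     (2 * r / s) ^ 2 * (a P * s ^ deg P))); last first.
    apply: rsum_le_cond => // P _; apply: Rmult_le_pos; first exact: pow2_ge_0.
    by apply: Rmult_le_pos => //; apply: pow_deg_ge0.
  apply: rsum_le => P; rewrite mem_idx => /andP[/eqP sP _] dP.
  rewrite (_ : _ * (a P * _) = a P * ((2 * r / s) ^ 2 * s ^ deg P)); last by ring.
  apply: Rmult_le_compat_l => //.
  apply: (Rle_trans _ ((2 * r) ^ deg P)).
    by apply: (nrm_smono_S w0 v0 w1 wM vM) => //; lra.
  have [m ->] : exists m, deg P = (2 + m)%N by exists (deg P - 2)%N; lia.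
  rewrite !pow_add (_ : (2 * r / s) ^ 2 * _ = (2 * r) ^ 2 * s ^ m); last by field; lra.
  apply: Rmult_le_compat_l; first exact: pow2_ge_0.
  by apply: pow_incr; lra.
(* The geometric bound [T Q <= A ^ deg Q] converts the weighted bound into an ordinary one on the
   radius [r / A]. *)
move=> j /ltP jn; apply/conv_seriesE; exists (r / A), (2 * r).
split=> [|D]; first by apply: Rdiv_lt_0_compat; lra.
apply: Rle_trans (key D j jn); apply: nrm_le => Q sQ.
rewrite /w /Rdiv Rpow_mult_distr; apply: Rmult_le_compat_l; first exact: pow_deg_ge0.
by rewrite pow_inv; apply: Rinv_le_contravar => //; apply: TA.
Qed.

(** * Inversion *)

Definition tangent_id n (phi : pmap) :=
  forall j Q, (j < n)%N -> size Q = n -> deg Q = 1%N -> phi j Q = sid n j Q.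

Lemma sid_unitQ n i j : (i < n)%N -> (j < n)%N -> sid n j (unitQ n i) = ind (i == j).
Proof.
move=> lt_in jn; rewrite (proj1 (meqP _ _ _) (@sidE n) j jn _ (size_unitQ n i)).
rewrite /dg /mon; case: eqP => [/(unitQ_inj lt_in) ->|E].
  by rewrite eqxx /ind; ring.
by case: eqP E => [->|_] E //; rewrite /ind; ring.
Qed.

Lemma sid_higher n j Q : (j < n)%N -> size Q = n -> (2 <= deg Q)%N -> sid n j Q = C0.
Proof.
move=> jn sQ dQ; rewrite (proj1 (meqP _ _ _) (@sidE n) j jn _ sQ) /dg /mon.
by case: eqP => [E|_]; [rewrite E deg_unitQ in dQ | rewrite /ind; ring].
Qed.

Lemma higher_deg1 n F a Q : (deg Q <= 1)%N -> higher n F a Q = C0.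
Proof.
move=> dQ; rewrite /higher big1_seq // => P /andP[dP].
by rewrite mem_idx => /andP[_]; lia.
Qed.

Lemma scomp_diag n F (a : series) lam j Q : (j < n)%N ->
  (forall i, (i < n)%N -> a (unitQ n i) = dg n lam j (unitQ n i)) ->
  size Q = n -> (1 <= deg Q)%N ->
  scomp n F a Q = (lam j * F j Q + higher n F a Q)%cx.
Proof.
move=> jn aL sQ dQ; rewrite scomp_split //; congr Cadd.
rewrite (@csum_delta _ _ j) ?iota_uniq //.
  by rewrite mem_iota jn aL // /dg /mon eqxx /ind /=; ring.
move=> i; rewrite mem_iota => /andP[_ lt_in] ij; rewrite aL // /dg /mon.
case: eqP => [/(unitQ_inj lt_in) E|_]; first by rewrite E eqxx in ij.
by rewrite /ind; ring.
Qed.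

(** The equation [phi o psi = id] reads [psi_Q = - higher psi phi Q] in degree at least 2. This is a
    recursion without small divisors, so the constant weights 1 suffice. *)
Lemma right_inverse n phi : fix0 n phi -> tangent_id n phi -> conv_map n phi ->
  exists psi, [/\ fix0 n psi, tangent_id n psi, conv_map n psi
    & meq n (pcomp n phi psi) (sid n)].
Proof.
move=> phi0 phi1 cphi.
pose psi := solve n (fun _ _ => Copp C1) (fun j _ => phi j).
have psi0 : fix0 n psi by apply: solve_fix0.
exists psi; split=> //; first by move=> j Q _ _; apply: solve_deg1.
- have [|s [M [s0 H]]] := @conv_family _ n (iota 0 n) phi.
    by move=> i; rewrite mem_iota => /andP[_ /ltP]; apply: cphi.
  apply: (@conv_recursion n (fun=> 1) (fun=> 1) 1
    (fun P => \rsum_(x <- iota 0 n) Cnorm (phi x P)) s M) => //.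
  + by move=> ?; lra.
  + by split=> // *; rewrite ?pow1; try lra; split=> *; rewrite ?pow1; lra.
  + by move=> P; apply: rsum_ge0 => x _ _; apply: Cnorm_ge0.
  + by move=> j Q _ _; apply: solve_deg1.
  move=> j Q jn sQ dQ; rewrite /psi solve_eq // -/psi CnormM CnormN Cnorm1.
  apply: Rmult_le_compat_l; first by lra.
  apply: Rle_trans (Cnorm_sum _ _ _) _; apply: rsum_le => P _ _; rewrite CnormM.
  apply: Rmult_le_compat_r; first exact: Cnorm_ge0.
  apply: (rsum_single (F := fun x => Cnorm (phi x P))); last by rewrite mem_iota.
  by move=> x _; apply: Cnorm_ge0.
apply/meqP => j jn Q sQ; rewrite pcompE.
have [d0|dQ] := posnP (deg Q).
  rewrite -pcompE (proj1 (fix0P _ _) (pcomp_fix0 phi0 psi0)) //.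
  by rewrite (proj1 (fix0P _ _) (@sid_fix0 n)).
rewrite (@scomp_diag _ _ _ (fun=> C1) j) //; last first.
  move=> i lt_in; rewrite phi1 ?size_unitQ ?deg_unitQ //.
  exact: (proj1 (meqP _ _ _) (@sidE n) j jn _ (size_unitQ n i)).
case: (leqP (deg Q) 1) => d1.
  rewrite higher_deg1 // /psi solve_deg1; [ring | lia].
by rewrite {1}/psi solve_eq // -/psi sid_higher //; ring.
Qed.

(** The right inverse [psi] has itself a right inverse [chi], and [phi = phi o psi o chi = chi]. *)
Theorem inverse_exists n phi : fix0 n phi -> tangent_id n phi -> conv_map n phi ->
  exists psi, [/\ fix0 n psi, conv_map n psi, meq n (pcomp n phi psi) (sid n)
    & meq n (pcomp n psi phi) (sid n)].
Proof.
move=> phi0 phi1 cphi; have [psi [psi0 psi1 cpsi E]] := right_inverse phi0 phi1 cphi.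
have [chi [chi0 _ _ E']] := right_inverse psi0 psi1 cpsi.
exists psi; split=> //; rewrite -[in X in meq n X _](pcompid (n:=n) phi) -E'.
rewrite (pcompA phi psi0 chi0) E pidcomp //.
Qed.

(** * Simultaneous formal linearization *)

Section FormalLinearization.
Variables (n h : nat) (g : nat -> pmap) (Lam : nat -> nat -> C).
Hypothesis g0 : forall k, (k < h)%N -> fix0 n (g k).
Hypothesis gL : forall k j i, (k < h)%N -> (j < n)%N -> (i < n)%N ->
  g k j (unitQ n i) = dg n (Lam k) j (unitQ n i).
Hypothesis gC : forall p q, (p < h)%N -> (q < h)%N ->
  meq n (pcomp n (g p) (g q)) (pcomp n (g q) (g p)).
Hypothesis gF : forall k, (k < h)%N -> formally_linearizable n (g k).
Variables (phi : pmap) (kk : nat -> seq nat -> nat) (res : seq nat -> bool).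
Hypothesis kkh : forall j Q, (kk j Q < h)%N.
Hypothesis resP : forall Q, res Q -> size Q = n ->
  forall k j, (k < h)%N -> (j < n)%N -> cmono (Lam k) Q = Lam k j.
(** [kk j Q] is the index of the map whose equation determines [phi j Q], and [mu j Q] is the
    divisor of that equation. *)
Let mu j Q := (cmono (Lam (kk j Q)) Q - Lam (kk j Q) j)%cx.
Hypothesis nonresP : forall j Q, (j < n)%N -> size Q = n -> (2 <= deg Q)%N ->
  ~~ res Q -> mu j Q <> C0.
Hypothesis phi0 : fix0 n phi.
Hypothesis phi1 : tangent_id n phi.
Hypothesis phi2 : forall j Q, (j < n)%N -> size Q = n -> (2 <= deg Q)%N ->
  ~~ res Q -> (mu j Q * phi j Q)%cx = higher n phi (g (kk j Q) j) Q.

Let E k j Q := (pcomp n (g k) phi j Q - pcomp n phi (dg n (Lam k)) j Q)%cx.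

Lemma defectE k j Q : (k < h)%N -> (j < n)%N -> size Q = n -> (1 <= deg Q)%N ->
  E k j Q = (higher n phi (g k j) Q - (cmono (Lam k) Q - Lam k j) * phi j Q)%cx.
Proof.
move=> kh jn sQ dQ; rewrite /E pcomp_dg // pcompE (@scomp_diag _ _ _ (Lam k) j) //.
  by ring.
by move=> i lt_in; apply: gL.
Qed.

(** The terms of degree at least 2 of the outer map [F] do not see [E k] in its
    lowest degree. *)
Lemma outer_defect F k j Q : fix0 n F -> (k < h)%N -> size Q = n -> (1 <= deg Q)%N ->
  (forall i P, (i < n)%N -> size P = n -> (deg P < deg Q)%N -> E k i P = C0) ->
  (scomp n (pcomp n (g k) phi) (F j) Q =
   scomp n phi (F j) Q * cmono (Lam k) Q +
   \csum_(i <- iota 0 n) F j (unitQ n i) * E k i Q)%cx.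
Proof.
move=> F0 kh sQ dQ IH.
have a0 : fix0 n (pcomp n (g k) phi) by apply: pcomp_fix0 => //; apply: g0.
have b0 : fix0 n (pcomp n phi (dg n (Lam k))) by apply: pcomp_fix0.
have := scomp_perturb (F j) a0 b0 _ sQ dQ; rewrite -/E => <-.
  have -> : scomp n (pcomp n phi (dg n (Lam k))) (F j) Q =
      (scomp n phi (F j) Q * cmono (Lam k) Q)%cx; last by ring.
  rewrite -(scomp_dg (Lam k) (scomp n phi (F j)) sQ) scompA //; apply: scomp_exts => // i _ P sP.
  exact: pcompE.
move=> i lt_in P sP dP; apply: Csub0_eq; apply: (IH i P) => //; lia.
Qed.

(** [g_l o g_k o phi] is expanded at [Q] by applying [outer_defect] with [g_l] outside, then again
    with the roles exchanged. Commutation equates the two expansions, and the terms in [phi]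
    cancel. *)
Lemma defect_exchange k l j Q : (k < h)%N -> (l < h)%N -> (j < n)%N ->
  size Q = n -> (1 <= deg Q)%N ->
  (forall k i P, (k < h)%N -> (i < n)%N -> size P = n -> (deg P < deg Q)%N ->
     E k i P = C0) ->
  ((cmono (Lam k) Q - Lam k j) * E l j Q = (cmono (Lam l) Q - Lam l j) * E k j Q)%cx.
Proof.
move=> kh lh jn sQ dQ IH.
have comp k' l' : (k' < h)%N -> (l' < h)%N -> pcomp n (pcomp n (g l') (g k')) phi j Q =
  (Lam l' j * E k' j Q + cmono (Lam k') Q * E l' j Q +
   cmono (Lam k') Q * cmono (Lam l') Q * phi j Q)%cx.
  move=> kh' lh'.
  have -> : pcomp n (pcomp n (g l') (g k')) phi j Q =
      pcomp n (g l') (pcomp n (g k') phi) j Q.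
    by symmetry; apply: pcompA => //; [apply: g0 | apply/ltP].
  rewrite pcompE outer_defect //; [|exact: g0|by move=> i P; apply: IH].
  rewrite (@csum_delta _ _ j) ?iota_uniq //; last first.
    move=> i; rewrite mem_iota => /andP[_ lt_in] ij; rewrite gL // /dg /mon.
    case: eqP => [/(unitQ_inj lt_in) F|_]; first by rewrite F eqxx in ij.
    by rewrite /ind; ring.
  rewrite mem_iota jn gL // /dg /mon eqxx /=.
  have -> : scomp n phi (g l' j) Q = (E l' j Q + phi j Q * cmono (Lam l') Q)%cx.
    by rewrite /E pcomp_dg // pcompE; ring.
  by rewrite /ind; ring.
have := comp k l kh lh.
have -> : pcomp n (pcomp n (g l) (g k)) phi j Q = pcomp n (pcomp n (g k) (g l)) phi j Q.
  by apply: pcomp_meq => //; [apply: gC | apply/ltP].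
rewrite comp // => H; apply: Csub0_eq.
transitivity ((Lam l j * E k j Q + cmono (Lam k) Q * E l j Q +
   cmono (Lam k) Q * cmono (Lam l) Q * phi j Q) -
  (Lam k j * E l j Q + cmono (Lam l) Q * E k j Q +
   cmono (Lam l) Q * cmono (Lam k) Q * phi j Q))%cx; first by ring.
by rewrite H; ring.
Qed.

(** At a fully resonant [Q] every eigenvalue of [g_k] equals [m], so the linear part is [m] times
    the identity. A formal linearization [q] then satisfies [q o g_k = m q]; evaluating
    [q o g_k o phi] at [Q] shows that the linear part of [q] kills the vector of defects, and this
    linear part is invertible. *)
Lemma defect_resonant k Q : (k < h)%N -> size Q = n -> (2 <= deg Q)%N -> res Q ->
  (forall i P, (i < n)%N -> size P = n -> (deg P < deg Q)%N -> E k i P = C0) ->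
  forall j, (j < n)%N -> E k j Q = C0.
Proof.
move=> kh sQ dQ rQ IH j jn.
pose m := cmono (Lam k) Q; pose D := dg n (fun=> m).
have [p [q [p0 [q0 [qp [pq L]]]]]] := gF kh.
have gk0 := g0 kh.
have gD : meq n (lin n (linpart n (g k))) D.
  apply: meq_trans (meq_sym (lin_linpart (@dg_linear n _))).
  apply: lin_ext => j' i jn' lt_in; rewrite /linpart gL // /dg /mon.
  by case: eqP => // F; rewrite -(resP rQ sQ kh jn').
(* The linearized map is conjugate, through the linear part of [q], to the scalar map [D], which
   commutes with every linear map; hence it is [D] itself. *)
have qgD : meq n (pcomp n q (g k)) (pcomp n D q).
  have DC F : fix0 n F -> meq n (pcomp n (lin n (linpart n F)) D)
      (pcomp n D (lin n (linpart n F))).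
    move=> F0; rewrite lin_dg dg_pcomp; last exact: lin_fix0.
    apply/meqP => j' _ P sP; rewrite /lin big_distrr.
    by apply: eq_bigr => i _ /=; ring.
  have E1 : meq n (pcomp n q (pcomp n (g k) p)) D.
    rewrite (lin_linpart L) linpart_lin_comp; last exact: pcomp_fix0.
    rewrite linpart_lin_comp // gD pcompA //; try exact: lin_fix0; try exact: dg_fix0.
    rewrite DC // -pcompA //; try exact: lin_fix0.
    rewrite -linpart_lin_comp // (linpart_meq qp) linpart_id.
    by rewrite pcompid.
  rewrite -[X in meq n X _]pcompid -pq pcompA // -(pcompA q) // ?E1 //.
have qE l : (l < n)%N -> (\csum_(i <- iota 0 n) q l (unitQ n i) * E k i Q = C0)%cx.
  move=> ln; have := outer_defect l q0 kh sQ (ltnW dQ) IH.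
  have -> : scomp n (pcomp n (g k) phi) (q l) Q = (scomp n phi (q l) Q * m)%cx.
    have -> : scomp n (pcomp n (g k) phi) (q l) Q = pcomp n (pcomp n q (g k)) phi l Q.
      rewrite -pcompE; apply: pcompA => //; exact/ltP.
    have -> : pcomp n (pcomp n q (g k)) phi l Q = pcomp n D (pcomp n q phi) l Q.
      transitivity (pcomp n (pcomp n D q) phi l Q).
        by apply: pcomp_meq => //; exact/ltP.
      by symmetry; apply: pcompA => //; exact/ltP.
    rewrite dg_pcomp //; [|exact: pcomp_fix0|exact/ltP].
    by rewrite pcompE; ring.
  exact: Cadd_fix.
(* The linear part of [p] inverts that of [q], so the defect is recovered from the combinations
   shown to vanish in [qE]. *)
transitivity (\csum_(l <- iota 0 n) p j (unitQ n l) *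
    \csum_(i <- iota 0 n) q l (unitQ n i) * E k i Q)%cx; last first.
  rewrite big1_seq // => l; rewrite mem_iota => /andP[_ /andP[_ ln]].
  by rewrite qE //; ring.
transitivity (\csum_(i <- iota 0 n) sid n j (unitQ n i) * E k i Q)%cx.
  rewrite (@csum_delta _ _ j) ?iota_uniq //.
    by rewrite sid_unitQ // mem_iota jn eqxx /ind /=; ring.
  move=> i; rewrite mem_iota => /andP[_ lt_in] ij.
  by rewrite sid_unitQ // (negbTE ij) /ind; ring.
transitivity (\csum_(i <- iota 0 n) \csum_(l <- iota 0 n)
    p j (unitQ n l) * (q l (unitQ n i) * E k i Q))%cx.
  apply: eq_big_seq => i; rewrite mem_iota => /andP[_ lt_in].
  have -> : sid n j (unitQ n i) = matmul n (linpart n p) (linpart n q) j i.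
    rewrite -linpart_pcomp //; symmetry; apply: pq; first exact/ltP.
    exact: size_unitQ.
  by rewrite matmulE big_distrl; apply: eq_bigr => l _ /=; rewrite /linpart; ring.
rewrite exchange_big; apply: eq_bigr => l _ /=.
by rewrite big_distrr.
Qed.

Theorem defect_eq0 k : (k < h)%N ->
  meq n (pcomp n (g k) phi) (pcomp n phi (dg n (Lam k))).
Proof.
move=> kh; apply/meqP => j jn Q sQ; apply: Csub0_eq; rewrite -/(E k j Q).
have [d] : exists d, (deg Q < d)%N by exists (deg Q).+1.
elim: d k j Q kh jn sQ => // d IHd k j Q kh jn sQ dQ.
have IH k' i P : (k' < h)%N -> (i < n)%N -> size P = n -> (deg P < deg Q)%N ->
    E k' i P = C0.
  by move=> kh' lt_in sP dP; apply: IHd => //; lia.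
case: (posnP (deg Q)) => [d0|d1].
  have := proj1 (fix0P _ _) (pcomp_fix0 (g0 kh) phi0) j Q jn sQ d0.
  rewrite /E => ->; rewrite pcomp_dg // (proj1 (fix0P _ _) phi0) //; ring.
case: (leqP (deg Q) 1) => d2.
  have {}d1 : deg Q = 1%N by lia.
  have [l ln QE] := deg1P sQ d1.
  rewrite defectE ?d1 // higher_deg1 ?d1 // phi1 // QE cmono_unitQ // sid_unitQ //.
  by case: eqP => [->|_]; rewrite /ind; ring.
case: (boolP (res Q)) => rQ.
  by apply: defect_resonant => // i P; apply: IH.
(* The equation used to define [phi j Q] holds by construction; the exchange relation carries this
   over to every other [k]. *)
have E0 : E (kk j Q) j Q = C0 by rewrite defectE // -phi2 // /mu; ring.
have := defect_exchange (kkh j Q) kh jn sQ d1 IH; rewrite E0 -/(mu j Q) => H.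
apply: (Cmul_integral _ (nonresP jn sQ d2 rQ)); rewrite H; ring.
Qed.

End FormalLinearization.

(** * Counting small divisors *)

(** [L] lists the internal nodes of a binary decomposition of [Q] into unit
    multi-indices. *)
Inductive tree n : seq nat -> seq (seq nat) -> Prop :=
| tree_leaf i : (i < n)%N -> tree n (unitQ n i) [::]
| tree_node P P' L L' : tree n P L -> tree n P' L' ->
    tree n (madd P P') (madd P P' :: L ++ L').

Section Trees.
Variable n : nat.

Lemma tree_size Q L : tree n Q L ->
  [/\ size Q = n, (0 < deg Q)%N & (size L).+1 = deg Q].
Proof.
elim=> [i lt_in|P P' L1 L2 _ [sP dP E] _ [sP' dP' E']].
  by rewrite size_unitQ deg_unitQ.
rewrite (size_madd sP sP') deg_madd ?sP //= size_cat; split=> //; lia.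
Qed.

Lemma tree_mem Q L x : tree n Q L -> x \in L ->
  size x = n /\ (2 <= deg x <= deg Q)%N.
Proof.
move=> t; elim: t x => // P P' L1 L2 t1 IH1 t2 IH2 x.
have [sP dP _] := tree_size t1; have [sP' dP' _] := tree_size t2.
rewrite inE mem_cat => /orP[/eqP ->|/orP[/IH1|/IH2]].
- rewrite (size_madd sP sP') deg_madd ?sP //; lia.
- by rewrite deg_madd ?sP // => -[]; lia.
by rewrite deg_madd ?sP // => -[]; lia.
Qed.

Lemma tree_exists Q : size Q = n -> (0 < deg Q)%N -> exists L, tree n Q L.
Proof.
have [d] : exists d, (deg Q <= d)%N by exists (deg Q).
elim: d Q => [|d IH] Q dQ sQ Q0; first by lia.
have [i [P' [lt_in sP' E]]] := madd_unitQ sQ Q0.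
have dE : deg Q = (deg P').+1 by rewrite E deg_madd ?size_unitQ // deg_unitQ.
case: (posnP (deg P')) => [d0|d1].
  exists [::]; rewrite E (deg0_zeroQ d0) sP' maddC madd0Q ?size_unitQ //.
  exact: tree_leaf.
have [|L tL] := IH P' _ sP' d1; first by lia.
exists (madd (unitQ n i) P' :: [::] ++ L); rewrite {1}E.
by apply: tree_node => //; apply: tree_leaf.
Qed.

(** The last bound, slightly better below a bad ancestor, is what makes the
    induction go through. *)
Lemma tree_count (bad : pred (seq nat)) m Q L :
  (forall P, size P = n -> (2 <= deg P)%N -> bad P -> (m < deg P)%N) ->
  (forall P S, size P = n -> size S = n -> (2 <= deg P)%N -> (0 < deg S)%N ->
     bad P -> bad (madd P S) -> (m <= deg S)%N) ->
  tree n Q L ->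
  [/\ ((deg Q <= m)%N -> count bad L = 0%N),
      ((m < deg Q)%N -> (m * count bad L + m <= 2 * deg Q)%N)
    & forall S, size S = n -> (0 < deg S)%N -> bad (madd Q S) ->
        (m * count bad L + 2 * m <= 2 * (deg Q + deg S))%N].
Proof.
move=> H1 H2; elim=> [i lt_in|P P' L1 L2 t1 [A1 B1 C1] t2 [A2 B2 C2]].
  rewrite muln0 deg_unitQ //=; split=> // [|S sS dS bS]; first by lia.
  have sU := size_unitQ n i.
  have := H1 _ (size_madd sU sS); rewrite deg_madd ?sU // deg_unitQ // => H.
  by have := H _ bS; lia.
have [sP dP _] := tree_size t1; have [sP' dP' _] := tree_size t2.
have sQ := size_madd sP sP'.
have dQ : deg (madd P P') = (deg P + deg P')%N by rewrite deg_madd ?sP.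
have bQ : bad (madd P P') -> (m < deg P + deg P')%N.
  by rewrite -dQ; apply: H1 => //; lia.
have C1' := C1 _ sP' dP'; have C2' := C2 _ sP dP; rewrite maddC in C2'.
rewrite /= count_cat dQ.
(* At a bad node whose children both have degree above [m], the second bounds of the children add up
   with exactly the spare [m] needed. If one child has degree at most [m], it contains no bad node,
   and the third bound of the other child is used with its sibling as [S]. *)
have first_part : [/\ ((deg P + deg P' <= m)%N ->
    (bad (madd P P') + (count bad L1 + count bad L2))%N = 0%N)
  & ((m < deg P + deg P')%N -> (m * (bad (madd P P') + (count bad L1 + count bad L2))
     + m <= 2 * (deg P + deg P'))%N)].
  case: (bad _) bQ C1' C2' => bQ C1' C2'; split=> dm.
  - by have := bQ isT; lia.
  - case: (leqP (deg P) m) => [/A1 a1|/B1]; case: (leqP (deg P') m) => [/A2 a2|/B2].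
    + by have := bQ isT; have := C1' isT; nia.
    + by have := C2' isT; nia.
    + by have := C1' isT; nia.
    + by nia.
  - by rewrite A1 ?A2; lia.
  case: (leqP (deg P) m) => [/A1 a1|/B1]; case: (leqP (deg P') m) => [/A2 a2|/B2]; nia.
case: first_part => F1 F2; split=> // S sS dS bS.
case: (boolP (bad (madd P P'))) => bP; rewrite ?bP ?(negbTE bP) in F2 *.
  have mS : (m <= deg S)%N.
    by apply: (H2 _ _ sQ sS _ dS bP bS); rewrite dQ; lia.
  by have := F2 (bQ bP); lia.
(* The node itself is good, so the bad multi-index [Q + S] is viewed from each child, with the
   sibling added to [S]. *)
have := C1 (madd P' S) (size_madd sP' sS); have := C2 (madd P S) (size_madd sP sS).
rewrite !deg_madd ?sP ?sP' // maddA (maddC P' P) maddA => c2 c1.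
have {}c1 := c1 (ltn_addr _ dP') bS; have {}c2 := c2 (ltn_addr _ dP) bS.
case: (leqP (deg P) m) => [/A1 a1|/B1]; case: (leqP (deg P') m) => [/A2 a2|/B2]; nia.
Qed.

End Trees.

(** * From a Brjuno series to a multiplicative majorant *)

Section Absorb.
Variables (n : nat) (m : nat -> nat) (eta : nat -> R) (d : nat -> seq nat -> R)
  (e : seq nat -> R) (B : R).
Hypothesis m_gt : forall v, (v < m v)%N.
Hypothesis eta_gt0 : forall v, 0 < eta v.
Hypothesis eta_le1 : forall v, eta v <= 1.
Hypothesis e_gt0 : forall Q, size Q = n -> (2 <= deg Q)%N -> 0 < e Q.
Hypothesis e_attained : forall Q, size Q = n -> (2 <= deg Q)%N ->
  exists2 j, (j < n)%N & e Q = d j Q.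
Hypothesis d_low : forall v j Q, (j < n)%N -> size Q = n -> (2 <= deg Q)%N ->
  d j Q < eta v -> (m v < deg Q)%N.
Hypothesis d_sep : forall v j P S, (j < n)%N -> size P = n -> size S = n ->
  (2 <= deg P)%N -> (0 < deg S)%N -> d j P < eta v -> d j (madd P S) < eta v ->
  (m v <= deg S)%N.
Hypothesis sumB : forall N,
  \rsum_(v <- iota 0 N) (ln (/ eta v.+1) * / INR (m v)) <= B.

Let l v := ln (/ eta v).
Let Rltb x y := if Rlt_dec x y then true else false.

Lemma RltbP x y : reflect (x < y) (Rltb x y).
Proof. by rewrite /Rltb; case: Rlt_dec => H; constructor. Qed.

Lemma l_ge0 v : 0 <= l v.
Proof.
rewrite /l -ln_1; apply: Rcomplements.ln_le; first by lra.
by rewrite -Rinv_1; apply: Rinv_le_contravar.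
Qed.

Definition logdiv Q := Rmax 0 (ln (/ e Q)).

(** Going down from [V], let [u] be the first index with [e Q < eta u]. Then [eta (u + 1) <= e Q],
    and the single summand [l (u + 1)] already bounds the logarithm; if there is no such [u], [l 0]
    does. *)
Lemma logdiv_le V Q : size Q = n -> (2 <= deg Q <= m V)%N ->
  logdiv Q <= l 0 + \rsum_(v <- iota 0 V) (if Rltb (e Q) (eta v) then l v.+1 else 0).
Proof.
move=> sQ /andP[d2 dV].
have t0 u : 0 <= (if Rltb (e Q) (eta u) then l u.+1 else 0).
  by case: ifP => _; [apply: l_ge0 | lra].
have S0 u : 0 <= \rsum_(v <- iota 0 u) (if Rltb (e Q) (eta v) then l v.+1 else 0).
  by apply: rsum_ge0.
have le u : eta u <= e Q -> ln (/ e Q) <= l u.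
  move=> H; apply: Rcomplements.ln_le; first exact/Rinv_0_lt_compat/e_gt0.
  exact: Rinv_le_contravar.
have eV : eta V <= e Q.
  apply: Rnot_lt_le => H; have [j jn E] := e_attained sQ d2.
  by rewrite E in H; have := d_low jn sQ d2 H; lia.
apply: Rmax_lub; first by have := l_ge0 0; have := S0 V; lra.
elim: V eV {dV} => [|V IH] eV; first by have := le 0%N eV; have := S0 0%N; lra.
rewrite -addn1 iotaD big_cat /= big_cons big_nil Rplus_0_r add0n.
case: RltbP => H; last by have := IH (Rnot_lt_le _ _ H); lra.
by have := le _ eV; have := S0 V; have := l_ge0 0; lra.
Qed.

(** Summing [logdiv_le] over the nodes and exchanging sums leaves, for each [v], the number of nodes
    below the threshold [eta v]. For each [j] there are at most [2 deg Q / m v] of them by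
    [tree_count], and the series bounded by [B] appears. *)
Lemma tree_bound Q L : tree n Q L ->
  \rsum_(x <- L) logdiv x <= (l 0 + 2 * INR n * B) * INR (deg Q).
Proof.
move=> t; have [sQ dQ sL] := tree_size t; pose V := deg Q.
have dV : (deg Q <= m V)%N by apply/ltnW/m_gt.
apply: (Rle_trans _ (\rsum_(x <- L) (l 0 +
   \rsum_(v <- iota 0 V) (if Rltb (e x) (eta v) then l v.+1 else 0)))).
  apply: rsum_le => x xL _; have [sx /andP[x2 xQ]] := tree_mem t xL.
  by apply: logdiv_le => //; rewrite x2 (leq_trans xQ).
rewrite big_split /= rsum_const exchange_big /= Rmult_plus_distr_r.
apply: Rplus_le_compat.
  rewrite Rmult_comm; apply: Rmult_le_compat_l; first exact: l_ge0.
  by apply: le_INR; rewrite -sL; lia.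
apply: (Rle_trans _ (\rsum_(v <- iota 0 V)
    (2 * INR n * INR (deg Q) * (ln (/ eta v.+1) * / INR (m v))))); last first.
  rewrite -big_distrr /=; have := sumB V => H.
  rewrite (_ : 2 * INR n * B * INR (deg Q) = 2 * INR n * INR (deg Q) * B); last by ring.
  apply: Rmult_le_compat_l => //; have := pos_INR n; have := pos_INR (deg Q); nra.
apply: rsum_le => v _ _; rewrite -/(l v.+1).
have mv : 0 < INR (m v) by apply: lt_0_INR; have := m_gt v; lia.
(* [e x] is one of the [d j x], so being below the threshold is charged to some [j]; this produces
   the factor [n]. *)
apply: (Rle_trans _ (\rsum_(x <- L) \rsum_(j <- iota 0 n)
    (if Rltb (d j x) (eta v) then l v.+1 else 0))).
  apply: rsum_le => x xL _; have [sx /andP[x2 xQ]] := tree_mem t xL.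
  have [j jn ->] := e_attained sx x2.
  apply: (rsum_single (F := fun j => if Rltb (d j x) (eta v) then l v.+1 else 0)).
    by move=> i _; case: ifP => _; [apply: l_ge0 | lra].
  by rewrite mem_iota.
rewrite exchange_big /=.
have cnt j : (j < n)%N -> \rsum_(x <- L) (if Rltb (d j x) (eta v) then l v.+1 else 0) <=
    2 * INR (deg Q) * (l v.+1 * / INR (m v)).
  move=> jn; pose bad x := Rltb (d j x) (eta v).
  have -> : \rsum_(x <- L) (if Rltb (d j x) (eta v) then l v.+1 else 0) =
      INR (count bad L) * l v.+1.
    elim: (L) => [|x L' IH]; first by rewrite big_nil /=; ring.
    rewrite big_cons IH /= -/(bad x) plus_INR; case: (bad x) => /=; ring.
  have [c1 c2 _] : [/\ ((deg Q <= m v)%N -> count bad L = 0%N),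
      ((m v < deg Q)%N -> (m v * count bad L + m v <= 2 * deg Q)%N) & True].
    have [||? ?] := @tree_count n bad (m v) Q L _ _ t; last by split.
    - by move=> P sP dP /RltbP; apply: d_low.
    by move=> P S sP sS dP dS /RltbP bP /RltbP; apply: (d_sep jn sP sS dP dS bP).
  have {c1 c2} c : (m v * count bad L <= 2 * deg Q)%N.
    by case: (leqP (deg Q) (m v)) => [/c1 ->|/c2]; lia.
  have {}c : INR (m v) * INR (count bad L) <= 2 * INR (deg Q).
    by rewrite -(mult_INR 2) -mult_INR; apply: le_INR; lia.
  have l0 := l_ge0 v.+1; apply: (Rmult_le_reg_r (INR (m v))) => //.
  rewrite (_ : 2 * _ * _ * _ = 2 * INR (deg Q) * l v.+1); last by field; lra.
  by nra.
apply: (Rle_trans _ (\rsum_(j <- iota 0 n) (2 * INR (deg Q) * (l v.+1 * / INR (m v))))).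
  by apply: rsum_le => j; rewrite mem_iota => /andP[_ ?] _; apply: cnt.
by rewrite rsum_const size_iota; lra.
Qed.

Let sums Q x := exists L, tree n Q L /\ x = \rsum_(y <- L) logdiv y.
Let K Q := Rbar.real (Lub.Lub_Rbar (sums Q)).

(** The supremum is taken in the extended reals. It is finite: [tree_bound] excludes plus infinity
    and the existence of a tree excludes minus infinity. *)
Lemma K_lub Q : size Q = n -> (0 < deg Q)%N -> is_lub (sums Q) (K Q).
Proof.
move=> sQ dQ; have [L tL] := tree_exists sQ dQ.
have [ub lub] := Lub.Lub_Rbar_correct (sums Q).
rewrite /K; case: (Lub.Lub_Rbar (sums Q)) ub lub => [r| |] ub lub.
- split=> [x /ub //|b bb]; apply: (lub (Rbar.Finite b)) => x /bb //.
- suff : False by []. 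
  apply: (lub (Rbar.Finite ((l 0 + 2 * INR n * B) * INR (deg Q)))).
  by move=> x [L' [tL' ->]]; apply: tree_bound.
by have := ub _ (ex_intro _ L (conj tL erefl)).
Qed.

(** Trees for [P] and [P'] joined under the new node [P + P'] form a tree for the sum; the suprema
    over both subtrees are taken one after the other. *)
Lemma K_add P P' : size P = n -> size P' = n -> (0 < deg P)%N -> (0 < deg P')%N ->
  logdiv (madd P P') + (K P + K P') <= K (madd P P').
Proof.
move=> sP sP' dP dP'; have [_ lP] := K_lub sP dP; have [_ lP'] := K_lub sP' dP'.
have [|uQ _] := K_lub (size_madd sP sP'); first by rewrite deg_madd ?sP //; lia.
suff : K P <= K (madd P P') - logdiv (madd P P') - K P' by lra.
apply: lP => x [L [tL ->]].
suff : K P' <= K (madd P P') - logdiv (madd P P') - \rsum_(y <- L) logdiv y by lra.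
apply: lP' => x' [L' [tL' ->]].
have : \rsum_(y <- madd P P' :: L ++ L') logdiv y <= K (madd P P').
  by apply: uQ; exists (madd P P' :: L ++ L'); split=> //; apply: tree_node.
by rewrite big_cons big_cat /=; lra.
Qed.

(** With [T = exp K], both absorption inequalities are the exponential of [K_add], since [logdiv]
    dominates 0 and [log (1 / e)]. The geometric growth of [T] is [tree_bound]. *)
Theorem brjuno_absorbs (kappa : seq nat -> R) :
  (forall Q, size Q = n -> (2 <= deg Q)%N -> kappa Q = / e Q) ->
  exists T A, absorbs n kappa T A.
Proof.
move=> kE; pose T Q := if (size Q == n) && (0 < deg Q)%N then exp (K Q) else 1.
have TE Q : size Q = n -> (0 < deg Q)%N -> T Q = exp (K Q).
  by move=> sQ dQ; rewrite /T sQ eqxx dQ.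
(* The maximum with 0 ensures [1 <= A], whatever the sign of the bound. *)
pose A := exp (Rmax 0 (l 0 + 2 * INR n * B)).
have expm x y : x <= y -> exp x <= exp y.
  by case=> [H|->]; [apply/Rlt_le/exp_increasing | lra].
have A1 : 1 <= A by rewrite -exp_0; apply/expm/Rmax_l.
exists T, A; split=> [Q| |i lt_in|P P' sP sP' dP dP'|].
- by rewrite /T; case: ifP => _; [apply: exp_pos | lra].
- by rewrite /T deg_zeroQ andbF.
- rewrite TE ?size_unitQ ?deg_unitQ // -exp_0; apply: expm.
  have [|u _] := K_lub (size_unitQ n i); first by rewrite deg_unitQ.
  by apply: u; exists [::]; split; [apply: tree_leaf | rewrite big_nil].
- have sQ := size_madd sP sP'.
  have dQ : (2 <= deg (madd P P'))%N by rewrite deg_madd ?sP //; lia.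
  have H := K_add sP sP' dP dP'.
  rewrite !TE //; last by lia.
  have := Rmax_l 0 (ln (/ e (madd P P'))); have := Rmax_r 0 (ln (/ e (madd P P'))).
  rewrite -/(logdiv _) => h1 h2; rewrite -exp_plus; split; first by apply: expm; lra.
  rewrite kE // -[/ e _]exp_ln; last exact/Rinv_0_lt_compat/e_gt0.
  by rewrite -exp_plus; apply: expm; lra.
split=> // Q sQ; case: (posnP (deg Q)) => [d0|dQ].
  by rewrite /T d0 andbF /=; lra.
rewrite TE // /A -Rpower_pow; last exact: exp_pos.
rewrite /Rpower ln_exp; apply: expm.
have [_ u] := K_lub sQ dQ; apply: u => x [L [tL ->]].
apply: Rle_trans (tree_bound tL) _; rewrite Rmult_comm.
by apply: Rmult_le_compat_l; [apply: pos_INR | apply: Rmax_r].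
Qed.

End Absorb.

(** For [T Q = A ^ (deg Q - 1)] the exponent of [P + P'] exceeds the sum of the two exponents by
    one, and this spare factor [A] pays for the bounded [kappa]. At degree 0 the truncated exponent
    gives the required value 1. *)
Lemma const_absorbs n c (kappa : seq nat -> R) : 0 < c ->
  (forall Q, size Q = n -> (2 <= deg Q)%N -> kappa Q <= c) ->
  exists T A, absorbs n kappa T A.
Proof.
move=> c0 kc; pose A := Rmax 1 c; have A1 : 1 <= A := Rmax_l _ _.
have cA : c <= A := Rmax_r _ _.
have pA k : 1 <= A ^ k by apply: pow_R1_Rle.
exists (fun Q => A ^ (deg Q).-1), A; split=> [Q| |i lt_in|P P' sP sP' dP dP'|].
- by have := pA (deg Q).-1; lra.
- by rewrite deg_zeroQ.
- by rewrite deg_unitQ //=; lra.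
- have E : (deg (madd P P')).-1 = ((deg P).-1 + (deg P').-1).+1.
    by rewrite deg_madd ?sP //; lia.
  rewrite E -pow_add [X in _ <= X]/=; set X := A ^ _.
  have X1 : 1 <= X by apply: pA.
  have : kappa (madd P P') <= c.
    by apply: kc; [apply: size_madd | rewrite deg_madd ?sP //; lia].
  by move=> k; split; [nra | change (A ^ S _) with (A * X); nra].
split=> // Q _; case: (deg Q) => [|k] /=; first by lra.
by have := pA k; nra.
Qed.

(** * The simultaneous Brjuno condition *)

Lemma fold_RmaxP x l : List.In (List.fold_right Rmax x l) (x :: l) /\
  forall y, List.In y (x :: l) -> y <= List.fold_right Rmax x l.
Proof.
elim: l => [|z l [IH1 IH2]] /=; first by split; [left | move=> y [->|//]; lra].
have H1 := Rmax_l z (List.fold_right Rmax x l).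
have H2 := Rmax_r z (List.fold_right Rmax x l); split.
  rewrite /Rmax; case: Rle_dec => _; last by right; left.
  by case: IH1 => H; [left | right; right].
move=> y [<-|[<-|yl]] //; first by have := IH2 x (or_introl erefl); lra.
by have := IH2 y (or_intror yl); lra.
Qed.

Lemma fold_RminP x l : List.In (List.fold_right Rmin x l) (x :: l) /\
  forall y, List.In y (x :: l) -> List.fold_right Rmin x l <= y.
Proof.
elim: l => [|z l [IH1 IH2]] /=; first by split; [left | move=> y [->|//]; lra].
have H1 := Rmin_l z (List.fold_right Rmin x l).
have H2 := Rmin_r z (List.fold_right Rmin x l); split.
  rewrite /Rmin; case: Rle_dec => _; first by right; left.
  by case: IH1 => H; [left | right; right].
move=> y [<-|[<-|yl]] //; first by have := IH2 x (or_introl erefl); lra.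
by have := IH2 y (or_intror yl); lra.
Qed.

Lemma list_max_seqP (f : nat -> R) N : (0 < N)%N ->
  (exists2 k, (k < N)%N & list_max (List.map f (List.seq 0 N)) = f k) /\
  forall k, (k < N)%N -> f k <= list_max (List.map f (List.seq 0 N)).
Proof.
case: N => // N _; have [H1 H2] := fold_RmaxP (f 0%N) (List.map f (List.seq 1 N)).
have E : f 0%N :: List.map f (List.seq 1 N) = List.map f (List.seq 0 N.+1) by [].
rewrite E in H1 H2; split=> [|k kN].
  by case/in_map_iff: H1 => k [Ek /in_seq [_ /ltP kN]]; exists k => //; apply: esym.
by apply: H2; apply: in_map; apply/in_seq; split; [apply/leP | apply/ltP].
Qed.

Lemma list_min_seqP (f : nat -> R) N : (0 < N)%N ->
  (exists2 k, (k < N)%N & list_min (List.map f (List.seq 0 N)) = f k) /\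
  forall k, (k < N)%N -> list_min (List.map f (List.seq 0 N)) <= f k.
Proof.
case: N => // N _; have [H1 H2] := fold_RminP (f 0%N) (List.map f (List.seq 1 N)).
have E : f 0%N :: List.map f (List.seq 1 N) = List.map f (List.seq 0 N.+1) by [].
rewrite E in H1 H2; split=> [|k kN].
  by case/in_map_iff: H1 => k [Ek /in_seq [_ /ltP kN]]; exists k => //; apply: esym.
by apply: H2; apply: in_map; apply/in_seq; split; [apply/leP | apply/ltP].
Qed.

Lemma pos_lower_bound (T : eqType) (l : seq T) (f : T -> R) :
  (forall x, x \in l -> 0 < f x) -> exists2 c, 0 < c & forall x, x \in l -> c <= f x.
Proof.
elim: l => [|x l IH] H; first by exists 1 => //; lra.
have [|c c0 cf] := IH; first by move=> y yl; apply: H; rewrite inE yl orbT.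
exists (Rmin (f x) c); first by apply: Rmin_glb_lt => //; apply/H/mem_head.
move=> y; rewrite inE => /orP[/eqP ->|/cf]; first exact: Rmin_l.
exact: Rle_trans (Rmin_r _ _).
Qed.

Lemma CeqbP x y : reflect (x = y) (Ceqb x y).
Proof.
rewrite /Ceqb; case: x y => [a b] [c d] /=.
case: Req_EM_T => [->|ac]; last by constructor => -[].
by case: Req_EM_T => [->|bd]; constructor => // -[].
Qed.

Lemma CpowD x a b : Cpow x (a + b) = (Cpow x a * Cpow x b)%cx.
Proof.
elim: a => [|a IH]; first by rewrite add0n /=; ring.
by rewrite addSn /= IH; ring.
Qed.

Lemma cmono_madd lam P S : size P = size S ->
  cmono lam (madd P S) = (cmono lam P * cmono lam S)%cx.
Proof.
rewrite /cmono; elim: P S 0%N => [|p P IH] [|s S] i //= => [_|[/IH E]]; first by ring.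
by rewrite -/(madd P S) E CpowD; ring.
Qed.

Lemma cmono_const n lam c Q : size Q = n -> (forall i, (i < n)%N -> lam i = c) ->
  cmono lam Q = Cpow c (deg Q).
Proof.
rewrite /cmono => sQ; have : (0 + size Q <= n)%N by rewrite sQ.
elim: Q {sQ} 0%N => [|q Q IH] i //= iQ lamc.
by rewrite CpowD lamc ?IH //; lia.
Qed.

Section SmallDivisors.
Variables (n h : nat) (Lam : nat -> nat -> C).
Hypotheses (n0 : (0 < n)%N) (h0 : (0 < h)%N).
Hypothesis Lam0 : forall k j, (k < h)%N -> (j < n)%N -> Lam k j <> C0.

Let res := fully_resonant n h Lam.
Let eps := eps n h Lam.
Let dist k j Q := Cnorm (cmono (Lam k) Q - Lam k j)%cx.
Definition divisor j Q := list_max (List.map (fun k => dist k j Q) (List.seq 0 h)).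

Lemma divisorP j Q : (exists2 k, (k < h)%N & divisor j Q = dist k j Q) /\
  forall k, (k < h)%N -> dist k j Q <= divisor j Q.
Proof. exact: (list_max_seqP (fun k => dist k j Q)). Qed.

Lemma epsP Q : (exists2 j, (j < n)%N & eps Q = divisor j Q) /\
  forall j, (j < n)%N -> eps Q <= divisor j Q.
Proof. exact: (list_min_seqP (fun j => divisor j Q)). Qed.

Lemma resP Q : reflect (forall k j, (k < h)%N -> (j < n)%N ->
  cmono (Lam k) Q = Lam k j) (res Q).
Proof.
apply: (iffP idP) => [/forallb_forall H k j kh jn|H].
  have /H /forallb_forall H' : List.In k (List.seq 0 h).
    by apply/in_seq; split; [apply/leP | apply/ltP].
  apply/CeqbP/H'; apply/in_seq; split; [exact/leP | exact/ltP].
apply/forallb_forall => k /in_seq [_ /ltP kh].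
by apply/forallb_forall => j /in_seq [_ /ltP jn]; apply/CeqbP/H.
Qed.

Lemma omega_list m Q : (Q \in flat_map (mindices n) (List.seq 2 (m - 1)%coq_nat)) =
  (size Q == n) && (2 <= deg Q <= m)%N.
Proof.
apply/mem_flat_map/andP => [[d]|[sQ dQ]].
  rewrite seq_iota mem_iota mem_mindices => dm /andP[-> /eqP ->]; split=> //; lia.
by exists (deg Q); rewrite ?mem_mindices ?sQ ?eqxx // seq_iota mem_iota; lia.
Qed.

Lemma omega_None m Q : omega n h Lam m = None -> size Q = n -> (2 <= deg Q <= m)%N ->
  res Q.
Proof.
rewrite /omega; set l := List.filter _ _.
case E : l => [|x l'] //= _ sQ dQ; apply: contraT => rQ.
suff : List.In Q l by rewrite E.
by apply/filter_In; split=> //; apply/In_mem; rewrite omega_list sQ eqxx.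
Qed.

Lemma omega_Some m w : omega n h Lam m = Some w ->
  (forall Q, size Q = n -> (2 <= deg Q <= m)%N -> ~~ res Q -> w <= eps Q) /\
  exists Q, [/\ size Q = n, (2 <= deg Q <= m)%N, ~~ res Q & w = eps Q].
Proof.
rewrite /omega; set l := List.filter _ _.
case E : (List.map _ l) => [|x l'] // [<-].
have [H1 H2] := fold_RminP x l'; rewrite -E in H1 H2; split.
  move=> Q sQ dQ rQ; apply: H2; apply: in_map; apply/filter_In; split=> //.
  by apply/In_mem; rewrite omega_list sQ eqxx.
case/in_map_iff: H1 => Q [<- /filter_In [/In_mem]].
by rewrite omega_list => /andP[/eqP sQ dQ] rQ; exists Q.
Qed.

(** A full resonance makes all eigenvalues of the [k]-th map equal to one number [m_k] with
    [m_k ^ deg Q0 = m_k]. Positive powers of [m_k] are therefore periodic, and [eps Q], which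
    depends only on [deg Q], takes finitely many values; the nonresonant ones are positive. *)
Lemma resonant_lower_bound Q0 : size Q0 = n -> (2 <= deg Q0)%N -> res Q0 ->
  exists2 c, 0 < c & forall Q, size Q = n -> (2 <= deg Q)%N -> ~~ res Q -> c <= eps Q.
Proof.
move=> sQ0 dQ0 /resP rQ0; pose m k := Lam k 0%N.
have Lm k j : (k < h)%N -> (j < n)%N -> Lam k j = m k.
  by move=> kh jn; rewrite -(rQ0 k j kh jn) (rQ0 k 0%N).
have cE k Q : (k < h)%N -> size Q = n -> cmono (Lam k) Q = Cpow (m k) (deg Q).
  by move=> kh sQ; apply: (cmono_const sQ) => i; apply: Lm.
have eps_gt0 Q : ~~ res Q -> 0 < eps Q.
  move=> rQ; have [[j jn ->] _] := epsP Q; have [_ H] := divisorP j Q.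
  have [k kh ne] : exists2 k, (k < h)%N & cmono (Lam k) Q <> m k.
    apply: NNPP => N; case/negP: rQ; apply/resP => k i kh lt_in; rewrite Lm //.
    by apply: NNPP => ne; apply: N; exists k.
  apply: Rlt_le_trans (H k kh); apply: Cnorm_gt0 => /Csub0_eq.
  by rewrite Lm.
(* The common period of the powers of all [m k], valid from exponent 1 on. *)
pose r := (deg Q0).-1.
have per k d : (k < h)%N -> Cpow (m k) (r + d.+1) = Cpow (m k) d.+1.
  move=> kh; have H : Cpow (m k) r.+1 = m k.
    by rewrite /r prednK ?(ltn_trans _ dQ0) // -(cE k Q0) // (rQ0 k 0%N).
  have -> : (r + d.+1 = d + r.+1)%N by lia.
  elim: d => [|d IH]; first by rewrite add0n H /=; ring.
  by rewrite addSn [LHS]/= IH.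
have red d : (2 <= d)%N -> exists d', (2 <= d' <= r.+1)%N /\
    forall k, (k < h)%N -> Cpow (m k) d = Cpow (m k) d'.
  have [N] : exists N, (d <= N)%N by exists d.
  elim: N d => [|N IH] d dN d2; first by lia.
  case: (leqP d r.+1) => dr; first by exists d; rewrite d2.
  have [||d' [d'r E]] := IH (d - r)%N; rewrite /r in dr *; try lia.
  exists d'; split=> // k kh; rewrite -E // -/r.
  have -> : (d = r + (d - r).-1.+1)%N by rewrite /r; lia.
  rewrite per //; congr Cpow; rewrite /r; lia.
have [|c c0 cl] := @pos_lower_bound _ [seq Q <- idx n r.+1 | ~~ res Q] eps.
  by move=> Q; rewrite mem_filter => /andP[/eps_gt0].
exists c => // Q sQ dQ rQ; have [d' [d'r E]] := red _ dQ.
(* A representative of the reduced degree [d'], with all of it in the first variable; it has the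
   same divisors as [Q]. *)
pose Q' := d' :: zeroQ n.-1.
have sQ' : size Q' = n by rewrite /= size_zeroQ prednK.
have dQ' : deg Q' = d' by rewrite deg_cons deg_zeroQ addn0.
have cQ' k : (k < h)%N -> cmono (Lam k) Q' = cmono (Lam k) Q.
  by move=> kh; rewrite !cE // dQ' E.
have -> : eps Q = eps Q'.
  have div j : divisor j Q = divisor j Q'.
    congr list_max; apply: map_ext_in => k /in_seq [_ /ltP kh].
    by rewrite /dist cQ'.
  by congr list_min; apply: map_ext_in => j _; apply: div.
apply: cl; rewrite mem_filter mem_idx sQ' eqxx dQ'.
have -> : res Q' = res Q.
  by apply/resP/resP => H k j kh jn; [rewrite -cQ' | rewrite cQ'] => //; apply: H.
by rewrite rQ; lia.
Qed.

(** If [Lam_k^P] and [Lam_k^(P + S)] are both close to the same eigenvalue for every [k], then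
    [Lam_k^S] is close to 1. So [S] plus a unit multi-index has a small divisor for that unit index,
    which its lower bound [w] forbids up to degree [m]. *)
Lemma divisor_sep w a b theta j P S m : (j < n)%N -> size P = n -> size S = n ->
  (forall Q, size Q = n -> (2 <= deg Q <= m)%N -> w <= eps Q) ->
  0 < a -> 0 < w <= 1 -> 0 < theta <= a / 2 -> theta * (4 * b) <= a ->
  (forall k i, (k < h)%N -> (i < n)%N -> a <= Cnorm (Lam k i) <= b) ->
  (0 < deg S)%N -> divisor j P < theta * w -> divisor j (madd P S) < theta * w ->
  (m <= deg S)%N.
Proof.
move=> jn sP sS wm a0 [w0 w1] [t0 ta] tb ab dS dP dPS; case: leqP => // Sm.
(* Its degree [deg S + 1] lies between 2 and [m], because [0 < deg S < m]. *)
pose Q := madd S (unitQ n 0).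
have sQ : size Q = n by apply: size_madd; rewrite ?size_unitQ.
have dQ : deg Q = (deg S).+1 by rewrite deg_madd ?size_unitQ // deg_unitQ // addn1.
have := wm Q sQ; rewrite dQ => /(_ _) H; have {}H : w <= eps Q by apply: H; lia.
have [_ /(_ 0%N n0) eQ] := epsP Q; have [[k kh E] _] := divisorP 0 Q.
have [_ /(_ k kh) kP] := divisorP j P; have [_ /(_ k kh) kPS] := divisorP j (madd P S).
have [a1 b1] := ab k j kh jn; have [a2 b2] := ab k 0%N kh n0.
rewrite /dist in kP kPS E.
set x := cmono (Lam k) P in kP; set y := cmono (Lam k) S.
have EQ : dist k 0 Q = Cnorm (Lam k 0%N) * Cnorm (y - C1)%cx.
  rewrite -CnormM /dist /Q cmono_madd ?size_unitQ // cmono_unitQ //.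
  by congr Cnorm; rewrite -/y; ring.
have xl : a / 2 <= Cnorm x.
  have : Cnorm (Lam k j) <= Cnorm x + Cnorm (x - Lam k j)%cx.
    by apply: Rle_trans (CnormB _ _); apply: Req_le; congr Cnorm; ring.
  by nra.
have xy : Cnorm x * Cnorm (y - C1)%cx < 2 * (theta * w).
  rewrite -CnormM; rewrite cmono_madd ?sP // -/x -/y in kPS.
  apply: (Rle_lt_trans _ (Cnorm (x * y - Lam k j)%cx + Cnorm (x - Lam k j)%cx)); last lra.
  by apply: Rle_trans (CnormB _ _); apply: Req_le; congr Cnorm; ring.
have y0 := Cnorm_ge0 (y - C1)%cx; set z := Cnorm (y - C1)%cx in xy y0 EQ.
(* With [z = |y - 1|], the bounds [w <= b * z] and [a * z < 4 * (theta * w)] contradict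
   [theta * (4 * b) <= a]. *)
have wz : w <= b * z.
  apply: (Rle_trans _ (dist k 0 Q)); first by rewrite /dist -E; lra.
  by rewrite EQ; apply: Rmult_le_compat_r.
have az : a * z < 4 * (theta * w) by nra.
have b0 : 0 < b by lra.
have : a * w <= b * (a * z) by nra.
have : b * (a * z) < b * (4 * (theta * w)) by apply: Rmult_lt_compat_l.
have : b * (4 * (theta * w)) <= a * w by nra.
lra.
Qed.

(** If some [Q] is fully resonant, or if [omega] along [p] stays away from 0, [eps] has a positive
    lower bound and [const_absorbs] applies. In the remaining case [omega] eventually falls below
    the constant [theta], and [brjuno_absorbs] is applied from there on. *)
Theorem brjuno_small_divisors : brjuno n h Lam ->
  (forall Q, size Q = n -> (2 <= deg Q)%N -> ~~ res Q -> 0 < eps Q) /\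
  exists T A, absorbs n (fun Q => if res Q then 0 else / eps Q) T A.
Proof.
move=> [p [p0 [pS br]]].
have const c : 0 < c ->
    (forall Q, size Q = n -> (2 <= deg Q)%N -> ~~ res Q -> c <= eps Q) ->
    (forall Q, size Q = n -> (2 <= deg Q)%N -> ~~ res Q -> 0 < eps Q) /\
    exists T A, absorbs n (fun Q => if res Q then 0 else / eps Q) T A.
  move=> c0 cl; split=> [Q sQ dQ rQ|]; first by have := cl Q sQ dQ rQ; lra.
  apply: (@const_absorbs n (/ c)) => [|Q sQ dQ]; first exact: Rinv_0_lt_compat.
  case: ifP => [_|/negbT rQ]; first exact/Rlt_le/Rinv_0_lt_compat.
  by apply: Rinv_le_contravar => //; apply: cl.
case: (classic (exists Q0, [/\ size Q0 = n, (2 <= deg Q0)%N & res Q0])).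
  by move=> [Q0 [s0 d0 r0]]; have [c c0 cl] := resonant_lower_bound s0 d0 r0; apply: (const c).
move=> nores.
have nr Q : size Q = n -> (2 <= deg Q)%N -> ~~ res Q.
  by move=> sQ dQ; apply/negP => rQ; apply: nores; exists Q.
have p_gt v : (v < p v)%N.
  by elim: v => [|v IH]; [rewrite p0 | have := pS v; lia].
case: br => [[v E]|[wpos [M sumM]]].
  (* [omega] would be a minimum over the empty set here; in the absence of full resonances a
     multi-index of degree 2 excludes this. *)
  pose Q := 2%N :: zeroQ n.-1.
  have sQ : size Q = n by rewrite /= size_zeroQ prednK.
  have dQ : deg Q = 2%N by rewrite deg_cons deg_zeroQ.
  have := nr Q sQ; rewrite dQ (omega_None E sQ) // => [/(_ isT)//|].
  by rewrite dQ; have := p_gt v.+1; lia.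
(* Index shift: [w v] is [omega] at [p (v + 1)]. The default 1 only makes the function total, as
   [wE] shows. *)
pose w v := if omega n h Lam (p v.+1) is Some x then x else 1.
have wE v : omega n h Lam (p v.+1) = Some (w v) /\ 0 < w v.
  by have [x [E x0]] := wpos v; rewrite /w E.
have w_le v Q : size Q = n -> (2 <= deg Q <= p v.+1)%N -> w v <= eps Q.
  move=> sQ dQ; have [/omega_Some [H _] _] := wE v; apply: H => //.
  by apply: nr => //; case/andP: dQ.
have eps0 Q : size Q = n -> (2 <= deg Q)%N -> 0 < eps Q.
  move=> sQ dQ; have [_ w0] := wE (deg Q); apply: Rlt_le_trans w0 _; apply: w_le => //.
  by have := p_gt (deg Q).+1; lia.
have w_anti u v : (u <= v)%N -> w v <= w u.
  move=> uv; have [/omega_Some [_ [Q [sQ dQ _ ->]]] _] := wE u; apply: w_le => //.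
  suff : (p u.+1 <= p v.+1)%N by lia.
  rewrite -(subnK uv); elim: (v - u)%N => // k IH.
  by have := pS (k + u).+1; rewrite addSn; lia.
case: (classic (exists2 c, 0 < c & forall v, c <= w v)) => [[c c0 cw]|small].
  apply: (const c) => // Q sQ dQ _; apply: Rle_trans (cw (deg Q)) _; apply: w_le => //.
  by have := p_gt (deg Q).+1; lia.
split=> [Q sQ dQ _|]; first exact: eps0.
pose l := [seq (k, j) | k <- iota 0 h, j <- iota 0 n].
have lP k j : (k < h)%N -> (j < n)%N -> (k, j) \in l.
  by move=> kh jn; apply: allpairs_f; rewrite mem_iota.
pose N (x : nat * nat) := Cnorm (Lam x.1 x.2).
have [|a a0 al] := @pos_lower_bound _ l N.
  move=> x /allpairsP [[k j] [/=]]; rewrite !mem_iota => /andP[_ kh] /andP[_ jn] ->.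
  exact/Cnorm_gt0/Lam0.
pose b := \rsum_(x <- l) N x.
have ab k j : (k < h)%N -> (j < n)%N -> a <= Cnorm (Lam k j) <= b.
  move=> kh jn; split; first by apply: (al (k, j)); apply: lP.
  by apply: (rsum_single (F := N) (x := (k, j))); [move=> x _; apply: Cnorm_ge0 | apply: lP].
have b0 : 0 < b by have := ab 0%N 0%N h0 n0; lra.
(* The bounds by [a / 2] and [a / (4 * b)] are those required by [divisor_sep]; the bound by 1 keeps
   [eta] below [w]. *)
pose theta := Rmin (Rmin 1 (a / 2)) (a / (4 * b)).
have [t1 [ta tb]] : theta <= 1 /\ theta <= a / 2 /\ theta * (4 * b) <= a.
  have H1 := Rmin_l (Rmin 1 (a / 2)) (a / (4 * b)).
  have H2 := Rmin_r (Rmin 1 (a / 2)) (a / (4 * b)).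
  have H3 := Rmin_l 1 (a / 2); have H4 := Rmin_r 1 (a / 2).
  rewrite -/theta in H1 H2; split; first by lra.
  split; first by lra.
  rewrite [X in _ <= X](_ : a = a / (4 * b) * (4 * b)); last by field; lra.
  by apply: Rmult_le_compat_r => //; lra.
have t0 : 0 < theta.
  by apply: Rmin_glb_lt; [apply: Rmin_glb_lt; lra | apply: Rdiv_lt_0_compat; lra].
have [v0 wv0] : exists v0, w v0 < theta.
  apply: NNPP => H; apply: small; exists theta => // v.
  by apply: Rnot_lt_le => Hv; apply: H; exists v.
have wt v : w (v0 + v)%N <= theta.
  by apply: Rle_trans (w_anti v0 (v0 + v)%N _) _; [lia | lra].
have w0 v : 0 < w v by case: (wE v).
pose eta v := theta * w (v0 + v)%N.
have etaw v : eta v <= w (v0 + v)%N by have := w0 (v0 + v)%N; rewrite /eta; nra.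
(* The scale [p (v0 + v + 1)] goes with [theta] times [omega] at that scale. Each summand pairs it
   with the next threshold, hence corresponds to the Brjuno term of index [v0 + 1 + v]. The earlier
   terms are subtracted from [M], since they may be negative. *)
apply: (@brjuno_absorbs n (fun v => p (v0 + v).+1) eta divisor eps
  (2 * (M - \rsum_(v <- iota 0 v0.+1) brjuno_term n h Lam p v))).
- by move=> v; have := p_gt (v0 + v).+1; lia.
- by move=> v; apply: Rmult_lt_0_compat.
- by move=> v; have := etaw v; have := wt v; lra.
- exact: eps0.
- by move=> Q sQ dQ; case: (epsP Q).
- move=> v j Q jn sQ dQ H; rewrite ltnNge; apply/negP => dm.
  have [_ /(_ j jn) H1] := epsP Q.
  have H2 : w (v0 + v)%N <= eps Q by apply: w_le => //; rewrite dQ.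
  by have := etaw v; lra.
- move=> v j P S jn sP sS dP dS bP bPS.
  apply: (divisor_sep jn sP sS (w := w (v0 + v)%N) (a := a) (b := b) (theta := theta)) => //.
    by move=> Q; apply: w_le.
  by split=> //; have := wt v; lra.
- move=> K; have S0 : \rsum_(v <- iota 0 (v0.+1 + K)) brjuno_term n h Lam p v <= M.
    by rewrite -seq_iota -RsumE; apply: sumM.
  have I : iota v0.+1 K = [seq (v0.+1 + i)%N | i <- iota 0 K] by rewrite -iotaDl addn0.
  rewrite iotaD big_cat add0n I big_map in S0.
  have {}S0 : \rsum_(v <- iota 0 v0.+1) brjuno_term n h Lam p v +
    \rsum_(v <- iota 0 K) brjuno_term n h Lam p (v0.+1 + v)%N <= M := S0.
  (* From index [v0] on, [w <= theta], so [log (1 / (theta * w)) <= 2 log (1 / w)]: the factor 2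
     absorbs [theta]. *)
  apply: (Rle_trans _ (2 * \rsum_(v <- iota 0 K) brjuno_term n h Lam p (v0.+1 + v)%N)).
    rewrite big_distrr /=; apply: rsum_le => v _ _.
    have [E _] := wE (v0.+1 + v)%N; rewrite /brjuno_term E.
    have E1 : (v0 + v.+1 = v0.+1 + v)%N by lia.
    have E2 : ((v0 + v).+1 = v0.+1 + v)%N by lia.
    rewrite /eta E1 E2; set x := w _; have x0 : 0 < x by apply: w0.
    have xt : x <= theta by rewrite /x -E1; apply: wt.
    have mp : 0 < INR (p (v0.+1 + v)%N).
      by apply: lt_0_INR; have := p_gt (v0.+1 + v)%N; lia.
    rewrite -/x Rinv_mult ln_mult; try exact: Rinv_0_lt_compat.
    have : ln (/ theta) <= ln (/ x).
      apply: Rcomplements.ln_le; first exact: Rinv_0_lt_compat.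
      exact: Rinv_le_contravar.
    by have := Rinv_0_lt_compat _ mp; nra.
  set u := \big[_/_]_(v <- iota 0 v0.+1) _ in S0 *.
  by set z := \big[_/_]_(v <- iota 0 K) _ in S0 *; lra.
move=> Q sQ dQ; by rewrite (negbTE (nr Q sQ dQ)).
Qed.

End SmallDivisors.

(** * Holomorphic linearization *)

Lemma pcomp_cancel n A B X : meq n (pcomp n A B) (sid n) -> fix0 n B -> fix0 n X ->
  meq n (pcomp n A (pcomp n B X)) X.
Proof. by move=> AB B0 X0; rewrite pcompA // AB pidcomp. Qed.

Theorem diagonal_linearization n h (g : nat -> pmap) (Lam : nat -> nat -> C) :
  (0 < n)%N -> (0 < h)%N ->
  (forall k, (k < h)%N -> fix0 n (g k)) ->
  (forall k, (k < h)%N -> conv_map n (g k)) ->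
  (forall k, (k < h)%N -> exists G, meq n (pcomp n G (g k)) (sid n)) ->
  (forall k j i, (k < h)%N -> (j < n)%N -> (i < n)%N ->
     g k j (unitQ n i) = dg n (Lam k) j (unitQ n i)) ->
  (forall p q, (p < h)%N -> (q < h)%N ->
     meq n (pcomp n (g p) (g q)) (pcomp n (g q) (g p))) ->
  (forall k, (k < h)%N -> formally_linearizable n (g k)) ->
  brjuno n h Lam ->
  exists phi psi, [/\ fix0 n phi /\ fix0 n psi, conv_map n phi /\ conv_map n psi,
    meq n (pcomp n psi phi) (sid n), meq n (pcomp n phi psi) (sid n)
    & forall k, (k < h)%N -> meq n (pcomp n (g k) phi) (pcomp n phi (dg n (Lam k)))].
Proof.
move=> n0 h0 g0 cg gI gL gC gF br.
(* A zero eigenvalue would give the linear part of [g k] a zero column, so [G o g k] could not have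
   the identity as linear part. *)
have Lam0 k j : (k < h)%N -> (j < n)%N -> Lam k j <> C0.
  move=> kh jn L0; have [G E] := gI k kh.
  have := linpart_pcomp G j (g0 k kh) jn.
  rewrite /linpart E; [|exact/ltP|exact: size_unitQ].
  rewrite sid_unitQ // eqxx matmulE big1_seq.
    by case=> /R1_neq_R0.
  move=> l; rewrite mem_iota => /andP[_ /andP[_ ln]].
  rewrite gL // /dg /mon; case: eqP => [/(unitQ_inj jn) <-|_]; rewrite ?L0 /ind; ring.
have [eps0 [T [A TA]]] := brjuno_small_divisors n0 h0 Lam0 br.
set res := fully_resonant n h Lam in eps0 TA; set ep := eps n h Lam in eps0 TA.
have kkx j Q := proj1 (divisorP Lam h0 j Q).
have kk_ex j Q : exists k, (k < h)%N /\ divisor h Lam j Q =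
    Cnorm (cmono (Lam k) Q - Lam k j)%cx by have [k ? ?] := kkx j Q; exists k.
pose kk j Q := proj1_sig (constructive_indefinite_description _ (kk_ex j Q)).
have kkP j Q : (kk j Q < h)%N /\ divisor h Lam j Q =
    Cnorm (cmono (Lam (kk j Q)) Q - Lam (kk j Q) j)%cx.
  exact: proj2_sig (constructive_indefinite_description _ (kk_ex j Q)).
pose mu j Q := (cmono (Lam (kk j Q)) Q - Lam (kk j Q) j)%cx.
have mu_eps j Q : (j < n)%N -> ep Q <= Cnorm (mu j Q).
  move=> jn; have [_ <-] := kkP j Q; have [_ H] := epsP h Lam n0 Q; exact: H.
have mu0 j Q : (j < n)%N -> size Q = n -> (2 <= deg Q)%N -> ~~ res Q -> mu j Q <> C0.
  move=> jn sQ dQ rQ E; have := mu_eps j Q jn; have := eps0 Q sQ dQ rQ.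
  by rewrite E Cnorm0; lra.
(* The value 0 at full resonances is the normalization of [phi]; it matches the value 0 of the bound
   on the inverse divisors. *)
pose c j Q := if res Q then C0 else Complex.Cinv (mu j Q).
pose phi := solve n c (fun j Q => g (kk j Q) j).
have phi0 : fix0 n phi := solve_fix0 _ _.
have phi1 : tangent_id n phi by move=> j Q _ _; apply: solve_deg1.
have cphi : conv_map n phi.
  (* The germ used in the recursion varies with [Q], so the majorant sums over all maps and all
     components. *)
  pose l := [seq (k, j) | k <- iota 0 h, j <- iota 0 n].
  pose G (x : nat * nat) := g x.1 x.2.
  have [|s [M [s0 sM]]] := @conv_family _ n l G.
    move=> x /allpairsP [[k j] [/=]]; rewrite !mem_iota => /andP[_ kh] /andP[_ jn] ->.
    by apply: cg => //; apply/ltP.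
  apply: (conv_recursion _ TA _ s0 sM) => //.
  - move=> Q; case: ifP => _; first by lra.
    have e0 : 0 <= ep Q.
      have [[j _ E] _] := epsP h Lam n0 Q; rewrite /ep E.
      by have [_ ->] := kkP j Q; apply: Cnorm_ge0.
    case: e0 => [e0|<-]; first exact/Rlt_le/Rinv_0_lt_compat.
    by rewrite Rinv_0; lra.
  - by move=> P; apply: rsum_ge0 => x _ _; apply: Cnorm_ge0.
  move=> j Q jn sQ dQ; rewrite /phi solve_eq // -/phi CnormM.
  apply: Rmult_le_compat; try exact: Cnorm_ge0.
    rewrite /c; case: ifP => [_|/negbT rQ]; first by rewrite Cnorm0; lra.
    rewrite CnormV; last exact: mu0.
    by apply: Rinv_le_contravar; [apply: eps0 | apply: mu_eps].
  apply: Rle_trans (Cnorm_sum _ _ _) _; apply: rsum_le => P _ _; rewrite CnormM.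
  apply: Rmult_le_compat_r; first exact: Cnorm_ge0.
  apply: (rsum_single (F := fun x => Cnorm (G x P)) (x := (kk j Q, j))).
    by move=> x _; apply: Cnorm_ge0.
  by apply: allpairs_f; rewrite mem_iota //; case: (kkP j Q).
have [psi [psi0 cpsi pp pp']] := inverse_exists phi0 phi1 cphi.
exists phi, psi; split=> // k kh.
apply: (defect_eq0 g0 gL gC gF (res := res) (kk := kk)) => //.
- by move=> j Q; case: (kkP j Q).
- by move=> Q /resP H _.
move=> j Q jn sQ dQ rQ; rewrite /phi solve_eq // -/phi /c (negbTE rQ).
rewrite -/(mu j Q); transitivity ((Complex.Cinv (mu j Q) * mu j Q) *
  higher n phi (g (kk j Q) j) Q)%cx; first by ring.
by rewrite CmulVx; [ring | apply: mu0].
Qed.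

(** * Conjugation and passage to the eigenbasis *)

Section Conjugation.
Variables (n : nat) (R R' : pmap).
Hypotheses (R0 : fix0 n R) (R0' : fix0 n R').
Hypotheses (RR' : meq n (pcomp n R R') (sid n)) (R'R : meq n (pcomp n R' R) (sid n)).

Definition conj_map F := pcomp n R' (pcomp n F R).

Lemma conj_fix0 F : fix0 n F -> fix0 n (conj_map F).
Proof. by move=> F0; do 2!apply: pcomp_fix0 => //. Qed.

Lemma conj_comp F G : fix0 n F -> fix0 n G ->
  meq n (pcomp n (conj_map F) (conj_map G)) (conj_map (pcomp n F G)).
Proof.
move=> F0 G0; have GR0 : fix0 n (pcomp n G R) by apply: pcomp_fix0.
have FR0 : fix0 n (pcomp n F R) by apply: pcomp_fix0.
have c0 : fix0 n (pcomp n R' (pcomp n G R)) by apply: pcomp_fix0.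
rewrite /conj_map -(pcompA R' FR0 c0) -(pcompA F R0 c0).
by rewrite (pcomp_cancel RR' R0' GR0) (pcompA F G0 R0).
Qed.

Lemma conj_meq F G : meq n F G -> meq n (conj_map F) (conj_map G).
Proof. by rewrite /conj_map => ->. Qed.

Lemma conj_id : meq n (conj_map (sid n)) (sid n).
Proof. by rewrite /conj_map pidcomp. Qed.

Lemma conj_formally_linearizable F : fix0 n F -> formally_linearizable n F ->
  formally_linearizable n (conj_map F).
Proof.
move=> F0 [p [q [p0 [q0 [qp [pq L]]]]]].
have p0' : fix0 n (pcomp n R' p) by apply: pcomp_fix0.
have q0' : fix0 n (pcomp n q R) by apply: pcomp_fix0.
have Fp0 : fix0 n (pcomp n F p) by apply: pcomp_fix0.
have FR0 : fix0 n (pcomp n F R) by apply: pcomp_fix0.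
exists (pcomp n R' p), (pcomp n q R); split=> //; split=> //.
split; first by rewrite -(pcompA q R0 p0') (pcomp_cancel RR' R0' p0).
split.
  rewrite -(pcompA R' p0 q0') (pcomp_cancel pq q0 R0); exact: R'R.
apply: is_linear_meq L; symmetry.
rewrite /conj_map -(pcompA R' FR0 p0') -(pcompA F R0 p0').
rewrite (pcomp_cancel RR' R0' p0) -(pcompA q R0); last exact: pcomp_fix0.
by rewrite (pcomp_cancel RR' R0' Fp0).
Qed.

End Conjugation.

Lemma eigenbasis_meq n (F : pmap) P lam :
  (forall i j, (i < n)%N -> (j < n)%N ->
     matmul n (linpart n F) P i j = (P i j * lam j)%cx) ->
  meq n (pcomp n (lin n (linpart n F)) (lin n P)) (pcomp n (lin n P) (dg n lam)).
Proof. by move=> H; rewrite lin_comp lin_dg; apply: lin_ext. Qed.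

Lemma conj_conj n R R' F : fix0 n R -> fix0 n R' -> meq n (pcomp n R R') (sid n) ->
  fix0 n F -> meq n (conj_map n R' R (conj_map n R R' F)) F.
Proof.
move=> R0 R0' RR' F0; rewrite /conj_map.
have FR0 : fix0 n (pcomp n F R) by apply: pcomp_fix0.
rewrite -(pcompA R' FR0 R0') -(pcompA F R0 R0') RR' pcompid.
exact: pcomp_cancel.
Qed.

Lemma linpart_conj n R R' F : fix0 n R -> fix0 n F ->
  meq n (lin n (linpart n (conj_map n R R' F)))
    (pcomp n (lin n (linpart n R')) (pcomp n (lin n (linpart n F)) (lin n (linpart n R)))).
Proof.
by move=> R0 F0; rewrite /conj_map !linpart_lin_comp //; apply: pcomp_fix0.
Qed.

(** After conjugation by [phi], both products are linear, hence determined by their linear parts.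
    These are conjugates of products of diagonal matrices in the basis [P], which commute; undoing
    the conjugation by [conj_conj] gives the claim for the germs. *)
Lemma linearizable_commute n h (f : nat -> pmap) P P' (Lam : nat -> nat -> C) :
  (forall k, (k < h)%N -> fix0 n (f k)) ->
  meq n (pcomp n (lin n P) (lin n P')) (sid n) ->
  meq n (pcomp n (lin n P') (lin n P)) (sid n) ->
  (forall k, (k < h)%N -> meq n (pcomp n (lin n (linpart n (f k))) (lin n P))
     (pcomp n (lin n P) (dg n (Lam k)))) ->
  simult_holo_linearizable n h f ->
  forall p q, (p < h)%N -> (q < h)%N ->
    meq n (pcomp n (f p) (f q)) (pcomp n (f q) (f p)).
Proof.
move=> f0 PP' P'P fP [phi [psi [phi0 [psi0 [_ [_ [pp' [pp L]]]]]]]].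
have dP' lam : fix0 n (pcomp n (dg n lam) (lin n P')) by apply: pcomp_fix0.
have lf k : (k < h)%N -> meq n (lin n (linpart n (f k)))
    (pcomp n (lin n P) (pcomp n (dg n (Lam k)) (lin n P'))).
  move=> kh; rewrite (pcompA _ (dg_fix0 _) (lin_fix0 _)) -fP //.
  by rewrite -(pcompA _ (lin_fix0 _) (lin_fix0 _)) PP' pcompid.
have lfM p q : (p < h)%N -> (q < h)%N ->
    meq n (lin n (linpart n (pcomp n (f p) (f q))))
      (pcomp n (lin n P) (pcomp n (pcomp n (dg n (Lam p)) (dg n (Lam q))) (lin n P'))).
  move=> ph qh; rewrite (linpart_lin_comp _ (f0 q qh)) !lf //.
  rewrite -(pcompA _ (dP' _)); last by apply: pcomp_fix0.
  rewrite -(pcompA (dg n (Lam p)) (lin_fix0 _)); last by apply: pcomp_fix0.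
  rewrite (pcomp_cancel P'P (lin_fix0 _) (dP' _)).
  by rewrite (pcompA _ (dg_fix0 _) (lin_fix0 _)).
have Llin p q : (p < h)%N -> (q < h)%N ->
    is_linear n (conj_map n phi psi (pcomp n (f p) (f q))).
  move=> ph qh; apply: is_linear_meq (conj_comp phi0 psi0 pp (f0 p ph) (f0 q qh)) _.
  apply: (is_linear_meq (F := lin n (matmul n (linpart n (conj_map n phi psi (f p)))
    (linpart n (conj_map n phi psi (f q)))))); last exact: is_linear_lin.
  rewrite -lin_comp; apply: pcomp_meq; apply/meq_sym/lin_linpart.
    by apply: L; apply/ltP.
  by apply: L; apply/ltP.
move=> p q ph qh.
have pq0 : fix0 n (pcomp n (f p) (f q)) by apply: pcomp_fix0; apply: f0.
have qp0 : fix0 n (pcomp n (f q) (f p)) by apply: pcomp_fix0; apply: f0.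
rewrite -(conj_conj phi0 psi0 pp pq0) -(conj_conj phi0 psi0 pp qp0).
apply: conj_meq; rewrite (lin_linpart (Llin p q ph qh)) (lin_linpart (Llin q p qh ph)).
by rewrite (linpart_conj _ phi0 pq0) (linpart_conj _ phi0 qp0) !lfM // dgC.
Qed.

(** Conjugation by the eigenbasis [P] preserves all hypotheses and makes the linear parts diagonal.
    The linearization found there is composed with [P] to return to the original coordinates. *)
Lemma commute_linearizable n h (f : nat -> pmap) P P' (Lam : nat -> nat -> C) :
  (0 < n)%N -> (0 < h)%N ->
  (forall k, (k < h)%N -> biholo n (f k)) ->
  (forall k, (k < h)%N -> formally_linearizable n (f k)) ->
  meq n (pcomp n (lin n P) (lin n P')) (sid n) ->
  meq n (pcomp n (lin n P') (lin n P)) (sid n) ->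
  (forall k, (k < h)%N -> meq n (pcomp n (lin n (linpart n (f k))) (lin n P))
     (pcomp n (lin n P) (dg n (Lam k)))) ->
  brjuno n h Lam ->
  (forall p q, (p < h)%N -> (q < h)%N ->
    meq n (pcomp n (f p) (f q)) (pcomp n (f q) (f p))) ->
  simult_holo_linearizable n h f.
Proof.
move=> n0 h0 fB fF PP' P'P fP br fC.
have f0 k : (k < h)%N -> fix0 n (f k) by move=> /fB [].
pose R := lin n P; pose R' := lin n P'; pose g k := conj_map n R R' (f k).
have R0 : fix0 n R := lin_fix0 P; have R0' : fix0 n R' := lin_fix0 P'.
have g0 k : (k < h)%N -> fix0 n (g k) by move=> kh; apply: conj_fix0 => //; apply: f0.
have [|||||phi [psi [[phi0 psi0] [cphi cpsi] pp' pp E]]] :=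
  @diagonal_linearization n h g Lam n0 h0 g0 _ _ _ _ _ br.
- move=> k kh; have [_ [cf _]] := fB k kh.
  apply: conv_pcomp; last exact: conv_lin.
    by apply: pcomp_fix0 => //; apply: f0.
  by apply: conv_pcomp => //; apply: conv_lin.
- move=> k kh; have [_ [_ [G [G0 [_ [Gf _]]]]]] := fB k kh.
  exists (conj_map n R R' G); rewrite (conj_comp R0 R0' PP' G0 (f0 k kh)).
  by rewrite (conj_meq _ _ Gf); apply: conj_id.
- move=> k j i kh jn lt_in.
  transitivity (lin n (linpart n (g k)) j (unitQ n i)); first by rewrite lin_unitQ.
  have H : meq n (lin n (linpart n (g k))) (dg n (Lam k)).
    rewrite (linpart_conj _ R0 (f0 k kh)) -(lin_linpart (is_linear_lin n P)).
    rewrite -(lin_linpart (is_linear_lin n P')) fP //.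
    by apply: (pcomp_cancel P'P) => //; apply: dg_fix0.
  by apply: H; [apply/ltP | apply: size_unitQ].
- move=> p q ph qh.
  rewrite (conj_comp R0 R0' PP' (f0 p ph) (f0 q qh)).
  rewrite (conj_comp R0 R0' PP' (f0 q qh) (f0 p ph)).
  by apply: conj_meq; apply: fC.
- by move=> k kh; apply: conj_formally_linearizable => //; [apply: f0 | apply: fF].
have Rphi0 : fix0 n (pcomp n R phi) by apply: pcomp_fix0.
have psiR0 : fix0 n (pcomp n psi R') by apply: pcomp_fix0.
exists (pcomp n R phi), (pcomp n psi R'); do 2!split=> //.
split; first by apply: conv_pcomp => //; apply: conv_lin.
split; first by apply: conv_pcomp => //; apply: conv_lin.
split; first by rewrite -(pcompA psi R0' Rphi0) (pcomp_cancel P'P R0 phi0).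
split; first by rewrite -(pcompA R phi0 psiR0) (pcomp_cancel pp psi0 R0').
move=> k /ltP kh; apply: is_linear_meq (dg_linear n (Lam k)).
have fR0 : fix0 n (pcomp n (f k) (pcomp n R phi)) by apply: pcomp_fix0 => //; apply: f0.
have fR : fix0 n (pcomp n (f k) R) by apply: pcomp_fix0 => //; apply: f0.
rewrite -(pcompA psi R0' fR0) (pcompA (f k) R0 phi0) (pcompA R' fR phi0).
rewrite -[pcomp n R' _]/(g k) E // (pcompA psi phi0 (dg_fix0 _)) pp'.
by rewrite pidcomp //; apply: dg_fix0.
Qed.

(** In the statement, [%nat] has to mean the order of Stdlib, not the boolean
    one of ssrnat. *)
Delimit Scope coq_nat_scope with nat.

Theorem theorem3p5 (n h : nat) (f : nat -> pmap) :
  (1 <= n)%nat -> (2 <= h)%nat ->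
  (forall k, (k < h)%nat -> biholo n (f k)) ->
  (forall k, (k < h)%nat -> formally_linearizable n (f k)) ->
  (exists P Lam, common_eigenbasis n h f P Lam /\ brjuno n h Lam) ->
  (simult_holo_linearizable n h f <->
   forall p q, (p < h)%nat -> (q < h)%nat ->
     meq n (pcomp n (f p) (f q)) (pcomp n (f q) (f p))).
Proof.
move=> /ltP n0 /leP h2 fB fF [P [Lam [[[P' PP'] fP] br]]].
have h0 : (0 < h)%N by apply: ltnW.
(* The entrywise identities of the eigenbasis are turned into identities between linear maps. *)
have e1 : meq n (pcomp n (lin n P) (lin n P')) (sid n).
  rewrite lin_comp -lin_id; apply: lin_ext => i j /ltP lt_in /ltP jn.
  by case: (PP' i j lt_in jn).
have e2 : meq n (pcomp n (lin n P') (lin n P)) (sid n).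
  rewrite lin_comp -lin_id; apply: lin_ext => i j /ltP lt_in /ltP jn.
  by case: (PP' i j lt_in jn).
have eP k : (k < h)%N -> meq n (pcomp n (lin n (linpart n (f k))) (lin n P))
     (pcomp n (lin n P) (dg n (Lam k))).
  move=> /ltP kh; apply: eigenbasis_meq => i j /ltP lt_in /ltP jn; exact: fP.
have fB' k : (k < h)%N -> biholo n (f k) by move=> /ltP; apply: fB.
split=> [L p q /ltP ph /ltP qh|fC].
  by apply: (linearizable_commute _ e1 e2 eP L ph qh) => k /fB' [].
apply: (commute_linearizable n0 h0 fB' _ e1 e2 eP br) => [k /ltP|p q /ltP ph /ltP qh].
  exact: fF.
exact: fC.
Qed.
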